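(* Let $N\ge 2$, let $R$ be an associative unitary ring, and let $j^\ast:\mathbf{K}_N(\mathrm{Flat}\text{-}R)\to \mathbf{K}_N(\mathrm{Prj}\text{-}R)$ be the right adjoint of the natural inclusion $j_{!}:\mathbf{K}_N(\mathrm{Prj}\text{-}R)\to\mathbf{K}_N(\mathrm{Flat}\text{-}R)$. Then the functor $j^\ast$ has a right adjoint functor.
   Context: $\mathrm{Mod}\text{-}R$ is the category of all left $R$-modules; $\mathrm{Prj}\text{-}R$ and $\mathrm{Flat}\text{-}R$ are its full subcategories of projective and of flat modules. The right adjoint $j^\ast$ of $j_!$ exists for every ring $R$. For an additive category $\mathcal{C}$, an $N$-complex is a sequence $\mathbf{X}=(X^i,d^i_{\mathbf X}:X^i\to X^{i+1})_{i\in\mathbb{Z}}$ in which the composite of any $N$ consecutive maps is $0$; morphisms are commuting families of maps. Write $d^i_{\mathbf{X},\{r\}}=d^{i+r-1}_{\mathbf X}\cdots d^i_{\mathbf X}$ and $d^i_{\mathbf{X},\{0\}}=1_{X^i}$. A morphism $f:\mathbf{X}\to\mathbf{Y}$ is null-homotopic if there are $s^i\in\operatorname{Hom}(X^i,Y^{i-N+1})$ with $f^i=\sum_{j=0}^{N-1} d_{\mathbf{Y},\{N-1-j\}}^{i-(N-1-j)}\,s^{i+j}\,d^{i}_{\mathbf{X},\{j\}}$ for all $i$. $\mathbf{K}_N(\mathcal{C})$ is the homotopy category of unbounded $N$-complexes over $\mathcal{C}$: objects are $N$-complexes, morphisms are morphisms of $N$-complexes modulo null-homotopic ones. *)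

(* Defs.v *)
From HB Require Import structures.
From mathcomp Require Import all_boot all_order all_algebra.
From mathcomp Require Import boolp functions prodnormedzmodule.
From mathcomp Require Import zify.

Set Implicit Arguments.
Unset Strict Implicit.
Unset Printing Implicit Defensive.
Import GRing.Theory.
Local Open Scope ring_scope.
Local Open Scope quotient_scope.

Record category := Category {
  obj :> Type;
  hom : obj -> obj -> Type;
  idm : forall x, hom x x;
  comp : forall x y z, hom y z -> hom x y -> hom x z;
  comp1m : forall x y (f : hom x y), comp (idm y) f = f;
  compm1 : forall x y (f : hom x y), comp f (idm x) = f;
  compA : forall x y z t (h : hom z t) (g : hom y z) (f : hom x y),
    comp h (comp g f) = comp (comp h g) f }.

Record functor (C D : category) := Functor {
  fobj :> C -> D;
  fmap : forall x y, hom x y -> hom (fobj x) (fobj y);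
  fmap1 : forall x, fmap (idm x) = idm (fobj x);
  fmapM : forall x y z (g : hom y z) (f : hom x y),
    fmap (comp g f) = comp (fmap g) (fmap f) }.

(* [adjunction F G]: F is left adjoint to G. *)
Record adjunction (C D : category) (F : functor C D) (G : functor D C) :=
  Adjunction {
  adj : forall (x : C) (y : D), hom (F x) y -> hom x (G y);
  adj_bij : forall x y, bijective (@adj x y);
  adj_nat : forall (x x' : C) (y y' : D)
      (u : hom x' x) (v : hom y y') (f : hom (F x) y),
    adj (comp v (comp f (fmap F u))) = comp (fmap G v) (comp (adj f) u) }.

Definition has_right_adjoint (C D : category) (F : functor C D) : Prop :=
  exists G : functor D C, inhabited (adjunction F G).

(* N-complexes and their homotopies only use the abelian group structure on
   homs, so no biproducts are asked for. *)
Record preadditive := Preadditive {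
  pobj :> Type;
  phom : pobj -> pobj -> zmodType;
  pid : forall x, phom x x;
  pcomp : forall x y z, phom y z -> phom x y -> phom x z;
  pcomp1m : forall x y (f : phom x y), pcomp (pid y) f = f;
  pcompm1 : forall x y (f : phom x y), pcomp f (pid x) = f;
  pcompA : forall x y z t (h : phom z t) (g : phom y z) (f : phom x y),
    pcomp h (pcomp g f) = pcomp (pcomp h g) f;
  pcompDl : forall x y z (g g' : phom y z) (f : phom x y),
    pcomp (g + g') f = pcomp g f + pcomp g' f;
  pcompDr : forall x y z (g : phom y z) (f f' : phom x y),
    pcomp g (f + f') = pcomp g f + pcomp g f' }.

Record additive_functor (C D : preadditive) := AdditiveFunctor {
  aobj :> C -> D;
  amap : forall x y, phom x y -> phom (aobj x) (aobj y);
  amap1 : forall x, amap (pid x) = pid (aobj x);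
  amapM : forall x y z (g : phom y z) (f : phom x y),
    amap (pcomp g f) = pcomp (amap g) (amap f);
  amapD : forall x y (f g : phom x y), amap (f + g) = amap f + amap g }.

Section PreadditiveTheory.
Variable C : preadditive.

Lemma pcomp0l (x y z : C) (f : phom x y) : pcomp (0 : phom y z) f = 0.
Proof. by apply: (addrI (pcomp 0 f)); rewrite -pcompDl !addr0. Qed.

Lemma pcomp0r (x y z : C) (g : phom y z) : pcomp g (0 : phom x y) = 0.
Proof. by apply: (addrI (pcomp g 0)); rewrite -pcompDr !addr0. Qed.

Lemma pcompNl (x y z : C) (g : phom y z) (f : phom x y) :
  pcomp (- g) f = - pcomp g f.
Proof. by apply: (addrI (pcomp g f)); rewrite -pcompDl !subrr pcomp0l. Qed.

Lemma pcompNr (x y z : C) (g : phom y z) (f : phom x y) :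
  pcomp g (- f) = - pcomp g f.
Proof. by apply: (addrI (pcomp g f)); rewrite -pcompDr !subrr pcomp0r. Qed.

Lemma pcomp_suml (x y z : C) n (g : 'I_n -> phom y z) (f : phom x y) :
  pcomp (\sum_(i < n) g i) f = \sum_(i < n) pcomp (g i) f.
Proof. apply: (big_morph (fun g => pcomp g f)); [move=> ? ?; exact: pcompDl | exact: pcomp0l]. Qed.

Lemma pcomp_sumr (x y z : C) n (g : phom y z) (f : 'I_n -> phom x y) :
  pcomp g (\sum_(i < n) f i) = \sum_(i < n) pcomp g (f i).
Proof. apply: (big_morph (fun f => pcomp g f)); [move=> ? ?; exact: pcompDr | exact: pcomp0r]. Qed.

Lemma amap0 (D : preadditive) (F : additive_functor C D) (x y : C) :
  amap F (0 : phom x y) = 0.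
Proof. by apply: (addrI (amap F 0)); rewrite -amapD !addr0. Qed.

Lemma amapN (D : preadditive) (F : additive_functor C D) (x y : C)
  (f : phom x y) : amap F (- f) = - amap F f.
Proof. by apply: (addrI (amap F f)); rewrite -amapD !subrr amap0. Qed.

Lemma amap_sum (D : preadditive) (F : additive_functor C D) (x y : C) n
    (f : 'I_n -> phom x y) :
  amap F (\sum_(i < n) f i) = \sum_(i < n) amap F (f i).
Proof. apply: (big_morph (fun f => amap F f)); [move=> ? ?; exact: amapD | exact: amap0]. Qed.

End PreadditiveTheory.

Lemma shift_step (i j : int) (r : nat) : i + r.+1%:Z = j -> i + 1 + r%:Z = j.
Proof. by move<-; rewrite intS addrA. Qed.

Lemma htpy_index (N : nat) (i : int) (j : 'I_N) :
  i + j%:Z - N%:Z + 1 + (N.-1 - j)%N%:Z = i.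
Proof.
by have := ltn_ord j; lia. Qed.

(* The composite of r consecutive differentials starting in degree i.  The end
   degree j is any integer provably equal to i + r, so that composites whose
   degrees agree only up to arithmetic (as in a homotopy) typecheck. *)
Definition deg_cast (C : preadditive) (X : int -> C) (i j : int) (e : i = j) :
  phom (X i) (X j) := ecast k (phom (X i) (X k)) e (pid (X i)).

Fixpoint dpow (C : preadditive) (X : int -> C)
    (d : forall i, phom (X i) (X (i + 1))) (r : nat) :
    forall i j : int, i + r%:Z = j -> phom (X i) (X j) :=
  match r with
  | 0 => fun i j e => deg_cast X (etrans (esym (addr0 i)) e)
  | r'.+1 => fun i j e => pcomp (dpow d (shift_step e)) (d i)
  end.

Record ncomplex (N : nat) (C : preadditive) := NComplex {
  nobj :> int -> C;
  ndiff : forall i, phom (nobj i) (nobj (i + 1));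
  ndiffN : forall i, dpow ndiff (erefl (i + N%:Z)) = 0 }.

Record nhom (N : nat) (C : preadditive) (X Y : ncomplex N C) := NHom {
  nmap :> forall i, phom (X i) (Y i);
  nmapC : forall i,
    pcomp (ndiff Y i) (nmap i) = pcomp (nmap (i + 1)) (ndiff X i) }.

Definition null_homotopic (N : nat) (C : preadditive) (X Y : ncomplex N C)
    (f : nhom X Y) : Prop :=
  exists s : forall i, phom (X i) (Y (i - N%:Z + 1)),
    forall i, f i = \sum_(j < N)
      pcomp (dpow (ndiff Y) (htpy_index i j))
        (pcomp (s (i + j%:Z)) (dpow (ndiff X) (erefl (i + j%:Z)))).

HB.instance Definition _ N C (X Y : ncomplex N C) := gen_eqMixin (nhom X Y).
HB.instance Definition _ N C (X Y : ncomplex N C) := gen_choiceMixin (nhom X Y).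

Section NComplexTheory.
Variables (N : nat) (C : preadditive).
Implicit Types X Y Z : ncomplex N C.

Lemma nhomP X Y (f g : nhom X Y) : (forall i, f i = g i) -> f = g.
Proof.
case: f g => [f fC] [g gC] /= fg; have {}fg : f = g by exact: functional_extensionality_dep.
by case: _ / fg gC => gC; congr NHom; exact: Prop_irrelevance.
Qed.

Definition nid X : nhom X X.
Proof. by exists (fun i => pid (X i)) => i; rewrite pcomp1m pcompm1. Defined.

Definition ncomp X Y Z (g : nhom Y Z) (f : nhom X Y) : nhom X Z.
Proof.
exists (fun i => pcomp (g i) (f i)) => i.
by rewrite pcompA nmapC -pcompA nmapC pcompA.
Defined.

Definition nsub X Y (f g : nhom X Y) : nhom X Y.
Proof.
exists (fun i => f i - g i) => i.
by rewrite pcompDl pcompDr pcompNl pcompNr !nmapC.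
Defined.

Lemma nmap_dpow X Y (f : nhom X Y) r i j (e : i + r%:Z = j) :
  pcomp (f j) (dpow (ndiff X) e) = pcomp (dpow (ndiff Y) e) (f i).
Proof.
elim: r i j e => [|r IH] i j e /=.
  by rewrite /deg_cast; case: _ / etrans => /=; rewrite pcomp1m pcompm1.
by rewrite pcompA IH -!pcompA nmapC.
Qed.

Definition homotopic X Y (f g : nhom X Y) : bool :=
  `[< null_homotopic (nsub f g) >].

Lemma homotopic_equiv X Y : equiv_class_of (@homotopic X Y).
Proof.
have sub_trans (f g h : nhom X Y) :
    homotopic f g -> homotopic h g -> homotopic f h.
  move=> /asboolP[s sE] /asboolP[t tE]; apply/asboolP.
  exists (fun i => s i - t i) => i.
  have -> : nsub f h i = nsub f g i - nsub h g i by rewrite /= opprB addrA subrK.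
  rewrite sE tE -sumrB; apply: eq_bigr => j _.
  by rewrite pcompDl pcompNl pcompDr pcompNr.
have refl (f : nhom X Y) : homotopic f f.
  apply/asboolP; exists (fun=> 0) => i /=.
  by rewrite subrr big1 // => j _; rewrite pcomp0l pcomp0r.
have sym (f g : nhom X Y) : homotopic f g -> homotopic g f by move=> fg; exact: sub_trans (refl g) fg.
split=> // [f g|g f h]; first by apply/idP/idP; exact: sym.
by move=> fg gh; apply: (sub_trans _ g) => //; exact: sym.
Qed.

Canonical homotopic_rel X Y := EquivRelPack (homotopic_equiv X Y).

Lemma homotopic_comp X Y Z (g g' : nhom Y Z) (f f' : nhom X Y) :
  homotopic g g' -> homotopic f f' -> homotopic (ncomp g f) (ncomp g' f').
Proof.
move=> gg' ff'; have [_ _ tr] := homotopic_equiv X Z.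
apply: (tr (ncomp g f')).
- move: ff' => /asboolP[s sE]; apply/asboolP.
  exists (fun i => pcomp (g _) (s i)) => i /=.
  rewrite -pcompNr -pcompDr [f i - f' i]sE pcomp_sumr; apply: eq_bigr => j _.
  by rewrite pcompA nmap_dpow -!pcompA.
- move: gg' => /asboolP[s sE]; apply/asboolP.
  exists (fun i => pcomp (s i) (f' i)) => i /=.
  rewrite -pcompNl -pcompDl [g i - g' i]sE pcomp_suml; apply: eq_bigr => j _.
  by rewrite -!pcompA -nmap_dpow.
Qed.

End NComplexTheory.

Section HomotopyCategory.
Variables (N : nat) (C : preadditive).
Implicit Types X Y Z : ncomplex N C.

Definition khom X Y := {eq_quot (@homotopic_rel N C X Y)}.

Lemma khomP X Y (f : khom X Y) : exists g, f = \pi_(khom X Y) g.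
Proof. by exists (repr f); rewrite reprK. Qed.

Definition kcomp X Y Z (g : khom Y Z) (f : khom X Y) : khom X Z :=
  \pi_(khom X Z) (ncomp (repr g) (repr f)).

Lemma kcompE X Y Z (g : nhom Y Z) (f : nhom X Y) :
  kcomp (\pi_(khom Y Z) g) (\pi_(khom X Y) f) = \pi_(khom X Z) (ncomp g f).
Proof.
apply/eqmodP; apply: homotopic_comp.
- by have /eqmodP := reprK (\pi_(khom Y Z) g).
- by have /eqmodP := reprK (\pi_(khom X Y) f).
Qed.

Definition K : category.
Proof.
refine (@Category (ncomplex N C) khom (fun X => \pi_(khom X X) (nid X)) kcomp _ _ _).
- move=> X Y f; have [{}f ->] := khomP f; rewrite kcompE; congr (\pi_ _ _).
  by apply: nhomP => i /=; rewrite pcomp1m.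
- move=> X Y f; have [{}f ->] := khomP f; rewrite kcompE; congr (\pi_ _ _).
  by apply: nhomP => i /=; rewrite pcompm1.
- move=> X Y Z T h g f; have [{}h ->] := khomP h.
  have [{}g ->] := khomP g; have [{}f ->] := khomP f.
  rewrite (kcompE g f) (kcompE h g) (kcompE h) (kcompE _ f); congr (\pi_ _ _).
  by apply: nhomP => i /=; rewrite pcompA.
Defined.

End HomotopyCategory.

Section InducedFunctor.
Variables (N : nat) (C D : preadditive) (F : additive_functor C D).

Lemma amap_dpow (X : int -> C) d r i j (e : i + r%:Z = j) :
  amap F (dpow (X := X) d e) = dpow (X := fun k => F (X k)) (fun k => amap F (d k)) e.
Proof.
elim: r i j e => [|r IH] i j e /=; last by rewrite amapM IH.
by rewrite /deg_cast; case: _ / etrans => /=; rewrite amap1.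
Qed.

Definition ncomplex_map (X : ncomplex N C) : ncomplex N D.
Proof.
exists (fun i => F (X i)) (fun i => amap F (ndiff X i)) => i.
by rewrite -amap_dpow ndiffN amap0.
Defined.

Definition nhom_map (X Y : ncomplex N C) (f : nhom X Y) :
  nhom (ncomplex_map X) (ncomplex_map Y).
Proof. by exists (fun i => amap F (f i)) => i /=; rewrite -!amapM nmapC. Defined.

Lemma homotopic_map (X Y : ncomplex N C) (f g : nhom X Y) :
  homotopic f g -> homotopic (nhom_map f) (nhom_map g).
Proof.
move=> /asboolP[s sE]; apply/asboolP; exists (fun i => amap F (s i)) => i /=.
rewrite -amapN -amapD [f i - g i]sE amap_sum; apply: eq_bigr => j _.
by rewrite !amapM !amap_dpow.
Qed.

Definition kmap (X Y : ncomplex N C) (f : khom X Y) :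
    khom (ncomplex_map X) (ncomplex_map Y) :=
  \pi_(khom (ncomplex_map X) (ncomplex_map Y)) (nhom_map (repr f)).

Lemma kmapE (X Y : ncomplex N C) (f : nhom X Y) :
  kmap (\pi_(khom X Y) f) =
  \pi_(khom (ncomplex_map X) (ncomplex_map Y)) (nhom_map f).
Proof.
apply/eqmodP; apply: homotopic_map.
by have /eqmodP := reprK (\pi_(khom X Y) f).
Qed.

Definition K_map : functor (K N C) (K N D).
Proof.
refine (@Functor (K N C) (K N D) ncomplex_map kmap _ _).
- move=> X; rewrite /= kmapE; congr (\pi_ _ _).
  by apply: nhomP => i /=; rewrite amap1.
- move=> X Y Z g f; have [{}g ->] := khomP g; have [{}f ->] := khomP f.
  rewrite /= (kcompE g f) !kmapE kcompE; congr (\pi_ _ _).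
  by apply: nhomP => i /=; rewrite amapM.
Defined.

End InducedFunctor.

Definition full_sub (C : preadditive) (P : C -> Prop) : preadditive :=
  @Preadditive {x : C | P x} (fun x y => phom (sval x) (sval y))
    (fun x => pid (sval x)) (fun x y z g f => pcomp g f)
    (fun x y f => pcomp1m f) (fun x y f => pcompm1 f)
    (fun x y z t h g f => pcompA h g f)
    (fun x y z g g' f => pcompDl g g' f)
    (fun x y z g f f' => pcompDr g f f').

Definition full_incl (C : preadditive) (P Q : C -> Prop)
    (PQ : forall x, P x -> Q x) : additive_functor (full_sub P) (full_sub Q) :=
  @AdditiveFunctor (full_sub P) (full_sub Q)
    (fun x => exist Q (sval x) (PQ _ (svalP x))) (fun x y f => f)
    (fun x => erefl) (fun x y z g f => erefl) (fun x y f g => erefl).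

Section LinearZmod.
Variables (R : pzRingType) (U V : lmodType R).
Implicit Types f g h : {linear U -> V}.

Lemma linear_eqP f g : f =1 g -> f = g.
Proof.
case: f g => [f cf] [g cg] /= fg.
have {}fg : f = g by exact: functional_extensionality_dep.
case: _ / fg cg => cg; congr GRing.Linear.Pack.
case: cf cg => [[[a0 aD]] [b]] [[[c0 cD]] [d]].
by rewrite (Prop_irrelevance a0 c0) (Prop_irrelevance aD cD) (Prop_irrelevance b d).
Qed.

Definition lin0 : {linear U -> V} := \0.
Definition linD f g : {linear U -> V} := f \+ g.
Definition linN f : {linear U -> V} := \- f.

Lemma linDA : associative linD.
Proof. by move=> f g h; apply: linear_eqP => x /=; rewrite addrA. Qed.
Lemma linDC : commutative linD.
Proof. by move=> f g; apply: linear_eqP => x /=; rewrite addrC. Qed.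
Lemma lin0D : left_id lin0 linD.
Proof. by move=> f; apply: linear_eqP => x /=; rewrite add0r. Qed.
Lemma linND : left_inverse lin0 linN linD.
Proof. by move=> f; apply: linear_eqP => x /=; rewrite addNr. Qed.

HB.instance Definition _ :=
  GRing.isZmodule.Build {linear U -> V} linDA linDC lin0D linND.

End LinearZmod.

Definition lmod_cat (R : pzRingType) : preadditive.
Proof.
refine (@Preadditive (lmodType R) (fun U V => {linear U -> V}) (fun U => idfun)
  (fun U V W g f => g \o f) _ _ _ _ _).
- by move=> U V f; exact: linear_eqP.
- by move=> U V f; exact: linear_eqP.
- by move=> U V W T h g f; exact: linear_eqP.
- by move=> U V W g g' f; exact: linear_eqP.
- by move=> U V W g f f'; apply: linear_eqP => x /=; rewrite linearD.
Defined.

Definition projective (R : pzRingType) (P : lmodType R) : Prop :=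
  forall (M M' : lmodType R) (g : {linear M -> M'}) (h : {linear P -> M'}),
    (forall y, exists x, g x = y) ->
    exists k : {linear P -> M}, forall x, g (k x) = h x.

(* A right R-module is a left R^c-module.  For a right module A and a left
   module M, the sequence [:: (a1, x1); ...; (ak, xk)] stands for the formal
   sum of the ai ⊗ xi, and [tensor_eq] is equality of such sums in A ⊗_R M:
   the quotient of [seq (A * M)] by it is the commutative monoid presented by
   the defining relations of the tensor product, which is a group because
   - (a ⊗ x) = (- a) ⊗ x. *)
Inductive tensor_eq (R : pzRingType) (A : lmodType R^c) (M : lmodType R) :
    seq (A * M) -> seq (A * M) -> Prop :=
| tensor_refl s : tensor_eq s s
| tensor_sym s t : tensor_eq s t -> tensor_eq t s
| tensor_trans s t u : tensor_eq s t -> tensor_eq t u -> tensor_eq s u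
| tensor_cat s s' t t' :
    tensor_eq s s' -> tensor_eq t t' -> tensor_eq (s ++ t) (s' ++ t')
| tensor_catC s t : tensor_eq (s ++ t) (t ++ s)
| tensor_0l x : tensor_eq [:: (0, x)] [::]
| tensor_Dl a b x : tensor_eq [:: (a + b, x)] [:: (a, x); (b, x)]
| tensor_Dr a x y : tensor_eq [:: (a, x + y)] [:: (a, x); (a, y)]
| tensor_bal (r : R) a x :
    tensor_eq [:: ((r : R^c) *: a, x)] [:: (a, r *: x)].

(* f ⊗ M on formal sums. *)
Definition tensor_map (R : pzRingType) (A B : lmodType R^c) (M : lmodType R)
    (f : {linear A -> B}) (s : seq (A * M)) : seq (B * M) :=
  [seq (f p.1, p.2) | p <- s].

(* - ⊗_R M maps exact sequences A -> B -> C to exact sequences. *)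
Definition flat (R : pzRingType) (M : lmodType R) : Prop :=
  forall (A B C : lmodType R^c) (f : {linear A -> B}) (g : {linear B -> C}),
    (forall b, g b = 0 <-> exists a, f a = b) ->
    forall t : seq (B * M),
      tensor_eq (tensor_map g t) [::] <->
      exists s : seq (A * M), tensor_eq (tensor_map f s) t.

Section ProjectiveFlat.
Variable R : pzRingType.

(* The free left module on a module P: finitely supported functions P -> R. *)
Section Free.
Variable P : lmodType R.
Notation fct := (P -> R^o).

Definition covers (s : seq P) (f : fct) : Prop :=
  forall x, x \notin s -> f x = 0.

Definition finite_supp : {pred fct} := fun f => `[< exists s, covers s f >].

Lemma finite_supp_submod : submod_closed finite_supp.
Proof.
split=> [|r f g /asboolP[s sf] /asboolP[t tg]].
  by apply/asboolP; exists [::].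
apply/asboolP; exists (s ++ t) => x; rewrite mem_cat negb_or => /andP[xs xt].
by rewrite [LHS]/(r * f x + g x) sf // tg // mulr0; exact: addr0.
Qed.

Record free := Free { free_val :> fct; free_valP : finite_supp free_val }.
HB.instance Definition _ := [isSub for free_val].
HB.instance Definition _ := [Choice of free by <:].
HB.instance Definition _ := GRing.SubChoice_isSubLmodule.Build R fct finite_supp
  free (GRing.submod_closed_semi finite_supp_submod).

Lemma free_coverP (f : free) : {s | uniq s & covers s f}.
Proof.
have /asboolP/cid[s sf] := free_valP f.
by exists (undup s); [exact: undup_uniq | move=> x; rewrite mem_undup => /sf].
Qed.

Definition free_eval (f : free) : P :=
  \sum_(x <- s2val (free_coverP f)) (f x : R) *: (x : P).

Lemma free_evalE (s : seq P) (f : free) :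
  uniq s -> covers s f -> free_eval f = \sum_(x <- s) (f x : R) *: x.
Proof.
rewrite /free_eval; case: free_coverP => t /= ut tf us sf.
have sub (u : seq P) : \sum_(x <- u) (f x : R) *: x =
    \sum_(x <- [seq x <- u | f x != 0]) (f x : R) *: x.
  rewrite big_filter [RHS]big_mkcond; apply: eq_bigr => x _.
  by case: eqP => //= ->; rewrite scale0r.
rewrite (sub t) (sub s); apply: perm_big; apply: uniq_perm; rewrite ?filter_uniq//.
move=> x; rewrite !mem_filter; case: eqP => //= /eqP fx0.
have [xt|/tf/eqP] := boolP (x \in t); last by rewrite (negPf fx0).
by have [xs|/sf/eqP] := boolP (x \in s); last by rewrite (negPf fx0).
Qed.

Lemma covers_free (fs : seq free) :
  exists2 s : seq P, uniq s & forall f, f \in fs -> covers s f.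
Proof.
elim: fs => [|f fs [s us sP]]; first by exists [::].
have [t ut tP] := free_coverP f.
exists (undup (t ++ s)); first exact: undup_uniq.
move=> g; rewrite in_cons => /orP[/eqP->|gfs] x.
  by rewrite mem_undup mem_cat negb_or => /andP[/tP].
by rewrite mem_undup mem_cat negb_or => /andP[_]; exact: sP.
Qed.

Lemma free_eval_linear : linear free_eval.
Proof.
move=> r f g; have [s us sP] := covers_free [:: r *: f + g; f; g].
rewrite !(free_evalE us (sP _ _)) ?inE ?eqxx ?orbT // scaler_sumr -big_split /=.
by apply: eq_bigr => x _; rewrite scalerA -scalerDl.
Qed.

HB.instance Definition _ :=
  GRing.isLinear.Build R free P *:%R free_eval free_eval_linear.

Lemma delta_supp (x : P) : finite_supp (fun y => (y == x)%:R : R^o).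
Proof. by apply/asboolP; exists [:: x] => y; rewrite inE => /negPf ->. Qed.

Lemma free_eval_surj (x : P) : exists f : free, free_eval f = x.
Proof.
exists (Free (delta_supp x)); rewrite (@free_evalE [:: x]) //.
  by rewrite big_seq1 /= eqxx scale1r.
by move=> y; rewrite inE => /negPf /= ->.
Qed.

End Free.

Lemma projective_section (P : lmodType R) : projective P ->
  exists k : {linear P -> free P}, forall x, free_eval (k x) = x.
Proof. by move=> /(_ _ _ (@free_eval P) idfun (@free_eval_surj P)). Qed.

Section Tensor.
Variables (A B : lmodType R^c) (M : lmodType R).
Implicit Types (s t : seq (A * M)).

Lemma tensor_map_eq (f : {linear A -> B}) s t :
  tensor_eq s t -> tensor_eq (tensor_map f s) (tensor_map f t).
Proof.
elim=> {s t}; rewrite /tensor_map.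
- by move=> s; exact: tensor_refl.
- by move=> s t _; exact: tensor_sym.
- by move=> s t u _ st _; exact: tensor_trans.
- by move=> s s' t t' _ ss' _ tt'; rewrite !map_cat; exact: tensor_cat.
- by move=> s t; rewrite !map_cat; exact: tensor_catC.
- by move=> x /=; rewrite linear0; exact: tensor_0l.
- by move=> a b x /=; rewrite linearD; exact: tensor_Dl.
- by move=> a x y; exact: tensor_Dr.
- by move=> r a x /=; rewrite linearZ; exact: tensor_bal.
Qed.

Lemma tensor_0r (a : A) : tensor_eq [:: (a, 0 : M)] [::].
Proof.
apply: tensor_trans (tensor_0l A (0 : M)).
have := tensor_bal (0 : R) a (0 : M).
by rewrite scaler0 (scale0r a) => /tensor_sym.
Qed.

Lemma tensor_cons p s t : tensor_eq s t -> tensor_eq (p :: s) (p :: t).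
Proof. by move=> st; apply: (tensor_cat (tensor_refl [:: p])). Qed.

Lemma tensor_all0 s : (forall p, p \in s -> p.1 = 0) -> tensor_eq s [::].
Proof.
elim: s => [|[a x] s IH] s0; first exact: tensor_refl.
have -> : a = 0 by exact: (s0 (a, x) (mem_head _ _)).
apply: (tensor_cat (tensor_0l A x)); apply: IH => p ps.
by apply: s0; rewrite in_cons ps orbT.
Qed.

Lemma tensor_sumr (a : A) (I : Type) (r : seq I) (x : I -> M) :
  tensor_eq [:: (a, \sum_(i <- r) x i)] [seq (a, x i) | i <- r].
Proof.
elim: r => [|i r IH] /=; first by rewrite big_nil; exact: tensor_0r.
rewrite big_cons; apply: tensor_trans (tensor_Dr _ _ _) _.
exact: tensor_cons.
Qed.

Lemma tensor_split (I : Type) (r : seq I) (a b : I -> A) (x : I -> M) :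
  tensor_eq [seq (a i + b i, x i) | i <- r]
    ([seq (a i, x i) | i <- r] ++ [seq (b i, x i) | i <- r]).
Proof.
elim: r => [|i r IH] /=; first exact: tensor_refl.
apply: tensor_trans (tensor_cat (tensor_Dl _ _ _) IH) _ => /=.
apply: tensor_cons.
have := tensor_cat (tensor_catC [:: (b i, x i)] [seq (a i, x i) | i <- r])
  (tensor_refl [seq (b i, x i) | i <- r]).
by rewrite -!catA.
Qed.

Lemma tensor_mapr (I : Type) (r : seq I) (p q : I -> A * M) :
  (forall i, tensor_eq [:: p i] [:: q i]) ->
  tensor_eq [seq p i | i <- r] [seq q i | i <- r].
Proof.
move=> pq; elim: r => [|i r IH] /=; first exact: tensor_refl.
exact: (tensor_cat (pq i) IH).
Qed.

End Tensor.

Section Coordinates.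
Variables (M : lmodType R) (k : {linear M -> free M}).
Hypothesis kK : forall x, free_eval (k x) = x.

Definition coord (A : lmodType R^c) (t : seq (A * M)) (p : M) : A :=
  \sum_(q <- t) (k q.2 p : R^c) *: q.1.

Lemma coord_eq (A : lmodType R^c) (s t : seq (A * M)) p :
  tensor_eq s t -> coord s p = coord t p.
Proof.
rewrite /coord; elim=> {s t} //.
- by move=> s t u _ -> _ ->.
- by move=> s s' t t' _ ss' _ tt'; rewrite !big_cat /= ss' tt'.
- by move=> s t; rewrite !big_cat /= addrC.
- by move=> x; rewrite big_seq1 big_nil scaler0.
- by move=> a b x; rewrite !big_cons !big_nil !addr0 scalerDr.
- by move=> a x y; rewrite !big_cons !big_nil !addr0 /= linearD -scalerDl.
- by move=> r a x; rewrite !big_seq1 /= linearZ scalerA.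
Qed.

Lemma coord_map (A B : lmodType R^c) (f : {linear A -> B}) (t : seq (A * M)) p :
  coord (tensor_map f t) p = f (coord t p).
Proof.
by rewrite /coord big_map linear_sum; apply: eq_bigr => q _; rewrite linearZ.
Qed.

Lemma coordE (A : lmodType R^c) (t : seq (A * M)) (s : seq M) : uniq s ->
  (forall q, q \in t -> covers s (k q.2)) ->
  tensor_eq t [seq (coord t p, p) | p <- s].
Proof.
move=> us; elim: t => [|[a x] t IH] ts.
  apply: tensor_sym; apply: tensor_all0 => q /mapP[p _ ->] /=.
  by rewrite /coord big_nil.
have -> : [seq (coord ((a, x) :: t) p, p) | p <- s] =
    [seq ((k x p : R^c) *: a + coord t p, p) | p <- s].
  by apply: eq_map => p; rewrite /coord big_cons.
apply: tensor_trans (tensor_sym (tensor_split _ _ _ _)).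
rewrite -cat1s; apply: tensor_cat; last first.
  by apply: IH => q qt; apply: ts; rewrite in_cons qt orbT.
rewrite -{1}(kK x) (free_evalE us (ts (a, x) (mem_head _ _))).
apply: tensor_trans (tensor_sumr _ _ _) _.
by apply: tensor_mapr => p; apply: tensor_sym; exact: tensor_bal.
Qed.

End Coordinates.

Lemma projective_flat (P : lmodType R) : projective P -> flat P.
Proof.
move=> /projective_section[k kK] A B C f g fg t; split; last first.
  move=> [s st].
  apply: tensor_trans (tensor_map_eq g (tensor_sym st)) _.
  apply: tensor_all0 => q /mapP[q' /mapP[q'' _ ->] ->] /=.
  by apply/fg; exists q''.1.
move=> gt0; have im p : exists a, f a = coord k t p.
  apply/fg; rewrite -coord_map (coord_eq k p gt0).
  by rewrite /coord big_nil.
have [a aE] := choice im.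
have [s us sP] := covers_free [seq k q.2 | q <- t].
exists [seq (a p, p) | p <- s].
apply: tensor_sym; apply: tensor_trans (coordE kK us _) _.
  by move=> q qt; apply: sP; exact: map_f.
rewrite /tensor_map -map_comp; under eq_map do rewrite -aE.
exact: tensor_refl.
Qed.

End ProjectiveFlat.

Definition Prj (R : pzRingType) : preadditive :=
  full_sub (C := lmod_cat R) (@projective R).

Definition Flat (R : pzRingType) : preadditive :=
  full_sub (C := lmod_cat R) (@flat R).

Definition j_shriek (N : nat) (R : pzRingType) : functor (K N (Prj R)) (K N (Flat R)) :=
  K_map N (full_incl (C := lmod_cat R) (@projective_flat R)).

(* Main.v *)
(* The functor jstar has a right adjoint as soon as each X in K_N(Prj) admits
   T in K_N(Flat) and a map X -> T inducing Hom(P, X) = Hom(P, T) for P in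
   K_N(Prj), and such that Hom(Y, T) -> Hom(j_! jstar Y, T) is bijective for Y
   in K_N(Flat).  The cones of the counits j_! jstar Y -> Y are the N-complexes
   of flat modules to which every complex of projectives maps null-homotopically;
   these turn out to be exactly the flat objects of the abelian category of
   N-complexes.  Flat objects are closed under direct sums and pure quotients,
   and each map from one of them factors through a flat object of bounded size,
   so every complex has a precover by a flat object; by Neeman's argument the
   precovers can be refined, up to homotopy, to a coreflection E of the
   suspension of X.  The homotopy fibre T of E -> Sigma X then receives only
   null-homotopic maps from flat objects, and X -> T has cone E. *)

Require Import Defs.
From HB Require Import structures.
From mathcomp Require Import all_boot all_order all_algebra.
From mathcomp Require Import boolp classical_sets.
From mathcomp Require Import zify.

Set Implicit Arguments.
Unset Strict Implicit.
Unset Printing Implicit Defensive.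
Import Order.TTheory GRing.Theory Num.Theory.
Local Open Scope ring_scope.

(** * Submodules and quotients *)

(** One obstacle is size. Flat objects over X do not form a set, and a precover can be a direct sum
    only if its index is a type. Each map Y -> X is therefore divided by a maximal pure subcomplex
    of its kernel; what remains is the image of a tree type depending on X alone, by an
    existential-closure argument. The other obstacle is uniqueness: removing the ambiguity of lifts
    to a precover produces an endomorphism that is idempotent only up to homotopy, which is why
    homotopy idempotents have to be split.

    Flat objects and complexes of projectives are tied by two constructions. A map from a degreewise
    free complex with countable basis to a flat object passes through a telescope of finite free
    complexes, with an obstruction on a syzygy that dies in a contractible complex; Zorn's lemma
    removes countability. Conversely, a relation in a degreewise flat Y is killed degree by degree
    in finite free modules, and these assemble to a complex of projectives through which the given
    map factors. *)

Definition mklin (R : pzRingType) (U V : lmodType R) (f : U -> V)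
    (fL : linear f) : {linear U -> V} :=
  HB.pack f (GRing.isLinear.Build R U V *:%R f fL).

Arguments mklin : simpl never.
Lemma mklinE (R : pzRingType) (U V : lmodType R) (f : U -> V) (fL : linear f) x :
  mklin fL x = f x.
Proof. by []. Qed.

Section DepProd.
Variables (R : pzRingType) (I : Type) (M : I -> lmodType R).

(** Direct sums below are submodules of finitely supported families in this product, so that
    equality of elements is pointwise. *)
Definition dprod := forall i, M i.
HB.instance Definition _ := gen_eqMixin dprod.
HB.instance Definition _ := gen_choiceMixin dprod.

Definition dp0 : dprod := fun i => 0.
Definition dpN (x : dprod) : dprod := fun i => - x i.
Definition dpD (x y : dprod) : dprod := fun i => x i + y i.
Definition dpZ (a : R) (x : dprod) : dprod := fun i => a *: x i.

Lemma dpext (x y : dprod) : (forall i, x i = y i) -> x = y.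
Proof. by move=> xy; exact: functional_extensionality_dep. Qed.

Fact dpDA : associative dpD.
Proof. by move=> x y z; apply: dpext => i; exact: addrA. Qed.
Fact dpDC : commutative dpD.
Proof. by move=> x y; apply: dpext => i; exact: addrC. Qed.
Fact dp0D : left_id dp0 dpD.
Proof. by move=> x; apply: dpext => i; exact: add0r. Qed.
Fact dpND : left_inverse dp0 dpN dpD.
Proof. by move=> x; apply: dpext => i; exact: addNr. Qed.
HB.instance Definition _ := GRing.isZmodule.Build dprod dpDA dpDC dp0D dpND.

Fact dpZA (a b : R) (x : dprod) : dpZ a (dpZ b x) = dpZ (a * b) x.
Proof. by apply: dpext => i; exact: scalerA. Qed.
Fact dpZ1 : left_id 1 dpZ.
Proof. by move=> x; apply: dpext => i; exact: scale1r. Qed.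
Fact dpZDr : right_distributive dpZ +%R.
Proof. by move=> a x y; apply: dpext => i; exact: scalerDr. Qed.
Fact dpZDl (x : dprod) : {morph dpZ^~ x : a b / a + b}.
Proof. by move=> a b; apply: dpext => i; exact: scalerDl. Qed.
HB.instance Definition _ :=
  GRing.Zmodule_isLmodule.Build R dprod dpZA dpZ1 dpZDr dpZDl.

Lemma dpED (x y : dprod) i : (x + y) i = x i + y i. Proof. by []. Qed.
Lemma dpEZ a (x : dprod) i : (a *: x) i = a *: x i. Proof. by []. Qed.

End DepProd.

Record submod (R : pzRingType) (M : lmodType R) := Submod {
  smem :> M -> Prop;
  smem0 : smem 0;
  smemD : forall x y, smem x -> smem y -> smem (x + y);
  smemZ : forall a x, smem x -> smem (a *: x) }.

Section Sub.
Variables (R : pzRingType) (M : lmodType R) (S : submod M).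

Lemma smemN x : S x -> S (- x).
Proof. by rewrite -scaleN1r; exact: smemZ. Qed.

Lemma smemB x y : S x -> S y -> S (x - y).
Proof. by move=> xS /smemN; exact: smemD. Qed.

Lemma smem_sum (I : Type) (r : seq I) (P : pred I) (F : I -> M) :
  (forall i, P i -> S (F i)) -> S (\sum_(i <- r | P i) F i).
Proof.
by move=> FS; apply: (big_ind S); [exact: smem0 | exact: smemD | exact: FS].
Qed.

Definition sm_pred : {pred M} := fun x => `[< S x >].

Lemma sm_closed : submod_closed sm_pred.
Proof.
split=> [|a x y /asboolP xS /asboolP yS]; apply/asboolP; first exact: smem0.
by apply: smemD => //; exact: smemZ.
Qed.

Record sub_of := SubOf { sub_val :> M; sub_valP : sm_pred sub_val }.
HB.instance Definition _ := [isSub for sub_val].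
HB.instance Definition _ := [Choice of sub_of by <:].
HB.instance Definition _ := GRing.SubChoice_isSubLmodule.Build R M sm_pred
  sub_of (GRing.submod_closed_semi sm_closed).

Lemma sub_mem (x : sub_of) : S x.
Proof. exact/asboolP/(sub_valP x). Qed.

Definition mksub (x : M) (xS : S x) : sub_of := SubOf (asboolT xS).

Lemma sub_ext (x y : sub_of) : sub_val x = sub_val y -> x = y.
Proof. exact: val_inj. Qed.

Lemma sub_valD (x y : sub_of) : sub_val (x + y) = sub_val x + sub_val y.
Proof. by []. Qed.
Lemma sub_valZ a (x : sub_of) : sub_val (a *: x) = a *: sub_val x.
Proof. by []. Qed.
Fact subv_linear : linear sub_val. Proof. by []. Qed.
Definition subv : {linear sub_of -> M} := mklin subv_linear.

Section Corestrict.
Variables (U : lmodType R) (f : {linear U -> M}) (fS : forall x, S (f x)).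
Fact corestr_linear : linear (fun x => mksub (fS x)).
Proof. by move=> a x y; apply: sub_ext => /=; rewrite linearP. Qed.
Definition corestr : {linear U -> sub_of} := mklin corestr_linear.
End Corestrict.

(* M / S, carried by a choice of one representative in each class. *)
Definition qcan (x : M) : M := xget 0 [set y | S (x - y)].

Lemma qcanP x : S (x - qcan x).
Proof.
rewrite /qcan; case: xgetP => [y -> //|/(_ x)]; case.
by rewrite /= subrr; exact: smem0.
Qed.

Lemma qcan_eq x y : S (x - y) -> qcan x = qcan y.
Proof.
move=> xy; rewrite /qcan; congr xget; apply/seteqP; split=> z /= zS.
  have -> : y - z = (x - z) - (x - y) by rewrite opprB [RHS]addrC addrA subrK.
  exact: smemB.
have -> : x - z = (x - y) + (y - z) by rewrite addrA subrK.
exact: smemD.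
Qed.

Lemma qcan_id x : qcan (qcan x) = qcan x.
Proof.
by apply: qcan_eq; rewrite -opprB; apply: smemN; exact: qcanP.
Qed.

Definition quot := {x : M | qcan x = x}.
HB.instance Definition _ := gen_eqMixin quot.
HB.instance Definition _ := gen_choiceMixin quot.

Definition qcl (x : M) : quot := exist _ (qcan x) (qcan_id x).
Definition qrep (x : quot) : M := sval x.

Lemma qrep_inj : injective qrep.
Proof.
case=> x xE [y yE] /= e; case: _ / e yE => yE.
by congr exist; exact: Prop_irrelevance.
Qed.

Lemma qrepK x : qcl (qrep x) = x.
Proof. by apply: qrep_inj; case: x. Qed.

Lemma qclP x y : qcl x = qcl y <-> S (x - y).
Proof.
split=> [/(congr1 qrep) /= xy|/qcan_eq xy]; last exact: qrep_inj.
have := smemB (qcanP x) (qcanP y); rewrite xy.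
by rewrite opprB addrA subrK.
Qed.

Lemma qclK x : S (qrep (qcl x) - x).
Proof. by rewrite -opprB; apply: smemN; exact: qcanP. Qed.

Definition q0 := qcl 0.
Definition qN x := qcl (- qrep x).
Definition qD x y := qcl (qrep x + qrep y).
Definition qZ a x := qcl (a *: qrep x).

Lemma qDE x y : qD (qcl x) (qcl y) = qcl (x + y).
Proof.
apply/qclP; rewrite opprD addrACA.
by apply: smemD; exact: qclK.
Qed.
Lemma qNE x : qN (qcl x) = qcl (- x).
Proof. by apply/qclP; rewrite -opprD; apply: smemN; exact: qclK. Qed.
Lemma qZE a x : qZ a (qcl x) = qcl (a *: x).
Proof. by apply/qclP; rewrite -scalerBr; apply: smemZ; exact: qclK. Qed.

Lemma quotP (P : quot -> Prop) : (forall x, P (qcl x)) -> forall x, P x.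
Proof. by move=> h x; rewrite -(qrepK x). Qed.

Fact qDA : associative qD.
Proof.
by elim/quotP=> x; elim/quotP=> y; elim/quotP=> z; rewrite !qDE addrA.
Qed.
Fact qDC : commutative qD.
Proof. by elim/quotP=> x; elim/quotP=> y; rewrite !qDE addrC. Qed.
Fact q0D : left_id q0 qD.
Proof. by elim/quotP=> x; rewrite qDE add0r. Qed.
Fact qND : left_inverse q0 qN qD.
Proof. by elim/quotP=> x; rewrite qNE qDE addNr. Qed.
HB.instance Definition _ := GRing.isZmodule.Build quot qDA qDC q0D qND.

Fact qZA (a b : R) x : qZ a (qZ b x) = qZ (a * b) x.
Proof. by elim/quotP: x => x; rewrite !qZE scalerA. Qed.
Fact qZ1 : left_id 1 qZ.
Proof. by elim/quotP=> x; rewrite qZE scale1r. Qed.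
Fact qZDr : right_distributive qZ +%R.
Proof.
by move=> a; elim/quotP=> x; elim/quotP=> y; rewrite [_ + _]qDE !qZE scalerDr
  [_ + _ in RHS]qDE.
Qed.
Fact qZDl x : {morph qZ^~ x : a b / a + b}.
Proof.
by move=> a b; elim/quotP: x => x /=; rewrite !qZE scalerDl [_ + _ in RHS]qDE.
Qed.
HB.instance Definition _ :=
  GRing.Zmodule_isLmodule.Build R quot qZA qZ1 qZDr qZDl.

Fact qcl_linear : linear qcl.
Proof.
by move=> a x y; rewrite -[RHS]/(qD (qZ a (qcl x)) (qcl y)) qZE qDE.
Qed.
Definition qpi : {linear M -> quot} := mklin qcl_linear.

Lemma qpi_eq0 x : qpi x = 0 <-> S x.
Proof. by rewrite -[0]/(qcl 0) [_ = _]qclP subr0. Qed.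

Lemma qpi_surj y : exists x, qpi x = y.
Proof. by exists (qrep y); exact: qrepK. Qed.

Section Lift.
Variables (U : lmodType R) (f : {linear M -> U}) (fS : forall x, S x -> f x = 0).
Definition qlift_fun (x : quot) := f (qrep x).
Fact qliftE0 x : qlift_fun (qcl x) = f x.
Proof. by apply/eqP; rewrite -subr_eq0 -linearB fS //; exact: qclK. Qed.
Fact qlift_linear : linear qlift_fun.
Proof.
move=> a; elim/quotP=> x; elim/quotP=> y.
have -> : a *: qcl x + qcl y = qcl (a *: x + y) by rewrite qcl_linear.
by rewrite !qliftE0 linearP.
Qed.
Definition qlift : {linear quot -> U} := mklin qlift_linear.
Lemma qliftE x : qlift (qpi x) = f x. Proof. exact: qliftE0. Qed.
End Lift.

End Sub.

(** * N-complexes and homotopies *)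

Section WindowSum.
Variable V : nmodType.

Definition wsum (a : int) (n : nat) (F : int -> V) := \sum_(j < n) F (a + j%:Z).

Lemma wsum_sub (a c : int) (n k : nat) (F : int -> V) :
  c <= a -> a + n%:Z <= c + k%:Z ->
  (forall i, ~~ ((a <= i) && (i < a + n%:Z)) -> F i = 0) ->
  wsum c k F = wsum a n F.
Proof.
move=> ca ac F0; rewrite /wsum.
have [p pE] : exists p : nat, a = c + p%:Z by exists `|a - c|%N; lia.
have [q qE] : exists q : nat, k = (p + n + q)%N by exists (k - p - n)%N; lia.
rewrite qE !big_split_ord /= big1 ?add0r => [|i _]; last first.
  by apply: F0; have := ltn_ord i; lia.
rewrite [X in _ + X]big1 ?addr0 => [|i _].
  by apply: eq_bigr => i _; rewrite pE; congr F; lia.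
by apply: F0; have := ltn_ord i; lia.
Qed.

(** Both sums equal the sum over one window containing the two. This lets the range of a trace be
    moved. *)
Lemma eq_wsum (a b : int) (n k : nat) (F : int -> V) :
  (forall i, ~~ ((a <= i) && (i < a + n%:Z)) -> F i = 0) ->
  (forall i, ~~ ((b <= i) && (i < b + k%:Z)) -> F i = 0) ->
  wsum a n F = wsum b k F.
Proof.
move=> Fa Fb; pose c := Order.min a b; pose l := (`|a - b| + n + k)%N.
have [ca cb] : c <= a /\ c <= b by rewrite /c !ge_min !lexx orbT.
have cE : c = a \/ c = b by rewrite /c /Order.min; case: ifP; [left|right].
rewrite -(@wsum_sub a c n l) //; last by case: cE => ->; lia.
by rewrite (@wsum_sub b c k l) //; case: cE => ->; lia.
Qed.

End WindowSum.

Section Complexes.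
Variables (N : nat) (R : pzRingType).

(* An N-complex with all the composites of differentials: [dif X i j] is the
   composite X^i -> X^j when i <= j < i + N, and 0 otherwise. *)
Record cx := Cx {
  car :> int -> lmodType R;
  dif : forall i j, {linear car i -> car j};
  dif_comp : forall i j k x, i <= j -> j <= k ->
    dif j k (dif i j x) = dif i k x;
  dif_out : forall i j x, ~~ ((i <= j) && (j < i + N%:Z)) -> dif i j x = 0;
  dif_id : forall i x, dif i i x = x }.

Record chom (X Y : cx) := CHom {
  cmap :> forall i, {linear X i -> Y i};
  cmapD : forall i j x, cmap j (dif X i j x) = dif Y i j (cmap i x) }.

Definition gmap (X Y : int -> lmodType R) := forall i, {linear X i -> Y i}.

Section Ops.
Variables X Y Z : cx.
Fact idc_D i j x : @idfun (X j) (dif X i j x) = dif X i j (@idfun (X i) x).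
Proof. by []. Qed.
Definition idc : chom X X := @CHom X X (fun i => idfun) idc_D.

Fact ccomp_D (g : chom Y Z) (f : chom X Y) i j x :
  (g j \o f j) (dif X i j x) = dif Z i j ((g i \o f i) x).
Proof. by rewrite /= !cmapD. Qed.
Definition ccomp (g : chom Y Z) (f : chom X Y) : chom X Z :=
  @CHom X Z (fun i => g i \o f i) (@ccomp_D g f).

Fact c0_D i j x : (\0 : {linear X j -> Y j}) (dif X i j x) =
  dif Y i j ((\0 : {linear X i -> Y i}) x).
Proof. by rewrite /= linear0. Qed.
Definition c0 : chom X Y := @CHom X Y (fun i => \0) c0_D.

Fact cadd_D (f g : chom X Y) i j x :
  (f j \+ g j) (dif X i j x) = dif Y i j ((f i \+ g i) x).
Proof. by rewrite /= !cmapD linearD. Qed.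
Definition cadd (f g : chom X Y) : chom X Y := @CHom X Y (fun i => f i \+ g i) (@cadd_D f g).

Fact csub_D (f g : chom X Y) i j x :
  (f j \- g j) (dif X i j x) = dif Y i j ((f i \- g i) x).
Proof. by rewrite /= !cmapD linearB. Qed.
Definition csub (f g : chom X Y) : chom X Y := @CHom X Y (fun i => f i \- g i) (@csub_D f g).
End Ops.

Lemma ccompE (X Y Z : cx) (g : chom Y Z) (f : chom X Y) i x :
  ccomp g f i x = g i (f i x).
Proof. by []. Qed.
Lemma caddE (X Y : cx) (f g : chom X Y) i x : cadd f g i x = f i x + g i x.
Proof. by []. Qed.
Lemma csubE (X Y : cx) (f g : chom X Y) i x : csub f g i x = f i x - g i x.
Proof. by []. Qed.

Definition hmap (X Y : cx) := forall k : int, {linear X k -> Y (k - N%:Z + 1)}.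

Section Trace.
Variables (X Y : cx) (s : hmap X Y).

(** The summand of the null-homotopy formula that applies s in degree k. As [dif] is total it makes
    sense for every k, and it vanishes outside [i <= k < i + N]. *)
Definition tr_term i (x : X i) (k : int) : Y i :=
  dif Y (k - N%:Z + 1) i (s k (dif X i k x)).

Definition tr i (x : X i) : Y i := wsum i N (tr_term x).

Lemma tr_term0 i (x : X i) k : ~~ ((i <= k) && (k < i + N%:Z)) -> tr_term x k = 0.
Proof. by move=> ik; rewrite /tr_term (dif_out _ ik) !linear0. Qed.

Fact tr_linear i : linear (@tr i).
Proof.
move=> a x y; rewrite /tr /wsum scaler_sumr -big_split; apply: eq_bigr => j _.
by rewrite /tr_term !linearP.
Qed.

(** Applying the differential from i to j only moves the window of summands from i to j: the
    summands gained or lost pass through N or more consecutive differentials. *)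
Fact tr_D i j x :
  mklin (@tr_linear j) (dif X i j x) = dif Y i j (mklin (@tr_linear i) x).
Proof.
rewrite [LHS]/(tr _) [in RHS]/(mklin _) /= /tr /wsum linear_sum /=.
have [ij|ij] := boolP (i <= j); last first.
  rewrite [LHS]big1 => [|k _]; last first.
    by rewrite /tr_term (@dif_out _ i j) ?linear0 //; lia.
  by rewrite [RHS]big1 // => k _; rewrite dif_out //; lia.
(* If s lands above degree i, the differentials of Y do not compose, but then x has already been
   pushed at least N steps and is 0. *)
transitivity (wsum j N (fun k => dif Y i j (tr_term x k))).
  apply: eq_bigr => k _; rewrite /tr_term dif_comp //; last by lia.
  have [kj|kj] := boolP (j + k%:Z - N%:Z + 1 <= i); last first.
    by rewrite (@dif_out X i) ?linear0 //; lia.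
  by rewrite dif_comp.
apply: (@eq_wsum _ _ _ _ _ (fun k => dif Y i j (tr_term x k))) => k kN.
  have [/negPf ik|] := boolP (~~ ((i <= k) && (k < i + N%:Z))).
    by rewrite tr_term0 ?ik ?linear0.
  move=> /negPn ik; rewrite /tr_term.
  rewrite dif_comp //; last by lia.
  by rewrite dif_out //; lia.
by rewrite tr_term0 // linear0.
Qed.

Definition trc : chom X Y := @CHom X Y (fun i => mklin (@tr_linear i)) tr_D.
Lemma trcE i x : trc i x = tr x. Proof. by []. Qed.
End Trace.
Arguments trc : simpl never.

Definition nullh (X Y : cx) (f : chom X Y) :=
  exists s : hmap X Y, forall i x, f i x = trc s i x.

Lemma nullh_eq X Y (f g : chom X Y) :
  (forall i x, f i x = g i x) -> nullh f -> nullh g.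
Proof. by move=> fg [s sE]; exists s => i x; rewrite -fg. Qed.

Lemma nullh_tr X Y s : nullh (@trc X Y s). Proof. by exists s. Qed.

Lemma nullh0 X Y : nullh (c0 X Y).
Proof.
exists (fun i => \0) => i x /=; rewrite ?trcE /tr /wsum big1 // => j _.
by rewrite /tr_term /= linear0.
Qed.

Lemma nullhD X Y (f g : chom X Y) : nullh f -> nullh g -> nullh (cadd f g).
Proof.
move=> [s sE] [t tE]; exists (fun i => s i \+ t i) => i x /=.
rewrite sE tE ?trcE /tr /wsum -big_split; apply: eq_bigr => j _.
by rewrite /tr_term /= linearD.
Qed.

Lemma nullhB X Y (f g : chom X Y) : nullh f -> nullh g -> nullh (csub f g).
Proof.
move=> [s sE] [t tE]; exists (fun i => s i \- t i) => i x /=.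
rewrite sE tE ?trcE /tr /wsum -sumrB; apply: eq_bigr => j _.
by rewrite /tr_term /= linearB.
Qed.

Lemma nullh_compl X Y Z (g : chom Y Z) (f : chom X Y) :
  nullh f -> nullh (ccomp g f).
Proof.
move=> [s sE]; exists (fun i => g (i - N%:Z + 1) \o s i) => i x /=.
rewrite sE ?trcE /tr /wsum linear_sum; apply: eq_bigr => j _.
by rewrite /tr_term /= cmapD.
Qed.

Lemma nullh_compr X Y Z (g : chom Y Z) (f : chom X Y) :
  nullh g -> nullh (ccomp g f).
Proof.
move=> [s sE]; exists (fun i => s i \o f i) => i x /=.
rewrite sE ?trcE /tr /wsum; apply: eq_bigr => j _.
by rewrite /tr_term /= cmapD.
Qed.

Definition hteq X Y (f g : chom X Y) := nullh (csub f g).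

Lemma hteq_eq X Y (f g : chom X Y) : (forall i x, f i x = g i x) -> hteq f g.
Proof. by move=> fg; apply: nullh_eq (nullh0 X Y) => i x /=; rewrite fg subrr. Qed.

Lemma hteq_sym X Y (f g : chom X Y) : hteq f g -> hteq g f.
Proof.
move=> fg; apply: nullh_eq (nullhB (nullh0 X Y) fg) => i x /=.
by rewrite add0r opprB.
Qed.

Lemma hteq_trans X Y (g f h : chom X Y) : hteq f g -> hteq g h -> hteq f h.
Proof.
move=> fg gh; apply: nullh_eq (nullhD fg gh) => i x /=.
by rewrite addrA subrK.
Qed.

Lemma hteq_compl X Y Z (g : chom Y Z) (f f' : chom X Y) :
  hteq f f' -> hteq (ccomp g f) (ccomp g f').
Proof. by move/(nullh_compl g); apply: nullh_eq => i x /=; rewrite linearB. Qed.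

Lemma hteq_compr X Y Z (g g' : chom Y Z) (f : chom X Y) :
  hteq g g' -> hteq (ccomp g f) (ccomp g' f).
Proof. by move/(@nullh_compr _ _ _ _ f); apply: nullh_eq. Qed.

Lemma hteq_nullh X Y (f g : chom X Y) : hteq f g -> nullh g -> nullh f.
Proof.
by move=> fg /(nullhD fg); apply: nullh_eq => i x /=; rewrite subrK.
Qed.

(* A null-homotopic map Tr(s) extends along a degreewise split mono with
   retraction r as Tr(s r). *)
Lemma nullh_ext A B Z (m : chom A B) (r : gmap B A) (h : chom A Z) :
  (forall i x, r i (m i x) = x) -> nullh h ->
  exists2 h' : chom B Z, nullh h' & forall i x, h' i (m i x) = h i x.
Proof.
move=> rm [s sE]; exists (trc (fun i => s i \o r i)); first exact: nullh_tr.
move=> i x; rewrite sE ?trcE /tr /wsum; apply: eq_bigr => j _.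
by rewrite /tr_term /= -cmapD rm.
Qed.

(** Dual of the extension property: Tr(s) lifts along a degreewise split epi with section q as Tr(q
    s). *)
Lemma nullh_lift B C Z (p : chom B C) (q : gmap C B) (h : chom Z C) :
  (forall i x, p i (q i x) = x) -> nullh h ->
  exists2 h' : chom Z B, nullh h' & forall i x, p i (h' i x) = h i x.
Proof.
move=> pq [s sE]; exists (trc (fun i => q (i - N%:Z + 1) \o s i)).
  exact: nullh_tr.
move=> i x; rewrite sE ?trcE /tr /wsum linear_sum; apply: eq_bigr => j _.
by rewrite /tr_term /= cmapD pq.
Qed.

Lemma contr_to X Y (f : chom X Y) : nullh (idc Y) -> nullh f.
Proof. by move/(@nullh_compr _ _ _ _ f); apply: nullh_eq. Qed.

Lemma contr_from X Y (f : chom X Y) : nullh (idc X) -> nullh f.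
Proof. by move/(nullh_compl f); apply: nullh_eq. Qed.

(** The null-homotopic difference between [r m] and the identity extends along m, and subtracting
    the extension from r makes the retraction strict. *)
Lemma strict_retr A B (m : chom A B) (rg : gmap B A) (r : chom B A) :
  (forall i x, rg i (m i x) = x) -> hteq (ccomp r m) (idc A) ->
  exists2 r' : chom B A, hteq r' r & forall i x, r' i (m i x) = x.
Proof.
move=> rgm /(nullh_ext rgm)[n n0 nE]; exists (csub r n) => [|i x /=].
  apply: nullh_eq (nullhB (nullh0 _ _) n0) => i x /=.
  by rewrite add0r [RHS]addrC addKr.
by rewrite nE /= opprB addrC subrK.
Qed.

End Complexes.

(** * Sums of disks *)

Section FiniteSupport.
Variables (R : pzRingType) (I : choiceType) (M : I -> lmodType R).
Implicit Types (v w : dprod M) (s : seq I).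

Definition cov s v := forall i, i \notin s -> v i = 0.
Definition fsupp v := exists s, cov s v.

Lemma cov_cat s t v : cov s v -> cov (s ++ t) v /\ cov (t ++ s) v.
Proof.
by move=> vs; split=> i; rewrite mem_cat negb_or => /andP[? ?]; exact: vs.
Qed.

Lemma cov_undup s v : cov s v -> cov (undup s) v.
Proof. by move=> vs i; rewrite mem_undup; exact: vs. Qed.

Lemma covD s v w : cov s v -> cov s w -> cov s (v + w).
Proof. by move=> vs ws i si; rewrite dpED vs // ws // addr0. Qed.

Lemma covZ s a v : cov s v -> cov s (a *: v).
Proof. by move=> vs i si; rewrite dpEZ vs // scaler0. Qed.

Lemma fsupp0 : fsupp 0. Proof. by exists [::]. Qed.

Lemma fsuppD v w : fsupp v -> fsupp w -> fsupp (v + w).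
Proof.
move=> [s vs] [t wt]; exists (s ++ t).
by apply: covD; [case: (cov_cat t vs) | case: (cov_cat s wt)].
Qed.

Lemma fsuppZ a v : fsupp v -> fsupp (a *: v).
Proof. by move=> [s vs]; exists s; exact: covZ. Qed.

Definition dsingle i (x : M i) : dprod M := fun j =>
  if i =P j is ReflectT e then ecast k (M k) e x else 0.

Lemma dsingle_eq i (x : M i) : dsingle x i = x.
Proof. by rewrite /dsingle; case: eqP => // e; rewrite (eq_axiomK e). Qed.

Lemma dsingle_neq i (x : M i) j : i != j -> dsingle x j = 0.
Proof. by rewrite /dsingle; case: eqP. Qed.

Lemma dsingle_linear i : linear (@dsingle i).
Proof.
move=> a x y; apply: dpext => j; rewrite dpED dpEZ.
have [<-|ij] := eqVneq i j; first by rewrite !dsingle_eq.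
by rewrite !dsingle_neq // scaler0 addr0.
Qed.

Lemma fsupp_single i (x : M i) : fsupp (dsingle x).
Proof. by exists [:: i] => j; rewrite inE eq_sym; exact: dsingle_neq. Qed.

Lemma dsum_single s v : uniq s -> cov s v -> v = \sum_(i <- s) dsingle (v i).
Proof.
move=> us vs; apply: dpext => i.
have -> : (\sum_(j <- s) dsingle (v j)) i = \sum_(j <- s) dsingle (v j) i.
  by elim/big_rec2: _ => // j y1 y2 _ <-.
have [si|si] := boolP (i \in s).
  rewrite (bigD1_seq i) //= dsingle_eq big1 ?addr0 // => j ij.
  exact: dsingle_neq.
rewrite vs // big_seq big1 // => j sj; apply: dsingle_neq.
by apply: contraNneq si => <-.
Qed.

Section FSum.
Variables (V : lmodType R) (h : forall i, {linear M i -> V}).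

(** Any duplicate-free list covering the support gives the same value ([fsumE]); a family without
    finite support is sent to 0 by the empty default list. *)
Definition fsum v := \sum_(i <- xget [::] [set s | uniq s /\ cov s v]) h i (v i).

Lemma fsumE s v : uniq s -> cov s v -> fsum v = \sum_(i <- s) h i (v i).
Proof.
move=> us vs; rewrite /fsum; case: xgetP => [t _ [ut vt]|/(_ s)]; last by case.
have sub u : \sum_(i <- u) h i (v i) = \sum_(i <- [seq i <- u | v i != 0]) h i (v i).
  rewrite big_filter [RHS]big_mkcond; apply: eq_bigr => i _.
  by case: eqP => //= ->; rewrite linear0.
rewrite (sub t) (sub s); apply/perm_big/uniq_perm; rewrite ?filter_uniq //.
move=> i; rewrite !mem_filter; case: eqP => //= /eqP v0.
have [it|/vt/eqP] := boolP (i \in t); last by rewrite (negPf v0).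
by have [//|/vs/eqP] := boolP (i \in s); rewrite (negPf v0).
Qed.

Lemma fsumP a v w : fsupp v -> fsupp w -> fsum (a *: v + w) = a *: fsum v + fsum w.
Proof.
move=> [s vs] [t wt]; pose u := undup (s ++ t).
have vu : cov u v by apply: cov_undup; case: (cov_cat t vs).
have wu : cov u w by apply: cov_undup; case: (cov_cat s wt).
have uu : uniq u by exact: undup_uniq.
rewrite !(fsumE uu) //; last by apply: covD => //; exact: covZ.
rewrite scaler_sumr -big_split; apply: eq_bigr => i _.
by rewrite dpED dpEZ linearP.
Qed.

Lemma fsum_single i (x : M i) : fsum (dsingle x) = h i x.
Proof.
rewrite (@fsumE [:: i]) ?big_seq1 ?dsingle_eq // => j.
by rewrite inE eq_sym; exact: dsingle_neq.
Qed.

End FSum.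
End FiniteSupport.

Section Disk.
Variables (N : nat) (R : pzRingType).
Variables (I : choiceType) (deg : I -> int) (M : I -> lmodType R).
Local Notation win i n := ((deg i <= n) && (n < deg i + N%:Z)).

(* [disk] is the direct sum over i of the N-complexes M_i = ... = M_i living
   in the degrees deg i, ..., deg i + N - 1. *)
Definition disk_mem (n : int) (v : dprod M) :=
  fsupp v /\ forall i, ~~ win i n -> v i = 0.

Program Definition disk_sm n : submod (dprod M) := @Submod _ _ (disk_mem n) _ _ _.
Next Obligation. by split; [exact: fsupp0|]. Qed.
Next Obligation.
move=> n v w [vf v0] [wf w0]; split=> [|i i0]; first exact: fsuppD.
by rewrite dpED v0 ?w0 ?addr0.
Qed.
Next Obligation.
move=> n a v [vf v0]; split=> [|i i0]; first exact: fsuppZ.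
by rewrite dpEZ v0 ?scaler0.
Qed.

Definition disk_car n : lmodType R := sub_of (disk_sm n).

Definition restr (P : pred I) (v : dprod M) : dprod M :=
  fun i => if P i then v i else 0.

Lemma restr_linear P : linear (restr P).
Proof.
move=> a v w; apply: dpext => i; rewrite dpED dpEZ /restr.
by case: ifP; rewrite // scaler0 addr0.
Qed.

Lemma fsupp_restr P v : fsupp v -> fsupp (restr P v).
Proof. by move=> [s vs]; exists s => i si; rewrite /restr vs //; case: ifP. Qed.

Definition dskd (n m : int) (v : dprod M) : dprod M :=
  restr (fun i => (n <= m) && (m < deg i + N%:Z)) v.

Lemma dskd_mem n m v : disk_mem n v -> disk_mem m (dskd n m v).
Proof.
move=> [vf v0]; split=> [|i i0]; first exact: fsupp_restr.
by rewrite /dskd /restr; case: ifP => // /andP[nm mi]; apply: v0; lia.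
Qed.

Fact disk_dif_linear n m :
  linear (fun v : disk_car n => mksub (S := disk_sm m) (dskd_mem m (sub_mem v)) : disk_car m).
Proof. by move=> a v w; apply: sub_ext => /=; exact: restr_linear. Qed.

Definition disk_dif n m : {linear disk_car n -> disk_car m} :=
  mklin (@disk_dif_linear n m).

Lemma disk_out n (v : disk_car n) i : ~~ win i n -> sub_val v i = 0.
Proof. by have [_] := sub_mem v; apply. Qed.

Lemma disk_difE n m v i : sub_val (disk_dif n m v) i =
  if (n <= m) && (m < deg i + N%:Z) then sub_val v i else 0.
Proof. by []. Qed.

Fact disk_dif_comp (n m p : int) v : n <= m -> m <= p ->
  disk_dif m p (disk_dif n m v) = disk_dif n p v.
Proof.
move=> nm mp; apply: sub_ext; apply: dpext => i; rewrite !disk_difE.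
by repeat (case: ifP => ? //); lia.
Qed.
Fact disk_dif_out (n m : int) v : ~~ ((n <= m) && (m < n + N%:Z)) ->
  disk_dif n m v = 0.
Proof.
move=> nm; apply: sub_ext; apply: dpext => i; rewrite !disk_difE.
by case: ifP => // mi; apply: disk_out; lia.
Qed.
Fact disk_dif_id n v : disk_dif n n v = v.
Proof.
apply: sub_ext; apply: dpext => i; rewrite !disk_difE.
by case: ifP => // ni; rewrite disk_out //; lia.
Qed.
Definition disk : cx N R := Cx disk_dif_comp disk_dif_out disk_dif_id.

Lemma disk_ext n (v w : disk n) :
  (forall i, win i n -> sub_val v i = sub_val w i) -> v = w.
Proof.
move=> vw; apply: sub_ext; apply: dpext => i.
by have [/vw //|h] := boolP (win i n); rewrite !disk_out.
Qed.

Lemma dskE n m (v : disk n) i : sub_val (dif disk n m v) i =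
  if (n <= m) && (m < deg i + N%:Z) then sub_val v i else 0.
Proof. by []. Qed.

Definition dcomp_fun n i (v : disk n) : M i := sub_val v i.
Fact dcomp_linear n i : linear (@dcomp_fun n i). Proof. by []. Qed.
Definition dcomp n i : {linear disk n -> M i} := mklin (@dcomp_linear n i).

Lemma dctr_mem n v : disk_mem n v ->
  disk_mem (n - N%:Z + 1) (restr (fun i => deg i == n - N%:Z + 1) v).
Proof.
move=> [vf v0]; split=> [|i ni]; first exact: fsupp_restr.
by rewrite /restr; case: ifP => // /eqP ne; apply: v0; lia.
Qed.

Fact dctr_linear n : linear
  (fun v : disk n => mksub (S := disk_sm (n - N%:Z + 1)) (dctr_mem (sub_mem v)) : disk (n - N%:Z + 1)).
Proof. by move=> a v w; apply: sub_ext => /=; exact: restr_linear. Qed.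

(** The homotopy is the identity from the last degree of each disk back to its first, so exactly one
    summand of the trace survives on each disk. *)
Lemma disk_contr : nullh (idc disk).
Proof.
exists (fun n => mklin (@dctr_linear n)) => n v /=.
apply: disk_ext => i /andP[in1 in2].
rewrite -[RHS]/(dcomp n i (wsum n N (tr_term (fun n => mklin (@dctr_linear n)) v))).
rewrite /wsum linear_sum.
(* The surviving summand applies the homotopy in degree [deg i + N - 1], the last one of disk i. *)
have jP : (absz (deg i + N%:Z - 1 - n)%R < N)%N by lia.
rewrite (bigD1 (Ordinal jP)) //= big1 ?addr0 => [|j /eqP jN].
  by rewrite /dskd /restr; repeat (case: ifP => ? //); lia.
rewrite /dskd /restr; case: ifP => // _; case: ifP => // /eqP di.
by case: jN; apply: ord_inj => /=; lia.
Qed.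

(** The restriction makes the family vanish off the window whatever N is; for [0 < N] it changes
    nothing ([dgenE]). *)
Lemma dgen_mem i (x : M i) : disk_mem (deg i)
  (restr (fun j => win j (deg i)) (dsingle x)).
Proof.
split=> [|j ji]; first by apply: fsupp_restr; exact: fsupp_single.
by rewrite /restr (negPf ji).
Qed.

Fact dgen_linear i : linear (fun x : M i => mksub (S := disk_sm (deg i)) (dgen_mem x) : disk (deg i)).
Proof.
move=> a x y; apply: sub_ext => /=.
by rewrite dsingle_linear; exact: restr_linear.
Qed.
Definition dgen i : {linear M i -> disk (deg i)} := mklin (@dgen_linear i).

Section DMap.
Variables (Y : cx N R) (h : forall i, {linear M i -> Y (deg i)}).

Definition dmap_fun n (v : disk n) : Y n :=
  fsum (fun i => dif Y (deg i) n \o h i) (sub_val v).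

Fact dmap_linear n : linear (@dmap_fun n).
Proof.
move=> a v w; rewrite /dmap_fun /= fsumP //.
  by case: (sub_mem v).
by case: (sub_mem w).
Qed.

Lemma dmapE n (v : disk n) s : uniq s -> cov s (sub_val v) ->
  dmap_fun v = \sum_(i <- s) dif Y (deg i) n (h i (sub_val v i)).
Proof. by move=> us vs; rewrite /dmap_fun (fsumE _ us vs). Qed.

Fact dmap_D n m v : mklin (@dmap_linear m) (dif disk n m v) =
  dif Y n m (mklin (@dmap_linear n) v).
Proof.
rewrite !mklinE; have [[s vs] _] := sub_mem v.
have us := undup_uniq s; have {}vs := cov_undup vs.
rewrite (dmapE us vs) (@dmapE _ _ (undup s)) //; last first.
  by move=> i si; rewrite dskE vs //; case: ifP.
rewrite linear_sum; apply: eq_bigr => i _.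
rewrite dskE; have [win_i|win_i] := boolP (win i n); last first.
  by rewrite (disk_out v) // if_same !linear0.
have [nm|nm] := boolP (n <= m) => /=; last first.
  by rewrite [RHS]dif_out ?(negPf nm) // !linear0.
rewrite dif_comp //; last by lia.
by case: ifP => // mi; rewrite !linear0 dif_out //; lia.
Qed.

(** Disks corepresent evaluation: with [dmap_gen] and [disk_hom_ext], maps from the sum of disks to
    Y are the same as families of linear maps [M i -> Y (deg i)]. *)
Definition dmap : chom disk Y := @CHom N R disk Y (fun n => mklin (@dmap_linear n)) dmap_D.

End DMap.

Hypothesis N0 : (0 < N)%N.

Lemma dgenE i (x : M i) j : sub_val (dgen i x) j = dsingle x j.
Proof.
rewrite /= /restr; case: ifP => // h; have [e|ij] := eqVneq i j.
  by rewrite -e lexx /= in h; lia.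
by rewrite dsingle_neq.
Qed.

Lemma disk_sum n (v : disk n) s : uniq s -> cov s (sub_val v) ->
  v = \sum_(i <- s) dif disk (deg i) n (dgen i (sub_val v i)).
Proof.
move=> us vs; apply: disk_ext => i /andP[in1 in2].
rewrite -[RHS]/(dcomp n i _) linear_sum {1}(dsum_single us vs).
have -> : (\sum_(j <- s) dsingle (sub_val v j)) i =
    \sum_(j <- s) dsingle (sub_val v j) i.
  by elim/big_rec2: _ => // j y1 y2 _ <-.
apply: eq_bigr => j _; rewrite /dcomp mklinE /dcomp_fun dskE dgenE in2 andbT.
case: ifP => // jn; have [e|ij] := eqVneq j i; first by rewrite -e in in1; lia.
by rewrite dsingle_neq.
Qed.

Lemma dmap_gen (Y : cx N R) (h : forall i, {linear M i -> Y (deg i)}) i x : dmap h (deg i) (dgen i x) = h i x.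
Proof.
rewrite [LHS](@dmapE Y h _ _ [:: i]) //.
  by rewrite big_seq1 dgenE dsingle_eq dif_id.
by move=> j; rewrite inE eq_sym dgenE; exact: dsingle_neq.
Qed.

Lemma disk_hom_ext (Y : cx N R) (f g : chom disk Y) :
  (forall i x, f (deg i) (dgen i x) = g (deg i) (dgen i x)) ->
  forall n v, f n v = g n v.
Proof.
move=> fg n v; have [[s vs] _] := sub_mem v.
rewrite (disk_sum (undup_uniq s) (cov_undup vs)) !linear_sum.
by apply: eq_bigr => i _; rewrite !cmapD fg.
Qed.

End Disk.

(** * Constructions on N-complexes *)

Section Constructions.
Variables (N : nat) (R : pzRingType).
Local Notation cx := (cx N R).

Section Prod.
Variables A B : cx.

Definition cprod_car i : lmodType R := (A i * B i)%type.
Fact cprod_dif_linear i j : linear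
  (fun x : cprod_car i => (dif A i j x.1, dif B i j x.2) : cprod_car j).
Proof. by move=> a [x y] [x' y']; rewrite /= !linearP. Qed.
Definition cprod_dif i j : {linear cprod_car i -> cprod_car j} :=
  mklin (@cprod_dif_linear i j).
Fact cprod_comp (i j k : int) x : i <= j -> j <= k ->
  cprod_dif j k (cprod_dif i j x) = cprod_dif i k x.
Proof. by move=> ij jk; rewrite !mklinE /= !dif_comp. Qed.
Fact cprod_out (i j : int) x : ~~ ((i <= j) && (j < i + N%:Z)) ->
  cprod_dif i j x = 0.
Proof. by move=> ij; rewrite !mklinE /= !dif_out. Qed.
Fact cprod_id i x : cprod_dif i i x = x.
Proof. by case: x => x y; rewrite mklinE /= !dif_id. Qed.
Definition cprod : cx := Cx cprod_comp cprod_out cprod_id.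

Definition fst_fun i (x : cprod i) : A i := x.1.
Definition snd_fun i (x : cprod i) : B i := x.2.
Fact fst_linear i : linear (@fst_fun i). Proof. by []. Qed.
Fact snd_linear i : linear (@snd_fun i). Proof. by []. Qed.
Definition cfst : chom cprod A :=
  @CHom N R cprod A (fun i => mklin (@fst_linear i)) (fun i j x => erefl).
Definition csnd : chom cprod B :=
  @CHom N R cprod B (fun i => mklin (@snd_linear i)) (fun i j x => erefl).

Variables (Z : cx) (f : chom Z A) (g : chom Z B).
Fact cpair_linear i : linear (fun x => (f i x, g i x) : cprod i).
Proof. by move=> a x y; rewrite !linearP. Qed.
Fact cpair_D i j x : mklin (@cpair_linear j) (dif Z i j x) =
  dif cprod i j (mklin (@cpair_linear i) x).
Proof. by rewrite !mklinE !cmapD. Qed.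
Definition cpair : chom Z cprod :=
  @CHom N R Z cprod (fun i => mklin (@cpair_linear i)) cpair_D.
End Prod.

Record subcx (X : cx) := SubCx {
  scm :> forall i, submod (X i);
  scD : forall i j x, scm i x -> scm j (dif X i j x) }.

Section SubCx.
Variables (X : cx) (S : subcx X).
Definition scx_car i : lmodType R := sub_of (S i).
Fact scx_dif_linear i j : linear
  (fun x : scx_car i => mksub (scD j (sub_mem x)) : scx_car j).
Proof. by move=> a x y; apply: sub_ext => /=; rewrite linearP. Qed.
Definition scx_dif i j : {linear scx_car i -> scx_car j} :=
  mklin (@scx_dif_linear i j).
Fact scx_comp (i j k : int) x : i <= j -> j <= k ->
  scx_dif j k (scx_dif i j x) = scx_dif i k x.
Proof. by move=> ij jk; apply: sub_ext; rewrite /= dif_comp. Qed.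
Fact scx_out (i j : int) x : ~~ ((i <= j) && (j < i + N%:Z)) ->
  scx_dif i j x = 0.
Proof. by move=> ij; apply: sub_ext; rewrite /= dif_out. Qed.
Fact scx_id i x : scx_dif i i x = x.
Proof. by apply: sub_ext; rewrite /= dif_id. Qed.
Definition scx : cx := Cx scx_comp scx_out scx_id.

Definition scincl : chom scx X :=
  @CHom N R scx X (fun i => subv (S i)) (fun i j x => erefl).

Section Cor.
Variables (Z : cx) (f : chom Z X) (fS : forall i x, S i (f i x)).
Fact sccor_D i j x : corestr (@fS j) (dif Z i j x) =
  dif scx i j (corestr (@fS i) x).
Proof. by apply: sub_ext; rewrite /= cmapD. Qed.
Definition sccor : chom Z scx :=
  @CHom N R Z scx (fun i => corestr (@fS i)) sccor_D.
Lemma sccorE i x : scincl i (sccor i x) = f i x. Proof. by []. Qed.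
End Cor.

Definition qcx_car i : lmodType R := quot (S i).
Fact qcx_dif0 i j x : S i x -> (qpi (S j) \o dif X i j) x = 0.
Proof. by move=> Sx; apply/qpi_eq0; exact: scD. Qed.
Definition qcx_dif i j : {linear qcx_car i -> qcx_car j} :=
  qlift (@qcx_dif0 i j).
Lemma qcx_difE i j x : qcx_dif i j (qpi (S i) x) = qpi (S j) (dif X i j x).
Proof. exact: qliftE. Qed.
Fact qcx_comp (i j k : int) x : i <= j -> j <= k ->
  qcx_dif j k (qcx_dif i j x) = qcx_dif i k x.
Proof.
move=> ij jk; have [{}x <-] := qpi_surj x.
by rewrite !qcx_difE dif_comp.
Qed.
Fact qcx_out (i j : int) x : ~~ ((i <= j) && (j < i + N%:Z)) ->
  qcx_dif i j x = 0.
Proof.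
move=> ij; have [{}x <-] := qpi_surj x.
by rewrite !qcx_difE dif_out // linear0.
Qed.
Fact qcx_id i x : qcx_dif i i x = x.
Proof. by have [{}x <-] := qpi_surj x; rewrite !qcx_difE dif_id. Qed.
Definition qcx : cx := Cx qcx_comp qcx_out qcx_id.

Definition qcpi : chom X qcx :=
  @CHom N R X qcx (fun i => qpi (S i)) (fun i j x => esym (@qcx_difE i j x)).
Lemma qcpi_eq0 i x : qcpi i x = 0 <-> S i x. Proof. exact: qpi_eq0. Qed.
Lemma qcpi_surj i y : exists x, qcpi i x = y. Proof. exact: qpi_surj. Qed.

Section QLift.
Variables (Z : cx) (f : chom X Z) (f0 : forall i x, S i x -> f i x = 0).
Fact qclift_D i j x : qlift (f0 (i := j)) (dif qcx i j x) =
  dif Z i j (qlift (f0 (i := i)) x).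
Proof.
have [{}x <-] := qcpi_surj x.
by rewrite -[qcpi i x]/(qpi (S i) x) [dif qcx i j _]qcx_difE !qliftE cmapD.
Qed.
Definition qclift : chom qcx Z :=
  @CHom N R qcx Z (fun i => qlift (f0 (i := i))) qclift_D.
Lemma qcliftE i x : qclift i (qcpi i x) = f i x. Proof. exact: qliftE. Qed.
End QLift.
End SubCx.

Lemma ker_smD (U V : lmodType R) (f : {linear U -> V}) x y :
  f x = 0 -> f y = 0 -> f (x + y) = 0.
Proof. by rewrite linearD => -> ->; rewrite addr0. Qed.
Lemma ker_smZ (U V : lmodType R) (f : {linear U -> V}) a x :
  f x = 0 -> f (a *: x) = 0.
Proof. by rewrite linearZZ => ->; rewrite scaler0. Qed.
Definition ker_sm (U V : lmodType R) (f : {linear U -> V}) : submod U :=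
  @Submod R U (fun x => f x = 0) (linear0 f) (@ker_smD U V f) (@ker_smZ U V f).

Fact ker_scD (X Y : cx) (f : chom X Y) i j x :
  ker_sm (f i) x -> ker_sm (f j) (dif X i j x).
Proof. by rewrite /= cmapD => ->; rewrite linear0. Qed.
Definition ker_sc (X Y : cx) (f : chom X Y) : subcx X :=
  @SubCx X (fun i => ker_sm (f i)) (@ker_scD X Y f).

(* The cokernel of a degreewise split mono m, carried by the kernel of a
   degreewise retraction r. *)
Section Cok.
Variables (A B : cx) (m : chom A B) (r : gmap B A).
Hypothesis rm : forall i x, r i (m i x) = x.

Definition cok_car i : lmodType R := sub_of (ker_sm (r i)).
Definition cokp i : {linear B i -> B i} := idfun \- (m i \o r i).
Fact cokp_mem i x : ker_sm (r i) (cokp i x).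
Proof. by rewrite /= linearB rm subrr. Qed.
Definition cokpi i : {linear B i -> cok_car i} := corestr (@cokp_mem i).
Definition cokj i : {linear cok_car i -> B i} := subv (ker_sm (r i)).
Definition cok_dif i j : {linear cok_car i -> cok_car j} :=
  cokpi j \o dif B i j \o cokj i.

Lemma cokpi_m i x : cokpi i (m i x) = 0.
Proof. by apply: sub_ext; rewrite /= rm subrr. Qed.

Lemma cokpi_j i x : cokpi i (cokj i x) = x.
Proof.
by apply: sub_ext; rewrite /= [r i _](sub_mem x) linear0 subr0.
Qed.

Lemma cokjE i x : cokj i (cokpi i x) = x - m i (r i x). Proof. by []. Qed.

Lemma cok_difE i j x : cok_dif i j (cokpi i x) = cokpi j (dif B i j x).
Proof.
by rewrite -[LHS]/(cokpi j (dif B i j (cokj i (cokpi i x)))) cokjE !linearB -cmapD cokpi_m subr0.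
Qed.

Fact cok_comp (i j k : int) x : i <= j -> j <= k ->
  cok_dif j k (cok_dif i j x) = cok_dif i k x.
Proof. by move=> ij jk; rewrite -(cokpi_j x) !cok_difE dif_comp. Qed.
Fact cok_out (i j : int) x : ~~ ((i <= j) && (j < i + N%:Z)) ->
  cok_dif i j x = 0.
Proof. by move=> ij; rewrite -(cokpi_j x) !cok_difE dif_out // linear0. Qed.
Fact cok_id i x : cok_dif i i x = x.
Proof. by rewrite -{1}(cokpi_j x) !cok_difE dif_id cokpi_j. Qed.
Definition cok : cx := Cx cok_comp cok_out cok_id.

Definition cokc : chom B cok :=
  @CHom N R B cok cokpi (fun i j x => esym (@cok_difE i j x)).

Lemma cokc_m i x : cokc i (m i x) = 0. Proof. exact: cokpi_m. Qed.
Lemma cokc_j i x : cokc i (cokj i x) = x. Proof. exact: cokpi_j. Qed.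
Lemma cokc_eq0 i x : cokc i x = 0 -> x = m i (r i x).
Proof.
by move/(congr1 (@cokj i)); rewrite linear0 cokjE => /eqP; rewrite subr_eq0 => /eqP.
Qed.

Section CokLift.
Variables (Z : cx) (f : chom B Z) (fm : forall i x, f i (m i x) = 0).
Fact coklift_D i j x : (f j \o cokj j) (dif cok i j x) =
  dif Z i j ((f i \o cokj i) x).
Proof.
have [y ->] : exists y, x = cokc i y by exists (cokj i x); rewrite cokc_j.
transitivity (f j (cokj j (cokpi j (dif B i j y)))); first by rewrite -[in LHS](cmapD cokc).
rewrite -[RHS]/(dif Z i j (f i (cokj i (cokpi i y)))).
by rewrite !cokjE (linearB (f j)) (linearB (f i)) !fm !subr0 cmapD.
Qed.
Definition coklift : chom cok Z :=
  @CHom N R cok Z (fun i => f i \o cokj i) coklift_D.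
Lemma cokliftE i x : coklift i (cokc i x) = f i x.
Proof. by rewrite -[LHS]/(f i (cokj i (cokpi i x))) cokjE linearB fm subr0. Qed.
End CokLift.
End Cok.

Section DSum.
Variables (I : choiceType) (X : I -> cx).
Definition fsm n : submod (dprod (fun i => X i n)) :=
  @Submod _ _ (@fsupp R I (fun i => X i n)) (@fsupp0 _ _ _) (@fsuppD _ _ _)
    (@fsuppZ _ _ _).
Definition cds_car n : lmodType R := sub_of (fsm n).

Section CW.
Variables (Y : I -> cx) (n m : int) (h : forall i, {linear X i n -> Y i m}).
Fact cw_mem (v : cds_car n) : fsupp (fun i => h i (sub_val v i) : Y i m).
Proof.
have [s vs] : fsupp (sub_val v) := sub_mem v.
by exists s => i si; rewrite vs ?linear0.
Qed.
End CW.

Fact cds_dif_linear n m : linear (fun v : cds_car n =>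
  mksub (S := fsm m) (cw_mem (fun i => dif (X i) n m) v) : cds_car m).
Proof.
move=> a v w; apply: sub_ext; apply: dpext => i /=.
by rewrite dpED dpEZ /= !linearP.
Qed.
Definition cds_dif n m : {linear cds_car n -> cds_car m} :=
  mklin (@cds_dif_linear n m).
Lemma cds_difE n m v i : sub_val (cds_dif n m v) i = dif (X i) n m (sub_val v i).
Proof. by []. Qed.
Lemma cds_ext n (v w : cds_car n) :
  (forall i, sub_val v i = sub_val w i) -> v = w.
Proof. by move=> vw; apply: sub_ext; exact: dpext. Qed.
Fact cds_comp (i j k : int) x : i <= j -> j <= k ->
  cds_dif j k (cds_dif i j x) = cds_dif i k x.
Proof. by move=> ij jk; apply: cds_ext => t; rewrite !cds_difE dif_comp. Qed.
Fact cds_out (i j : int) x : ~~ ((i <= j) && (j < i + N%:Z)) ->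
  cds_dif i j x = 0.
Proof. by move=> ij; apply: cds_ext => t; rewrite !cds_difE dif_out. Qed.
Fact cds_id i x : cds_dif i i x = x.
Proof. by apply: cds_ext => t; rewrite !cds_difE dif_id. Qed.
Definition cds : cx := Cx cds_comp cds_out cds_id.

Lemma cdsE n m (v : cds n) i : sub_val (dif cds n m v) i =
  dif (X i) n m (sub_val v i).
Proof. by []. Qed.

Definition cdp_fun i n (v : cds n) : X i n := sub_val v i.
Fact cdp_linear i n : linear (@cdp_fun i n). Proof. by []. Qed.
Definition cdp i : chom cds (X i) :=
  @CHom N R cds (X i) (fun n => mklin (@cdp_linear i n)) (fun n m v => erefl).

Fact cdin_linear i n : linear (fun x : X i n =>
  mksub (S := fsm n) (@fsupp_single R I (fun i => X i n) i x) : cds n).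
Proof. by move=> a x y; apply: sub_ext; exact: dsingle_linear. Qed.
Fact cdin_D i n m x : mklin (@cdin_linear i m) (dif (X i) n m x) =
  dif cds n m (mklin (@cdin_linear i n) x).
Proof.
apply: cds_ext => j; rewrite cdsE !mklinE /=.
have [<-|ij] := eqVneq i j; first by rewrite !dsingle_eq.
by rewrite !dsingle_neq // linear0.
Qed.
Definition cdin i : chom (X i) cds :=
  @CHom N R (X i) cds (fun n => mklin (@cdin_linear i n)) (@cdin_D i).

Lemma cdin_eq i n x : sub_val (cdin i n x) i = x.
Proof. exact: dsingle_eq. Qed.
Lemma cdin_neq i j n x : i != j -> sub_val (cdin i n x) j = 0.
Proof. exact: dsingle_neq. Qed.

Lemma cds_sum n (v : cds n) s : uniq s -> cov s (sub_val v) ->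
  v = \sum_(i <- s) cdin i n (sub_val v i).
Proof.
move=> us vs; apply: sub_ext; rewrite -[RHS]/(subv (fsm n) _) linear_sum.
by rewrite {1}(dsum_single us vs); apply: eq_bigr.
Qed.

Section CdMap.
Variables (Y : cx) (h : forall i, chom (X i) Y).
Definition cdmap_fun n (v : cds n) : Y n := fsum (fun i => h i n) (sub_val v).
Fact cdmap_linear n : linear (@cdmap_fun n).
Proof.
by move=> a v w; rewrite /cdmap_fun /= fsumP; [|exact: (sub_mem v)|exact: (sub_mem w)].
Qed.
Fact cdmap_D n m v : mklin (@cdmap_linear m) (dif cds n m v) =
  dif Y n m (mklin (@cdmap_linear n) v).
Proof.
rewrite !mklinE /cdmap_fun; have [s vs] : fsupp (sub_val v) := sub_mem v.
have us := undup_uniq s; have {}vs := cov_undup vs.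
rewrite (fsumE _ us vs) (@fsumE _ _ _ _ _ (undup s)) //; last first.
  by move=> i si; rewrite cdsE vs // linear0.
by rewrite linear_sum; apply: eq_bigr => i _; rewrite cdsE cmapD.
Qed.
Definition cdmap : chom cds Y :=
  @CHom N R cds Y (fun n => mklin (@cdmap_linear n)) cdmap_D.
Lemma cdmap_in i n x : cdmap n (cdin i n x) = h i n x.
Proof. exact: fsum_single. Qed.
End CdMap.

Lemma cds_hom_ext (Y : cx) (f g : chom cds Y) :
  (forall i n x, f n (cdin i n x) = g n (cdin i n x)) ->
  forall n v, f n v = g n v.
Proof.
move=> fg n v; have [s vs] : fsupp (sub_val v) := sub_mem v.
rewrite (cds_sum (undup_uniq s) (cov_undup vs)) !linear_sum.
by apply: eq_bigr => i _; rewrite fg.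
Qed.

End DSum.

Lemma cds_contr (I : choiceType) (X : I -> cx) :
  (forall i, nullh (idc (X i))) -> nullh (idc (cds X)).
Proof.
move=> h; pose s i := projT1 (cid (h i)).
have sE i : forall n x, idc (X i) n x = trc (s i) n x := projT2 (cid (h i)).
have sL n : linear (fun v : cds X n =>
    mksub (S := fsm X (n - N%:Z + 1)) (cw_mem (fun i => s i n) v)
      : cds X (n - N%:Z + 1)).
  move=> a v w; apply: cds_ext => i /=.
  by rewrite dpED dpEZ /= !linearP.
exists (fun n => mklin (@sL n)) => n v; apply: cds_ext => i.
rewrite -[RHS]/(cdp X i n (wsum n N (tr_term (fun n => mklin (@sL n)) v))).
rewrite /wsum linear_sum.
rewrite -[LHS]/(idc (X i) n (sub_val v i)) sE /=.
by apply: eq_bigr.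
Qed.

(** The disk on [X i] ends in degree i, so X embeds by sending x to the family of all its
    differentials. The embedding is degreewise split with contractible target, hence its cokernel is
    the suspension. *)
Definition inj_hull (X : cx) : cx := disk N (fun i : int => i - N%:Z + 1) X.

Section InjHull.
Variable X : cx.

Fact iota_mem n x : disk_mem N (fun i : int => i - N%:Z + 1) n
  (fun i => dif X n i x).
Proof.
split=> [|i ni]; last by rewrite dif_out //; lia.
exists [seq n + j%:Z | j <- iota 0 N] => i /mapP ni; rewrite dif_out //.
apply/negP => /andP[ni1 ni2]; apply: ni; exists (absz (i - n)%R); last by lia.
by rewrite mem_iota; lia.
Qed.
Fact iota_linear n : linear (fun x : X n =>
  mksub (S := disk_sm N (fun i : int => i - N%:Z + 1) X n) (iota_mem x)
    : inj_hull X n).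
Proof. by move=> a x y; apply: sub_ext; apply: dpext => i /=; rewrite linearP. Qed.
Fact iota_D n m x : mklin (@iota_linear m) (dif X n m x) =
  dif (inj_hull X) n m (mklin (@iota_linear n) x).
Proof.
apply: disk_ext => i ni; rewrite dskE !mklinE /=.
case: ifP => nm; last first.
  by rewrite (@dif_out _ _ _ n m) ?linear0 //; move: nm ni; lia.
by rewrite dif_comp //; lia.
Qed.
Definition ciota : chom X (inj_hull X) :=
  @CHom N R X (inj_hull X) (fun n => mklin (@iota_linear n)) iota_D.
Lemma ciotaE n x i : sub_val (ciota n x) i = dif X n i x. Proof. by []. Qed.

Definition iretr n : {linear inj_hull X n -> X n} :=
  @dcomp N R int (fun i => i - N%:Z + 1) X n n.
Lemma iretrK n x : iretr n (ciota n x) = x.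
Proof. by rewrite /iretr mklinE /dcomp_fun ciotaE dif_id. Qed.

Lemma inj_hull_contr : nullh (idc (inj_hull X)).
Proof. exact: disk_contr. Qed.
End InjHull.

(** Dually, the disk on [X i] starts in degree i; X becomes a degreewise split quotient of a
    contractible complex. *)
Definition prj_cover (X : cx) : cx := disk N (fun i : int => i) X.
Definition csig (X : cx) : chom (prj_cover X) X :=
  @dmap N R int (fun i => i) X X (fun i => idfun).
Definition psec (X : cx) n : {linear X n -> prj_cover X n} := @dgen N R int (fun i => i) X n.
Lemma csig_sec (X : cx) n x : (0 < N)%N -> csig X n (psec X n x) = x.
Proof. by move=> N0; exact: (dmap_gen N0 (fun i => idfun)). Qed.
Lemma prj_cover_contr (X : cx) : nullh (idc (prj_cover X)).
Proof. exact: disk_contr. Qed.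

(** Together with [inj_hull_contr], this turns null-homotopies into strict extensions over the hull,
    a form that survives gluing. *)
Lemma nullh_iota (X Y : cx) (f : chom X Y) : nullh f ->
  exists g : chom (inj_hull X) Y, forall i x, g i (ciota X i x) = f i x.
Proof. by move/(nullh_ext (@iretrK X)) => [g _ gE]; exists g. Qed.

End Constructions.

(** * Flat modules *)

Section FlatModules.
Variable R : pzRingType.

Lemma exact_tensor0 (A B C : lmodType R^c) (M : lmodType R)
    (f : {linear A -> B}) (g : {linear B -> C}) (t : seq (B * M)) :
  (forall b, g b = 0 <-> exists a, f a = b) ->
  (exists s : seq (A * M), tensor_eq (tensor_map f s) t) ->
  tensor_eq (tensor_map g t) [::].
Proof.
move=> fg [s st]; apply: tensor_trans (tensor_map_eq g (tensor_sym st)) _.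
apply: tensor_all0 => q /mapP[q' /mapP[q'' _ ->] ->] /=.
by apply/fg; exists q''.1.
Qed.

Lemma sum_delta (M : lmodType R) (I : finType) (m : I -> M) i :
  \sum_j ((i == j)%:R : R) *: m j = m i.
Proof.
rewrite (bigD1 i) //= eqxx scale1r big1 ?addr0 // => j ji.
by rewrite eq_sym (negPf ji) scale0r.
Qed.

Lemma sum_sumType (V : nmodType) (K I : finType) (F : K + I -> V) :
  \sum_e F e = \sum_k F (inl k) + \sum_p F (inr p).
Proof. exact: big_sumType. Qed.

(** The equational criterion for flatness: every relation in M comes from relations in R. Unlike the
    tensor definition it has a direct analogue for N-complexes. *)
Definition eqflat (M : lmodType R) :=
  forall (I : finType) (m : I -> M) (r : I -> R), \sum_i r i *: m i = 0 ->
  exists (J : finType) (m' : J -> M) (a : I -> J -> R),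
    (forall i, m i = \sum_j a i j *: m' j) /\
    forall j, \sum_i r i * a i j = 0.

Section TensorFunctional.
Variables (B : lmodType R^c) (M : lmodType R) (phi : {linear B -> (R^c)^o}).
Definition tensor_ev (t : seq (B * M)) : M := \sum_(q <- t) (phi q.1 : R) *: q.2.
Lemma tensor_ev_eq s t : tensor_eq s t -> tensor_ev s = tensor_ev t.
Proof.
rewrite /tensor_ev; elim=> {s t} //.
- by move=> s t u _ -> _ ->.
- by move=> s s' t t' _ ss' _ tt'; rewrite !big_cat /= ss' tt'.
- by move=> s t; rewrite !big_cat /= addrC.
- by move=> x; rewrite big_seq1 big_nil linear0 scale0r.
- by move=> a b x; rewrite !big_cons !big_nil !addr0 linearD /= scalerDl.
- by move=> a x y; rewrite !big_cons !big_nil !addr0 /= scalerDr.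
- by move=> r a x; rewrite !big_seq1 /= linearZ /= scalerA.
Qed.
End TensorFunctional.

(** Tensor the exact sequence ker g -> R^I -> R, where g is the functional with coefficients r. The
    element sum of e_i ⊗ m_i dies in R ⊗ M, so it comes from ker g ⊗ M: second components of a
    preimage are the new family, coordinates of the first components the matrix. *)
Lemma flat_eqflat M : flat M -> eqflat M.
Proof.
move=> Mf I m r rm0.
pose B : lmodType R^c := dprod (fun _ : I => (R^c)^o).
have gL : linear (fun b : B => (\sum_i r i * (b i : R) : R) : (R^c)^o).
  move=> a b b'; rewrite [a *: (_ : (R^c)^o)]/GRing.scale /=.
  rewrite [X in _ = X + _]mulr_suml -big_split; apply: eq_bigr => i _ /=.
  by rewrite dpED dpEZ mulrDr; congr (_ + _); exact: (mulrA (r i) (b i : R) (a : R)).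
pose g := mklin gL; pose A : lmodType R^c := sub_of (ker_sm g).
have fg b : g b = 0 <-> exists a : A, subv (ker_sm g) a = b.
  split=> [gb0|[a <-]]; last exact: (sub_mem a).
  by exists (mksub (S := ker_sm g) gb0).
pose e i : B := fun j => (j == i)%:R.
pose t := [seq (e i, m i) | i <- enum I].
have t0 : tensor_eq (tensor_map g t) [::].
  have -> : tensor_map g t = [seq ((r i : (R^c)^o), m i) | i <- enum I].
    rewrite /tensor_map -map_comp; apply: eq_map => i /=; congr pair.
    rewrite (bigD1 i) //= /e eqxx mulr1 big1 ?addr0 // => j /negPf ->.
    by rewrite mulr0.
  apply: (@tensor_trans _ _ _ _ [seq ((1 : (R^c)^o), r i *: m i) | i <- enum I]).
    apply: tensor_mapr => i; have := tensor_bal (r i) (1 : (R^c)^o) (m i).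
    by rewrite [_ *: (_ : (R^c)^o)]/GRing.scale /= mulr1.
  apply: tensor_trans (tensor_sym (tensor_sumr _ _ _)) _.
  by rewrite big_enum /= rm0; exact: tensor_0r.
have [s st] := (Mf _ _ _ _ _ fg t).1 t0.
pose x0 : A * M := (0, 0).
exists 'I_(size s), (fun j : 'I_(size s) => (nth x0 s j).2),
  (fun i (j : 'I_(size s)) => (sub_val (nth x0 s j).1 : B) i : R); split=> [i|j].
  have phiL : linear (fun b : B => b i : (R^c)^o) by [].
  have := tensor_ev_eq (mklin phiL) st.
  rewrite /tensor_ev big_map big_map big_enum /= (bigD1 i) //=.
  rewrite {1}/e eqxx scale1r [X in _ = _ + X]big1 ?addr0 => [<-|j /negPf ji].
    by rewrite (big_nth x0) big_mkord; apply: eq_bigr.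
  by rewrite /e eq_sym ji scale0r.
exact: (sub_mem (nth x0 s j).1).
Qed.

(** Relations are killed one at a time: the next one, rewritten in the family already found, is a
    single relation there, and the matrices multiply. *)
Lemma eqflat_seq (M : lmodType R) : eqflat M ->
  forall (I : finType) (m : I -> M) (rs : seq (I -> R)),
    (forall r, List.In r rs -> \sum_i r i *: m i = 0) ->
  exists (J : finType) (m' : J -> M) (a : I -> J -> R),
    (forall i, m i = \sum_j a i j *: m' j) /\
    forall r, List.In r rs -> forall j, \sum_i r i * a i j = 0.
Proof.
move=> Mf I m rs; elim: rs => [|r rs IH] r0.
  by exists I, m, (fun i j => (i == j)%:R); split=> // i; rewrite sum_delta.
have [|J [m' [a [mE aE]]]] := IH; first by move=> r' r's; apply: r0; right.
have comp b (K : finType) (m'' : K -> M) (c : J -> K -> R) :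
    (forall j, m' j = \sum_k c j k *: m'' k) ->
    \sum_j b j *: m' j = \sum_k (\sum_j b j * c j k) *: m'' k.
  move=> m'E; under eq_bigr => j _ do rewrite m'E scaler_sumr.
  rewrite exchange_big; apply: eq_bigr => k _; rewrite scaler_suml.
  by apply: eq_bigr => j _; rewrite scalerA.
have assoc q (K : finType) (c : J -> K -> R) k :
    \sum_i q i * (\sum_j a i j * c j k) = \sum_j (\sum_i q i * a i j) * c j k.
  under eq_bigr => i _ do rewrite mulr_sumr.
  rewrite exchange_big; apply: eq_bigr => j _; rewrite mulr_suml.
  by apply: eq_bigr => i _; rewrite mulrA.
have [|K [m'' [c [m'E cE]]]] := Mf J m' (fun j => \sum_i r i * a i j).
  rewrite -[RHS](r0 r (or_introl erefl)).
  under [RHS]eq_bigr => i _ do rewrite mE scaler_sumr.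
  rewrite exchange_big; apply: eq_bigr => j _; rewrite scaler_suml.
  by apply: eq_bigr => i _; rewrite scalerA.
exists K, m'', (fun i k => \sum_j a i j * c j k); split=> [i|r' [<-|r's] k].
- by rewrite mE; exact: comp.
- by rewrite assoc cE.
- by rewrite assoc big1 // => j _; rewrite aE // mul0r.
Qed.

Section Expansion.
Variables (A : lmodType R^c) (M : lmodType R).

(* The elements of M occurring in a formal sum expanded along a finite family
   m', and the resulting coordinates in A. *)
Definition texp (J : finType) (m' : J -> M) (es : seq (A * (J -> R))) :
  seq (A * M) := [seq (e.1, \sum_j e.2 j *: m' j) | e <- es].

Definition tco (J : finType) (es : seq (A * (J -> R))) (j : J) : A :=
  \sum_(e <- es) (e.2 j : R^c) *: e.1.

Definition trefine (I J : finType) (a : I -> J -> R) (es : seq (A * (I -> R))) :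
  seq (A * (J -> R)) := [seq (e.1, fun j => \sum_i e.2 i * a i j) | e <- es].

Lemma texp_refine (I J : finType) (m : I -> M) (m' : J -> M) a es :
  (forall i, m i = \sum_j a i j *: m' j) -> texp m' (trefine a es) = texp m es.
Proof.
move=> mE; rewrite /texp /trefine -map_comp; apply: eq_map => e /=; congr pair.
under [RHS]eq_bigr => i _ do rewrite mE scaler_sumr.
rewrite [RHS]exchange_big; apply: eq_bigr => j _; rewrite scaler_suml.
by apply: eq_bigr => i _; rewrite scalerA.
Qed.

Lemma tco_refine (I J : finType) (a : I -> J -> R) es j :
  tco (trefine a es) j = \sum_i (a i j : R^c) *: tco es i.
Proof.
rewrite /tco /trefine big_map.
under [RHS]eq_bigr => i _ do rewrite scaler_sumr.
rewrite [RHS]exchange_big; apply: eq_bigr => e _ /=.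
transitivity (\sum_i (e.2 i * a i j : R^c) *: e.1).
  exact: (@scaler_suml R^c A e.1 I (index_enum I) xpredT).
by apply: eq_bigr => i _; rewrite scalerA.
Qed.

Lemma tensor_exp (J : finType) (m' : J -> M) es :
  tensor_eq (texp m' es) [seq (tco es j, m' j) | j <- enum J].
Proof.
elim: es => [|[a c] es IH].
  apply: tensor_sym; apply: tensor_all0 => q /mapP[j _ ->] /=.
  by rewrite /tco big_nil.
have -> : [seq (tco ((a, c) :: es) j, m' j) | j <- enum J] =
    [seq ((c j : R^c) *: a + tco es j, m' j) | j <- enum J].
  by apply: eq_map => j; rewrite /tco big_cons.
apply: tensor_trans (tensor_sym (tensor_split _ _ _ _)).
rewrite [texp _ _]/= -cat1s; apply: tensor_cat IH.
rewrite -big_enum /=; apply: tensor_trans (tensor_sumr _ _ _) _.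
by apply: tensor_mapr => j; apply: tensor_sym; exact: tensor_bal.
Qed.

(** The two sums already agree over a finite free module mapping to M, the coordinates in A being
    computed there. For flat M this is all of [tensor_eq]. *)
Definition tsame (s t : seq (A * M)) :=
  exists (J : finType) (m' : J -> M) es et,
    [/\ s = texp m' es, t = texp m' et & forall j, tco es j = tco et j].

Lemma texpP (s : seq (A * M)) : exists (J : finType) (m' : J -> M) es, s = texp m' es.
Proof.
pose x0 : A * M := (0, 0).
exists 'I_(size s), (fun j : 'I_(size s) => (nth x0 s j).2),
  [seq ((nth x0 s i).1, fun j : 'I_(size s) => (i == j)%:R) | i : 'I_(size s) <- enum 'I_(size s)].
rewrite /texp -map_comp -{1}(mkseq_nth x0 s) /mkseq -val_enum_ord -map_comp.
by apply: eq_map => i /=; rewrite sum_delta; case: nth.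
Qed.

Definition tinl (I J : finType) (i : I) (k : I + J) : R :=
  if k is inl i' then (i == i')%:R else 0.
Definition tinr (I J : finType) (j : J) (k : I + J) : R :=
  if k is inr j' then (j == j')%:R else 0.
Definition msum (I J : finType) (m : I -> M) (m' : J -> M) (k : I + J) : M :=
  match k with inl i => m i | inr j => m' j end.

Lemma tinlE (I J : finType) (m : I -> M) (m' : J -> M) i :
  m i = \sum_k tinl i k *: msum m m' k.
Proof.
rewrite sum_sumType [X in _ + X]big1 ?addr0 => [|j _]; last by rewrite scale0r.
by rewrite sum_delta.
Qed.

Lemma tinrE (I J : finType) (m : I -> M) (m' : J -> M) j :
  m' j = \sum_k tinr j k *: msum m m' k.
Proof.
rewrite sum_sumType [X in X + _]big1 ?add0r => [|i _]; last by rewrite scale0r.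
by rewrite sum_delta.
Qed.

Lemma tco_cat (J : finType) (es et : seq (A * (J -> R))) j :
  tco (es ++ et) j = tco es j + tco et j.
Proof. by rewrite /tco big_cat. Qed.

Lemma texp_cat (J : finType) (m' : J -> M) es et :
  texp m' (es ++ et) = texp m' es ++ texp m' et.
Proof. exact: map_cat. Qed.

(** The middle sum t is expanded along two families. Flatness supplies a common refinement in which
    the two expansions of t have equal coordinates. *)
Lemma tsame_trans s t u : eqflat M -> tsame s t -> tsame t u -> tsame s u.
Proof.
move=> Mf [J1 [m1 [es [et1 [sE tE1 co1]]]]] [J2 [m2 [et2 [eu [tE2 uE co2]]]]].
have zE : size et1 = size et2 by rewrite -(size_map (fun e => (e.1, \sum_j e.2 j *: m1 j)))
  -(size_map (fun e => (e.1, \sum_j e.2 j *: m2 j)) et2) -[LHS]/(size (texp _ _)) -tE1 tE2.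
(* One relation for each term of t: its expansions along [m1] and [m2] are the same element of M. *)
pose rel (p : (A * (J1 -> R)) * (A * (J2 -> R))) (k : J1 + J2) : R :=
  match k with inl i => p.1.2 i | inr j => - p.2.2 j end.
have tt : texp m1 et1 = texp m2 et2 by rewrite -tE1.
have [|K [m' [a [mE aE]]]] :=
    eqflat_seq Mf (m := msum m1 m2) (rs := [seq rel p | p <- zip et1 et2]).
  elim: (et1) (et2) tt => [|e1 l1 IH] [|e2 l2] //= [_ e12] /IH{}IH r [<-|/IH//].
  rewrite big_sumType /=; under [X in _ + X]eq_bigr do rewrite scaleNr.
  by rewrite sumrN e12 subrr.
exists K, m', (trefine (fun i => a (inl i)) es), (trefine (fun i => a (inr i)) eu).
split.
- by rewrite (texp_refine _ (fun i => mE (inl i))).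
- by rewrite (texp_refine _ (fun i => mE (inr i))).
move=> k; rewrite !tco_refine.
under eq_bigr do rewrite co1; under [RHS]eq_bigr do rewrite -co2.
rewrite -!(tco_refine (fun i => a (_ i))); congr (tco _ k).
elim: (et1) (et2) tt aE => [|e1 l1 IH] [|e2 l2] //= [e11 _] /IH{}IH aE.
congr cons; last by apply: IH => r rl; apply: aE; right.
congr pair => //; apply: funext => j.
have := aE _ (or_introl erefl) j; rewrite big_sumType /=.
under [X in _ + X]eq_bigr do rewrite mulNr.
by rewrite sumrN => /eqP; rewrite subr_eq0 => /eqP.
Qed.

Lemma sum_unit (F : unit -> M) : \sum_j F j = F tt.
Proof. by rewrite (bigD1 tt) //= big1 ?addr0 // => -[]. Qed.

(** The defining relations of the tensor product hold over explicit finite families; flatness enters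
    through transitivity. *)
Lemma tensor_same s t : eqflat M -> tensor_eq s t -> tsame s t.
Proof.
move=> Mf; elim=> {s t}.
- by move=> s; have [J [m' [es sE]]] := texpP s; exists J, m', es, es.
- by move=> s t _ [J [m' [es [et [sE tE co]]]]]; exists J, m', et, es; split.
- by move=> s t u _ st _; exact: tsame_trans.
- move=> s s' t t' _ [J [m [es [es' [sE sE' co]]]]] _ [J' [m' [et [et' [tE tE' co']]]]].
  exists (J + J')%type, (msum m m'),
    (trefine (@tinl J J') es ++ trefine (@tinr J J') et),
    (trefine (@tinl J J') es' ++ trefine (@tinr J J') et').
  rewrite !texp_cat !(texp_refine _ (tinlE m m')) !(texp_refine _ (tinrE m m')).
  split; rewrite -?sE -?sE' -?tE -?tE' //.
  move=> k; rewrite !tco_cat !tco_refine; congr (_ + _); apply: eq_bigr => i _.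
    by rewrite co.
  by rewrite co'.
- move=> s t; have [J [m [es sE]]] := texpP s; have [J' [m' [et tE]]] := texpP t.
  exists (J + J')%type, (msum m m'),
    (trefine (@tinl J J') es ++ trefine (@tinr J J') et),
    (trefine (@tinr J J') et ++ trefine (@tinl J J') es).
  rewrite !texp_cat !(texp_refine _ (tinlE m m')) !(texp_refine _ (tinrE m m')) -sE -tE.
  by split=> // k; rewrite !tco_cat addrC.
- move=> x; exists unit, (fun=> x), [:: (0, fun=> 1)], [::]; split=> //.
    by rewrite /texp /= sum_unit scale1r.
  by move=> j; rewrite /tco big_seq1 big_nil scaler0.
- move=> a b x; exists unit, (fun=> x), [:: (a + b, fun=> 1)], [:: (a, fun=> 1); (b, fun=> 1)].
  split; rewrite /texp /= ?sum_unit ?scale1r //.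
  by move=> j; rewrite /tco !big_cons !big_nil /= !scale1r !addr0.
- move=> a x y; exists bool, (fun b : bool => if b then x else y), [:: (a, fun=> 1)],
    [:: (a, fun b : bool => b%:R); (a, fun b : bool => (~~ b)%:R)].
  split; rewrite /texp /= ?big_bool /= ?scale1r ?scale0r ?addr0 ?add0r //.
  by case; rewrite /tco !big_cons !big_nil /= !scale1r ?scale0r ?addr0 ?add0r.
- move=> r a x; exists unit, (fun=> x), [:: ((r : R^c) *: a, fun=> 1)], [:: (a, fun=> r)].
  split; rewrite /texp /= ?sum_unit ?scale1r //.
  by move=> j; rewrite /tco !big_seq1 /= scale1r.
Qed.

End Expansion.

(** If the image of t under g vanishes, it does so over a finite free module; the coordinates of t
    there lie in the kernel of g and lift along f one by one. *)
Lemma eqflat_flat M : eqflat M -> flat M.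
Proof.
move=> Mf A B C f g fg t; split; last exact: exact_tensor0.
move=> /(tensor_same Mf)[J [m' [es [et [tE]]]]]; case: et => // _ co.
(* The expansion of the second components of t is read off [es], which expands the image of t under
   g. *)
pose eb := [seq (p.1.1, p.2.2) | p <- zip t es].
have [tb gE] : t = texp m' eb /\ forall j, g (tco eb j) = tco es j.
  rewrite /eb; clear eb co; elim: t es tE => [|[b x] t IH] [|[c e] es] //=.
    by split=> // j; rewrite /tco !big_nil linear0.
  move=> [gb -> /IH[tE gE]]; split; first by rewrite {1}tE.
  by move=> j; rewrite /tco !big_cons /= linearD linearZ gb [g (\sum_(_ <- _) _)]gE.
have ex j : exists a, f a = tco eb j by apply/fg; rewrite gE co /tco big_nil.
have [a aE] := choice ex.
exists [seq (a j, m' j) | j <- enum J].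
apply: tensor_sym; rewrite {1}tb; apply: tensor_trans (tensor_exp _ _) _.
rewrite /tensor_map -map_comp; under [X in tensor_eq _ X]eq_map do rewrite /= aE.
exact: tensor_refl.
Qed.

(** The hypothesis makes M a retract of the finite sum of the [Mt]; the matrices solving the
    components of a relation are put side by side. *)
Lemma flat_sum (M : lmodType R) (T : finType) (Mt : T -> lmodType R)
    (al : forall t, {linear M -> Mt t}) (be : forall t, {linear Mt t -> M}) :
  (forall x, x = \sum_t be t (al t x)) -> (forall t, flat (Mt t)) -> flat M.
Proof.
move=> sumE Mflat; apply: eqflat_flat => I m r rm0.
have ex t : exists p : {J : finType & ((J -> Mt t) * (I -> J -> R))%type},
    (forall i, al t (m i) = \sum_j (projT2 p).2 i j *: (projT2 p).1 j) /\
    forall j, \sum_i r i * (projT2 p).2 i j = 0.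
  have [|J [m' [a [mE aE]]]] := flat_eqflat (Mflat t) (m := fun i => al t (m i)) (r := r).
    rewrite -[RHS](linear0 (al t)) -rm0 linear_sum.
    by apply: eq_bigr => i _; rewrite linearZZ.
  by exists (existT _ J (m', a)).
pose p t := projT1 (cid (ex t)); pose pE t := projT2 (cid (ex t)).
exists {t : T & projT1 (p t)},
  (fun k => be (tag k) ((projT2 (p (tag k))).1 (tagged k))),
  (fun i k => (projT2 (p (tag k))).2 i (tagged k)); split=> [i|[t k]]; last exact: (pE t).2.
rewrite {1}(sumE (m i)); apply: (etrans _ (@sig_big_dep _ _ _ _ (fun t => projT1 (p t))
  xpredT (fun=> xpredT) (fun t k => (projT2 (p t)).2 i k *: be t ((projT2 (p t)).1 k)))).
apply: eq_bigr => t _; rewrite (pE t).1 linear_sum.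
by apply: eq_bigr => k _; rewrite linearZZ.
Qed.

Lemma flat_retract (M P : lmodType R) (i : {linear M -> P}) (p : {linear P -> M}) :
  (forall x, p (i x) = x) -> flat P -> flat M.
Proof.
move=> pi Pf; apply: (@flat_sum M unit (fun=> P) (fun=> i) (fun=> p)) => // x.
by rewrite sum_unit pi.
Qed.

End FlatModules.

(** * Flat objects *)

Section FlatObjects.
Variables (N : nat) (R : pzRingType).
Hypothesis N0 : (0 < N)%N.
Local Notation cx := (cx N R).

Definition scl_fun (V : lmodType R) (m : V) (a : R^o) : V := (a : R) *: m.
Fact scl_linear (V : lmodType R) (m : V) : linear (scl_fun m).
Proof. by move=> a x y; rewrite /scl_fun scalerDl scalerA. Qed.
Definition scl (V : lmodType R) (m : V) : {linear R^o -> V} := mklin (scl_linear m).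

(** Finite sums of disks on R: finitely generated projectives of the abelian category of
    N-complexes, in the role that R^n plays for modules. *)
Definition ff (I : finType) (deg : I -> int) : cx := disk N deg (fun _ => R^o).

Section FF.
Variables (I : finType) (deg : I -> int).
Definition fgen (i : I) : ff deg (deg i) := dgen N deg (fun _ => R^o) i 1.

Lemma ff_cov n (v : ff deg n) : cov (enum I) (sub_val v).
Proof. by move=> i; rewrite mem_enum. Qed.

Lemma ff_sum n (v : ff deg n) :
  v = \sum_i (sub_val v i : R) *: dif (ff deg) (deg i) n (fgen i).
Proof.
rewrite {1}(disk_sum N0 (enum_uniq _) (@ff_cov n v)) big_enum.
apply: eq_bigr => i _.
have {1}-> : sub_val v i = (sub_val v i : R) *: (1 : R^o).
  by rewrite [RHS]/GRing.scale /= mulr1.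
by rewrite !linearZ.
Qed.

Definition ffmap (Y : cx) (y : forall i, Y (deg i)) : chom (ff deg) Y :=
  dmap (fun i => scl (y i)).

Lemma ffmap_gen (Y : cx) (y : forall i, Y (deg i)) i : ffmap y (deg i) (fgen i) = y i.
Proof. by rewrite /ffmap /fgen dmap_gen // mklinE /scl_fun scale1r. Qed.

Lemma ff_hom_ext (Y : cx) (f g : chom (ff deg) Y) :
  (forall i, f (deg i) (fgen i) = g (deg i) (fgen i)) ->
  forall n v, f n v = g n v.
Proof.
move=> fg n v; rewrite (ff_sum v) !linear_sum; apply: eq_bigr => i _.
by rewrite !linearZZ !cmapD fg.
Qed.

Lemma ff_in (Y : cx) (S : subcx Y) (g : chom (ff deg) Y) :
  (forall i, S (deg i) (g (deg i) (fgen i))) -> forall n v, S n (g n v).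
Proof.
move=> Sg n v; rewrite (ff_sum v) linear_sum; apply: smem_sum => i _.
by rewrite linearZZ; apply: smemZ; rewrite cmapD; exact: scD.
Qed.

End FF.

Section Join.
Variables (I J : finType) (d : I -> int) (e : J -> int).
Definition djoin (k : I + J) : int :=
  match k with inl i => d i | inr j => e j end.
Definition finl : chom (ff d) (ff djoin) := ffmap (fun i => fgen djoin (inl i)).
Definition finr : chom (ff e) (ff djoin) := ffmap (fun j => fgen djoin (inr j)).
Definition fcase (Y : cx) (f : chom (ff d) Y) (g : chom (ff e) Y) : chom (ff djoin) Y :=
  ffmap (fun k => match k return Y (djoin k) with
                  | inl i => f (d i) (fgen d i) | inr j => g (e j) (fgen e j) end).
Lemma fcase_inl (Y : cx) (f : chom (ff d) Y) (g : chom (ff e) Y) n v : @fcase Y f g n (finl n v) = f n v.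
Proof.
apply: (ff_hom_ext (f := ccomp (fcase f g) finl)) => i.
rewrite ccompE ffmap_gen; exact: (ffmap_gen _ (inl i)).
Qed.
Lemma fcase_inr (Y : cx) (f : chom (ff d) Y) (g : chom (ff e) Y) n v : @fcase Y f g n (finr n v) = g n v.
Proof.
apply: (ff_hom_ext (f := ccomp (fcase f g) finr)) => i.
rewrite ccompE ffmap_gen; exact: (ffmap_gen _ (inr i)).
Qed.
End Join.

Definition factors (I : finType) (deg : I -> int) (Y : cx)
    (g : chom (ff deg) Y) n (x : ff deg n) :=
  exists (J : finType) (deg' : J -> int) (u : chom (ff deg) (ff deg'))
    (g' : chom (ff deg') Y), (forall i z, g i z = g' i (u i z)) /\ u n x = 0.

(* Flat objects of the category of N-complexes, by the equational criterion
   (for N = 2: the acyclic complexes of flat modules with flat cycles). *)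
Definition flatobj (Y : cx) := forall (I : finType) (deg : I -> int)
  (g : chom (ff deg) Y) n (x : ff deg n), g n x = 0 -> factors g x.

Lemma factorsD (I : finType) deg (Y : cx) (g h : chom (@ff I deg) Y) n (x : ff deg n) :
  factors g x -> factors h x -> factors (cadd g h) x.
Proof.
move=> [J [d [u [g' [gE u0]]]]] [K [e [v [h' [hE v0]]]]].
exists (J + K)%type, (djoin d e), (cadd (ccomp (finl d e) u) (ccomp (finr d e) v)),
  (fcase g' h'); split=> [i z|].
  by rewrite !caddE !ccompE linearD fcase_inl fcase_inr gE hE.
by rewrite caddE !ccompE u0 v0 !linear0 addr0.
Qed.

Lemma factors_eq (I : finType) deg (Y : cx) (g h : chom (@ff I deg) Y) n (x : ff deg n) :
  (forall i z, g i z = h i z) -> factors g x -> factors h x.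
Proof.
move=> gh [J [d [u [g' [gE u0]]]]]; exists J, d, u, g'; split=> // i z.
by rewrite -gh gE.
Qed.

Lemma factors_comp (I : finType) deg (Y Z : cx) (g : chom (@ff I deg) Y) (h : chom Y Z) n (x : ff deg n) :
  factors g x -> factors (ccomp h g) x.
Proof.
move=> [J [d [u [g' [gE u0]]]]]; exists J, d, u, (ccomp h g'); split=> // i z.
by rewrite /= gE.
Qed.

Lemma factors0 (I : finType) deg (Y : cx) n (x : @ff I deg n) : factors (c0 (ff deg) Y) x.
Proof.
exists void, (fun v : void => match v return int with end), (c0 _ _), (c0 _ _).
by split=> // i z /=; rewrite linear0.
Qed.

Lemma flatobj_retract (Y Z : cx) (i : chom Z Y) (p : chom Y Z) :
  (forall n z, p n (i n z) = z) -> flatobj Y -> flatobj Z.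
Proof.
move=> pi Yf I deg g n x gx.
have ix : (ccomp i g) n x = 0 by rewrite ccompE gx linear0.
by apply: factors_eq (factors_comp p (Yf _ _ _ _ _ ix)) => k z /=; rewrite pi.
Qed.

(** The finitely many generators have images in finitely many summands, so g is a finite sum of maps
    through single summands, each of which factors. *)
Lemma flatobj_cds (T : choiceType) (X : T -> cx) :
  (forall t, flatobj (X t)) -> flatobj (cds X).
Proof.
move=> Xf I deg g n x gx.
have [s sP] : exists s : seq T, forall i, cov s (sub_val (g (deg i) (fgen deg i))).
  have ex i : exists t : seq T, cov t (sub_val (g (deg i) (fgen deg i))) :=
    sub_mem (g (deg i) (fgen deg i)).
  have [s sP] := choice ex.
  exists (flatten [seq s i | i <- enum I]) => i t tN; apply: sP.
  apply: contra tN => ti; apply/flattenP; exists (s i) => //.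
  by apply: map_f; rewrite mem_enum.
pose gs u : chom (ff deg) (cds X) := foldr (fun t h => cadd (ccomp (cdin X t)
  (ccomp (cdp X t) g)) h) (c0 _ _) u.
have gsE u i z : gs u i z = \sum_(t <- u) cdin X t i (sub_val (g i z) t).
  by elim: u => [|t u IH]; rewrite ?big_nil ?big_cons //= IH.
apply: (@factors_eq _ _ _ (gs (undup s))) => [i z|].
  apply: (ff_hom_ext (f := gs (undup s))) => k; rewrite gsE -cds_sum ?undup_uniq //.
  exact: cov_undup.
elim: (undup s) => [|t u IH] /=; first exact: factors0.
apply: factorsD IH; apply: factors_comp; apply: Xf.
by rewrite ccompE gx linear0.
Qed.

(** A relation in [Y n] is an element of a finite free complex with all generators in degree n; the
    degree n part of its factorization is the matrix required. *)
Lemma flatobj_flat (Y : cx) n : flatobj Y -> flat (Y n).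
Proof.
move=> Yf; apply: eqflat_flat => I m r rm0.
pose deg (i : I) := n.
pose g : chom (ff deg) Y := ffmap m.
pose x : ff deg n := \sum_i r i *: (fgen deg i : ff deg n).
have gx : g n x = 0.
  rewrite linear_sum -[RHS]rm0; apply: eq_bigr => i _.
  by rewrite linearZZ (ffmap_gen m i).
have [J [deg' [u [g' [gE u0]]]]] := Yf _ _ _ _ _ gx.
exists J, (fun j => g' n (dif (ff deg') (deg' j) n (fgen deg' j))),
  (fun i j => (sub_val (u n (fgen deg i)) j : R)); split=> [i|j].
  rewrite -(ffmap_gen m i) -/g gE {1}(ff_sum (u (deg i) (fgen deg i))) linear_sum.
  by apply: eq_bigr => j _; rewrite linearZ.
have := congr1 (dcomp N deg' (fun _ => R^o) n j) u0.
rewrite linear0 /x !linear_sum => h; rewrite -[RHS]h.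
by apply: eq_bigr => i _; rewrite !linearZ.
Qed.

(** Here u is the coefficient matrix of a finite linear system and z its right-hand side in S: a
    system solvable in Y is solvable in S. *)
Definition pure (Y : cx) (S : subcx Y) := forall (I J : finType)
    (d : I -> int) (e : J -> int) (u : chom (ff d) (ff e)) (z : chom (ff d) Y),
  (forall n v, S n (z n v)) ->
  (exists w : chom (ff e) Y, forall n v, w n (u n v) = z n v) ->
  exists w : chom (ff e) Y, (forall n v, S n (w n v)) /\
    forall n v, w n (u n v) = z n v.

Lemma ff_lift (I : finType) deg (Y Z : cx) (p : chom Y Z) (g : chom (@ff I deg) Z) :
  (forall n z, exists y, p n y = z) ->
  exists h : chom (ff deg) Y, forall n v, p n (h n v) = g n v.
Proof.
move=> ps; pose y i := projT1 (cid (ps (deg i) (g (deg i) (fgen deg i)))).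
exists (ffmap y); apply: (ff_hom_ext (f := ccomp p (ffmap y))) => i.
rewrite ccompE ffmap_gen.
exact: (projT2 (cid (ps (deg i) (g (deg i) (fgen deg i))))).
Qed.

(** Lift g to h with values in Y. Then h x lies in S, purity gives w into S with w x = h x, and
    [h - w] is a lift of g that kills x. *)
Lemma flatobj_pure_quot (Y : cx) (S : subcx Y) : flatobj Y -> pure S -> flatobj (qcx S).
Proof.
move=> Yf Sp I deg g n x gx.
have [h hE] := ff_lift g (@qcpi_surj _ _ _ S).
pose z : chom (@ff unit (fun=> n)) Y := ffmap (fun=> h n x).
pose u : chom (@ff unit (fun=> n)) (ff deg) := ffmap (fun=> x).
have [i v||w [wS wE]] := Sp _ _ _ _ u z.
- apply: ff_in => -[]; rewrite ffmap_gen.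
  by apply/qcpi_eq0; rewrite hE.
- exists h; apply: (ff_hom_ext (f := ccomp h u)) => -[].
  by rewrite ccompE !ffmap_gen.
have hx : (csub h w) n x = 0.
  have := wE n (fgen (fun=> n) tt).
  by rewrite csubE (ffmap_gen (fun=> x) tt) (ffmap_gen (fun=> h n x) tt) => ->; rewrite subrr.
apply: factors_eq (factors_comp (qcpi S) (Yf _ _ _ _ _ hx)) => i v.
by rewrite ccompE csubE linearB hE (qcpi_eq0 _ _).2 ?subr0.
Qed.

End FlatObjects.

(** * Bounding flat quotients *)

Section SmallQuotients.
Variables (N : nat) (R : pzRingType).
Hypothesis N0 : (0 < N)%N.
Local Notation cx := (cx N R).

Definition elt (Y : cx) := {i : int & Y i}.
Definition mkelt (Y : cx) i (y : Y i) : elt Y := existT _ i y.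
Definition dg (Y : cx) (e : elt Y) : int := projT1 e.
Definition vl (Y : cx) (e : elt Y) : Y (dg e) := projT2 e.

(** The formal combination [rho] is kept apart from the family h, so that the same combination can
    be evaluated on two families of one type. *)
Definition cval (Y : cx) (J : Type) (h : J -> elt Y) n (rho : seq (R * J)) : Y n :=
  \sum_(p <- rho) p.1 *: dif Y (dg (h p.2)) n (vl (h p.2)).

Lemma dif_eq (Y : cx) (t k n : int) (y : Y t) : t = k ->
  dif Y k n (dif Y t k y) = dif Y t n y.
Proof. by move=> tk; case: _ / tk; rewrite dif_id. Qed.

Lemma mkelt_dif (Y : cx) (e : elt Y) k : dg e = k -> mkelt (dif Y (dg e) k (vl e)) = e.
Proof. by case: e => t y /= tk; case: _ / tk; rewrite dif_id. Qed.

Definition sumf (T J1 J2 : Type) (r : J1 -> T) (y : J2 -> T) (k : J1 + J2) : T :=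
  match k with inl j => r j | inr j => y j end.

Definition linl (J1 J2 : Type) (rho : seq (R * J1)) : seq (R * (J1 + J2)) :=
  [seq (p.1, inl p.2) | p <- rho].
Definition linr (J1 J2 : Type) (rho : seq (R * J2)) : seq (R * (J1 + J2)) :=
  [seq (p.1, inr p.2) | p <- rho].
Definition lneg (J : Type) (rho : seq (R * J)) : seq (R * J) :=
  [seq (- p.1, p.2) | p <- rho].

Section Cval.
Variable Y : cx.

Lemma cval_cat (J : Type) (h : J -> elt Y) n rho rho' :
  cval h n (rho ++ rho') = cval h n rho + cval h n rho'.
Proof. by rewrite /cval big_cat. Qed.

Lemma cval_neg (J : Type) (h : J -> elt Y) n rho :
  cval h n (lneg rho) = - cval h n rho.
Proof. by rewrite /cval big_map -sumrN; apply: eq_bigr => p _; rewrite scaleNr. Qed.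

Lemma cval_linl (J1 J2 : Type) (r : J1 -> elt Y) (y : J2 -> elt Y) n rho :
  cval (sumf r y) n (linl J2 rho) = cval r n rho.
Proof. by rewrite /cval big_map. Qed.

Lemma cval_linr (J1 J2 : Type) (r : J1 -> elt Y) (y : J2 -> elt Y) n rho :
  cval (sumf r y) n (linr J1 rho) = cval y n rho.
Proof. by rewrite /cval big_map. Qed.

Lemma cval1 (J : Type) (h : J -> elt Y) n j :
  cval h n [:: (1, j)] = dif Y (dg (h j)) n (vl (h j)).
Proof. by rewrite /cval big_seq1 scale1r. Qed.

Lemma cval1_self (J : Type) (h : J -> elt Y) j :
  cval h (dg (h j)) [:: (1, j)] = vl (h j).
Proof. by rewrite cval1 dif_id. Qed.

Lemma cval_scale (J : Type) (h : J -> elt Y) n a rho :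
  cval h n [seq (a * p.1, p.2) | p <- rho] = a *: cval h n rho.
Proof.
rewrite /cval big_map scaler_sumr; apply: eq_bigr => p _.
by rewrite scalerA.
Qed.

Lemma cval_dif (J : Type) (h : J -> elt Y) (n m : int) rho : n <= m ->
  dif Y n m (cval h n rho) = cval h m [seq p <- rho | dg (h p.2) <= n].
Proof.
move=> nm; rewrite /cval big_filter linear_sum [RHS]big_mkcond.
apply: eq_bigr => p _; rewrite linearZZ; case: ifP => tn; first by rewrite dif_comp.
by rewrite (@dif_out _ _ Y (dg (h p.2)) n) ?tn // linear0 scaler0.
Qed.

End Cval.

(* The type of a family h of elements of Y over X: its degrees, the linear
   relations it satisfies, and its images in X. *)
Definition lab (X : cx) (J : Type) : Type :=
  ((J -> int) * (int -> seq (R * J) -> Prop) * (J -> elt X))%type.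

Definition etype (X Y : cx) (f : chom Y X) (J : Type) (h : J -> elt Y) : lab X J :=
  (fun j => dg (h j), fun n rho => cval h n rho = 0,
   fun j => mkelt (f _ (vl (h j)))).

Section EType.
Variables (X Y : cx) (f : chom Y X) (J1 J2 : Type).
Variables (r : J1 -> elt Y) (y y' : J2 -> elt Y).
Hypothesis yy' : etype f (sumf r y') = etype f (sumf r y).

Lemma etype_dg j : dg (y' j) = dg (y j).
Proof. by have [/(congr1 (@^~ (inr j)))] := yy'. Qed.

Lemma etype_rel n rho rho' :
  cval r n rho = cval y n rho' <-> cval r n rho = cval y' n rho'.
Proof.
have rE z : cval r n rho = cval z n rho' <->
    cval (sumf r z) n (linl J2 rho ++ lneg (linr J1 rho')) = 0.
  rewrite cval_cat cval_neg cval_linl cval_linr.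
  by split=> [->|/eqP]; rewrite ?subrr // subr_eq0 => /eqP.
rewrite !rE.
have [_ /(congr1 (fun q => q n (linl J2 rho ++ lneg (linr J1 rho')))) -> _] := yy'.
by [].
Qed.

Lemma etype_img n rho : f n (cval y' n rho) = f n (cval y n rho).
Proof.
have fE z : f n (cval z n rho) =
    cval (fun k => mkelt (f _ (vl (sumf r z k)))) n (linr J1 rho).
  rewrite /cval big_map linear_sum; apply: eq_bigr => p _.
  by rewrite linearZZ cmapD.
by have [_ _ e] := yy'; rewrite !fE e.
Qed.

End EType.

(** Elements of E serve as parameters r; whatever type over r is realised in Y must be realised in
    E. *)
Definition exclosed (X Y : cx) (f : chom Y X) (J1 J2 : Type) (E : elt Y -> Prop) :=
  forall (r : J1 -> elt Y) (y : J2 -> elt Y), (forall j, E (r j)) ->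
  exists y', (forall j, E (y' j)) /\ etype f (sumf r y') = etype f (sumf r y).

(* Löwenheim-Skolem: every Y contains an existentially closed subset that is
   the image of this well-founded tree type, independent of Y. *)
Inductive wt (X : cx) (J1 J2 : Type) : Type :=
| wleaf of int
| wnode of lab X (J1 + J2) & J2 & (J1 -> wt X J1 J2).

Section Eval.
Variables (X Y : cx) (f : chom Y X) (J1 J2 : Type) (c : forall i, Y i).

Definition wpick (l : lab X (J1 + J2)) (r : J1 -> elt Y) : J2 -> elt Y :=
  if pselect (exists y, etype f (sumf r y) = l) is left e then projT1 (cid e)
  else fun=> mkelt (0 : Y 0).

Fixpoint weval (w : wt X J1 J2) : elt Y :=
  match w with
  | wleaf i => mkelt (c i)
  | wnode l j ch => wpick l (fun k => weval (ch k)) j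
  end.

(** Trees for the parameters, put under a node labelled by the type of (r, y), evaluate to a chosen
    realisation of that same type. *)
Lemma weval_closed : exclosed f J1 J2 (fun e => exists w, weval w = e).
Proof.
move=> r y /choice[ch chE].
exists (fun j => weval (wnode (etype f (sumf r y)) j ch)); split=> [j|]; first by eexists.
have -> : (fun j => weval (wnode (etype f (sumf r y)) j ch)) =
    wpick (etype f (sumf r y)) r.
  by apply: funext => j /=; congr (wpick _ _ j); apply: funext.
rewrite /wpick; case: pselect => [e|]; first exact: (projT2 (cid e)).
by case; exists y.
Qed.

End Eval.

Section Closed.
Variables (X Y : cx) (f : chom Y X) (A B : Type) (E : elt Y -> Prop).
Hypothesis Ecl : exclosed f (nat + A) (nat + B) E.
Variables (e0 : elt Y) (Ee0 : E e0).

(** Take the combination itself as the unknown. Its type contains the relation identifying it with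
    the combination of the parameters, so its realisation in E is that very element. *)
Lemma closed_cval (r : nat + A -> elt Y) n rho : (forall j, E (r j)) ->
  E (mkelt (cval r n rho)).
Proof.
move=> Er; have [y' [Ey' yy']] := Ecl (fun _ => mkelt (cval r n rho)) Er.
have := etype_dg yy' (inl 0%N).
have /esym yE : cval (fun _ : nat + B => mkelt (cval r n rho)) n [:: (1, inl 0%N)] =
  cval r n rho by rewrite cval1 dif_id.
by have := (etype_rel yy' n rho [:: (1, inl 0%N)]).1 yE; rewrite cval1 /= => -> dE;
  rewrite mkelt_dif.
Qed.

Definition esm_pred i (x : Y i) := E (mkelt x).

Lemma esm_lin i a (x y : Y i) : esm_pred x -> esm_pred y -> esm_pred (a *: x + y).
Proof.
move=> Ex Ey; pose r (k : nat + A) := if k is inl 0%N then mkelt x else mkelt y.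
have := @closed_cval r i [:: (a, inl 0%N); (1, inl 1%N)].
rewrite /cval !big_cons big_nil addr0 /= !dif_id scale1r; apply.
by rewrite /r => -[[|k]|a'].
Qed.

Lemma esm0 i : esm_pred (0 : Y i).
Proof. by have := @closed_cval (fun=> e0) i [::]; rewrite /cval big_nil; apply. Qed.

Lemma esmD i (x y : Y i) : esm_pred x -> esm_pred y -> esm_pred (x + y).
Proof. by move=> Ex Ey; have := esm_lin 1 Ex Ey; rewrite scale1r. Qed.

Lemma esmZ i a (x : Y i) : esm_pred x -> esm_pred (a *: x).
Proof. by move=> Ex; have := esm_lin a Ex (esm0 i); rewrite addr0. Qed.

Lemma esm_dif i j (x : Y i) : esm_pred x -> esm_pred (dif Y i j x).
Proof.
move=> Ex; have := @closed_cval (fun=> mkelt x) j [:: (1, inl 0%N)].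
by rewrite cval1; apply.
Qed.

Definition esc : subcx Y :=
  @SubCx N R Y (fun i => Submod (@esm0 i) (@esmD i) (@esmZ i)) esm_dif.

(** A finite system fits into the [nat] summands of the two index types: constants become
    parameters, a solution in Y the unknowns, and a realisation of its type in E is a solution
    again. *)
Lemma esc_pure : pure esc.
Proof.
move=> I J d e u z zE [w wE].
(* A finite family is laid out along [nat] by its enumeration and padded with [e0]. *)
pose F (I : finType) (G : I -> elt Y) k := nth e0 [seq G i | i <- enum I] k.
have FE (I' : finType) (G : I' -> elt Y) i : F I' G (index i (enum I')) = G i.
  have ie : i \in enum I' by rewrite mem_enum.
  by rewrite /F (nth_map i) ?index_mem // nth_index.
have FS (I' : finType) (G : I' -> elt Y) k : (forall i, E (G i)) -> E (F I' G k).
  by move=> EG; rewrite /F; elim: (enum I') k => [|i s IH] [|k] //=.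
pose r (k : nat + A) := if k is inl k then F I (fun i => mkelt (z (d i) (fgen N R d i))) k else e0.
pose y (k : nat + B) := if k is inl k then F J (fun j => mkelt (w (e j) (fgen N R e j))) k else e0.
have Er k : E (r k) by case: k => [k|//]; apply: FS => i; exact: zE.
have [y' [Ey' yy']] := Ecl y Er.
pose b (j : J) : nat + B := inl (index j (enum J)).
have yE j : y (b j) = mkelt (w (e j) (fgen N R e j)) by rewrite /y /b FE.
have dE j : dg (y' (b j)) = e j by rewrite (etype_dg yy') /y /b FE.
pose w' : chom (ff N R e) Y :=
  ffmap (fun j => dif Y (dg (y' (b j))) (e j) (vl (y' (b j)))).
exists w'; split.
  apply: (ff_in N0) => j; rewrite /w' ffmap_gen //; apply: esm_dif.
  by have := Ey' (b j); case: (y' (b j)).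
apply: (ff_hom_ext N0 (f := ccomp w' u)) => i.
rewrite ccompE [in LHS](ff_sum N0 (u (d i) (fgen N R d i))) linear_sum.
pose rho := [seq (sub_val (u (d i) (fgen N R d i)) j : R, b j) | j <- enum J].
have rE : cval r (d i) [:: (1, inl (index i (enum I)))] = z (d i) (fgen N R d i).
  by rewrite cval1 /r FE dif_id.
have := etype_rel yy' (d i) [:: (1, inl (index i (enum I)))] rho.
rewrite rE => -[h _]; rewrite h.
  rewrite /cval /rho big_map big_enum; apply: eq_bigr => j _.
  by rewrite linearZZ cmapD /w' ffmap_gen // dif_eq.
rewrite -wE {1}(ff_sum N0 (u (d i) (fgen N R d i))) linear_sum /cval /rho big_map.
rewrite big_enum; apply: eq_bigr => j _.
by rewrite linearZZ cmapD yE.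
Qed.

End Closed.

(** Solve in V and project the values on generators to K. The error of the projected solution lies
    in both S and K, so it is 0. *)
Lemma pure_summand (Y : cx) (V S K : subcx Y) :
  (forall i x, V i x -> exists s k, [/\ S i s, K i k & x = s + k]) ->
  (forall i x, K i x -> V i x) -> (forall i x, S i x -> K i x -> x = 0) ->
  pure V -> pure K.
Proof.
move=> Vd KV SK Vp I J d e u z zK /(Vp _ _ _ _ _ _ (fun n v => KV n _ (zK n v))).
move=> [w [wV wE]].
have ex j : exists k, S _ (w (e j) (fgen N R e j) - k) /\ K _ k.
  by have [s [k [sS kK ->]]] := Vd _ _ (wV (e j) (fgen N R e j)); exists k; rewrite addrK.
pose k j := projT1 (cid (ex j)).
have kP j : S _ (w (e j) (fgen N R e j) - k j) /\ K _ (k j) := projT2 (cid (ex j)).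
exists (ffmap k).
have kK : forall n v, K n (ffmap k n v).
  by apply: (ff_in N0) => j; rewrite ffmap_gen //; case: (kP j).
split=> // n v; apply/eqP; rewrite eq_sym -subr_eq0; apply/eqP; apply: SK.
  rewrite -wE; have := ff_in N0 (g := csub w (ffmap k)) (S := S); apply => j.
  by rewrite csubE ffmap_gen //; case: (kP j).
by apply: smemB => //; exact: kK.
Qed.

Lemma preim_smD (U V : lmodType R) (f : {linear U -> V}) (S : submod V) x y :
  S (f x) -> S (f y) -> S (f (x + y)).
Proof. by rewrite linearD; exact: smemD. Qed.
Lemma preim_smZ (U V : lmodType R) (f : {linear U -> V}) (S : submod V) a x :
  S (f x) -> S (f (a *: x)).
Proof. by rewrite linearZZ; exact: smemZ. Qed.
Lemma preim_sm0 (U V : lmodType R) (f : {linear U -> V}) (S : submod V) : S (f 0).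
Proof. by rewrite linear0; exact: smem0. Qed.
Definition preim_sm (U V : lmodType R) (f : {linear U -> V}) (S : submod V) :=
  Submod (@preim_sm0 U V f S) (@preim_smD U V f S) (@preim_smZ U V f S).
Fact preim_scD (Y Z : cx) (f : chom Y Z) (S : subcx Z) i j x :
  preim_sm (f i) (S i) x -> preim_sm (f j) (S j) (dif Y i j x).
Proof. by rewrite /= cmapD; exact: scD. Qed.
Definition preim_sc (Y Z : cx) (f : chom Y Z) (S : subcx Z) : subcx Y :=
  SubCx (@preim_scD Y Z f S).

(** Solve the system modulo S inside C, lift the solution to Y, and correct the remaining error,
    which has values in S, by purity of S. *)
Lemma pure_preim (Y : cx) (S : subcx Y) (C : subcx (qcx S)) :
  pure S -> pure C -> pure (preim_sc (qcpi S) C).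
Proof.
move=> Sp Cp I J d e u z zV [w wE].
have [w1 [w1C w1E]] : exists w1 : chom (ff N R e) (qcx S),
    (forall n v, C n (w1 n v)) /\ forall n v, w1 n (u n v) = ccomp (qcpi S) z n v.
  by apply: Cp => //; exists (ccomp (qcpi S) w) => n v; rewrite !ccompE wE.
have [w2 w2E] := ff_lift N0 w1 (@qcpi_surj _ _ _ S).
have [w3 [w3S w3E]] : exists w3 : chom (ff N R e) Y,
    (forall n v, S n (w3 n v)) /\ forall n v, w3 n (u n v) = csub z (ccomp w2 u) n v.
  apply: Sp => [n v|]; last first.
    by exists (csub w w2) => n v; rewrite !csubE ccompE wE.
  apply/qcpi_eq0; rewrite csubE ccompE linearB w2E w1E ccompE subrr //.
exists (cadd w2 w3); split=> n v; last by rewrite caddE w3E csubE ccompE addrC subrK.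
apply/(preim_smD (f := qcpi S n)); first by rewrite w2E.
by rewrite (qcpi_eq0 _ _).2 //; exact: smem0.
Qed.

Section Small.
Variables (X : cx).

(** W1 will enumerate a pure subcomplex of a quotient of Y, J2 contains lifts of its elements to Y,
    and J1 all combinations of these lifts. The outer closure must accept the lifts as unknowns and
    the combinations as parameters. *)
Let W1 := wt X (nat + void) (nat + void).
Let J2 := (nat + W1)%type.
Let J1 := (nat + (int * seq (R * J2)))%type.
Definition small := wt X J1 J2.

Variables (Y : cx) (f : chom Y X).
Hypothesis nopure : forall K : subcx Y, pure K ->
  (forall i x, K i x -> f i x = 0) -> forall i x, K i x -> x = 0.

Section DiffSubCx.
Variables (y y' : J2 -> elt Y).
Hypothesis ydg : forall j, dg (y' j) = dg (y j).
Definition diff_mem n (x : Y n) := exists rho, x = cval y n rho - cval y' n rho.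
Lemma diff0 n : diff_mem (0 : Y n).
Proof. by exists [::]; rewrite /cval !big_nil subrr. Qed.
Lemma diffD n (x z : Y n) : diff_mem x -> diff_mem z -> diff_mem (x + z).
Proof.
move=> [rho ->] [rho' ->]; exists (rho ++ rho').
by rewrite !cval_cat opprD addrACA.
Qed.
Lemma diffZ n a (x : Y n) : diff_mem x -> diff_mem (a *: x).
Proof.
move=> [rho ->]; exists [seq (a * p.1, p.2) | p <- rho].
by rewrite !cval_scale scalerBr.
Qed.
Lemma diff_dif n m (x : Y n) : diff_mem x -> diff_mem (dif Y n m x).
Proof.
move=> [rho ->]; have [nm|nm] := boolP (n <= m); last first.
  by rewrite dif_out ?(negPf nm) //; exact: diff0.
exists [seq p <- rho | dg (y p.2) <= n]; rewrite linearB !cval_dif //.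
by congr (_ - cval _ _ _); apply: eq_filter => p; rewrite ydg.
Qed.
Definition diff_sc : subcx Y :=
  @SubCx N R Y (fun n => Submod (@diff0 n) (@diffD n) (@diffZ n)) diff_dif.
End DiffSubCx.

(** Suppose x0 is outside the closed pure subcomplex S. Let C be a pure subcomplex of Y/S through
    the class of x0, enumerated by W1, with lifts y to Y. Since S is existentially closed, it
    contains y' of the same type as y over all combinations of y that lie in S. The differences y -
    y' span a complement K of S in the preimage of C, so K is pure; it lies in the kernel of f, so
    it is 0, and then y lies in S. *)
Lemma small_surj : exists e : small -> elt Y, forall x, exists w, e w = x.
Proof.
pose ev := @weval X Y f J1 J2 (fun=> 0); exists ev => x0; apply: contrapT => Ex0.
pose E := fun e : elt Y => exists w, ev w = e.
have Ecl : exclosed f J1 J2 E by exact: weval_closed.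
have Ee0 : E (mkelt (0 : Y 0)) by exists (wleaf X J1 J2 0).
pose S := esc Ecl Ee0; have Sp : pure S by exact: esc_pure.
pose Z := qcx S; pose z0 : Z (dg x0) := qcpi S _ (vl x0).
(* Only purity is wanted in Z, so types are taken over the zero map. Leaves evaluate to [z0] pushed
   to the various degrees, which puts [z0] into C. *)
pose ev1 := @weval X Z (c0 Z X) (nat + void)%type (nat + void)%type
  (fun i => dif Z (dg x0) i z0).
pose E1 := fun e : elt Z => exists w, ev1 w = e.
have E1cl : exclosed (c0 Z X) (nat + void) (nat + void) E1 by exact: weval_closed.
pose w0 : W1 := wleaf _ _ _ (dg x0).
have w0E : ev1 w0 = mkelt z0 by exact: (congr1 (@mkelt Z (dg x0)) (dif_id z0)).
have E1z0 : E1 (mkelt z0) by exists w0.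
pose C := esc E1cl E1z0; have Cp : pure C by exact: esc_pure.
have lift (w : W1) : exists a : Y (dg (ev1 w)), qcpi S _ a = vl (ev1 w).
  exact: qcpi_surj.
pose y (j : J2) : elt Y :=
  match j with inl _ => mkelt (0 : Y 0) | inr w => mkelt (projT1 (cid (lift w))) end.
have yE (w : W1) : qcpi S _ (vl (y (inr w))) = vl (ev1 w) := projT2 (cid (lift w)).
(* Every combination of the y that falls into S becomes a parameter; the other indices are filled
   with 0. *)
pose r (j : J1) : elt Y := if j is inr (n, rho) then
  (if pselect (E (mkelt (cval y n rho))) then mkelt (cval y n rho) else mkelt (0 : Y 0))
  else mkelt (0 : Y 0).
have Er j : E (r j) by case: j => [//|[n rho]] /=; case: pselect.
have [y' [Ey' yy']] := Ecl r y Er.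
have ydg j : dg (y' j) = dg (y j) := etype_dg yy' j.
pose K := diff_sc ydg.
have y'S n rho : S n (cval y' n rho).
  apply: smem_sum => p _; apply: smemZ; apply: scD.
  by have := Ey' p.2; case: (y' p.2).
(* If a combination of the differences lies in S, so does the same combination of the y. It is then
   a parameter, and y' satisfies the same equation, so the difference is 0. *)
have SK i x : S i x -> K i x -> x = 0.
  move=> Sx [rho xE]; have Ey : E (mkelt (cval y i rho)).
    by have := smemD Sx (y'S i rho); rewrite xE subrK.
  have rE : r (inr (i, rho)) = mkelt (cval y i rho) by rewrite /=; case: pselect.
  have := (etype_rel yy' i [:: (1, inr (i, rho))] rho).1.
  by rewrite cval1 rE dif_id => /(_ erefl) e; rewrite xE -e subrr.
have K0 : forall i x, K i x -> x = 0.
  apply: nopure => [|i x [rho ->]]; last by rewrite linearB (etype_img yy') subrr.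
  apply: (@pure_summand Y (preim_sc (qcpi S) C) S K) => //; last exact: pure_preim.
  - move=> i x [w wE].
    pose rho : seq (R * J2) := [:: (1, inr w)].
    exists (x - (cval y i rho - cval y' i rho)), (cval y i rho - cval y' i rho).
    split; last by rewrite subrK.
      rewrite opprB addrCA; apply: smemD; first exact: y'S.
      apply/qcpi_eq0; rewrite linearB cval1 cmapD yE.
      have {}wE : ev1 w = mkelt (qcpi S i x) := wE.
      by rewrite -[dg (y (inr w))]/(dg (ev1 w)) wE dif_id subrr.
    by exists rho.
  move=> i x [rho ->]; apply: smemB; last first.
    have c0 : qcpi S i (cval y' i rho) = 0 by apply/qcpi_eq0; exact: y'S.
    by rewrite [smem _ _]/(C i (qcpi S i (cval y' i rho))) c0; exact: (smem0 (C i)).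
  apply: smem_sum => -[a [k|w]] _; apply: smemZ; apply: scD.
    by apply: smem0.
  rewrite [smem _ _]/(C _ (qcpi S _ (vl (y (inr w))))) yE.
  have E1w : E1 (mkelt (vl (ev1 w))) by exists w; case: (ev1 w).
  exact: E1w.
apply: Ex0; suff : S _ (vl x0) by case: (x0).
apply/qcpi_eq0; rewrite -/z0.
have Sy : S _ (vl (y (inr w0))).
  have : K _ (cval y (dg (y (inr w0))) [:: (1, inr w0)] -
    cval y' (dg (y (inr w0))) [:: (1, inr w0)]) by exists [:: (1, inr w0)].
  move/K0/eqP; rewrite subr_eq0 => /eqP.
  rewrite cval1_self => ->; exact: y'S.
have := (qcpi_eq0 _ _).2 Sy; rewrite yE => e.
by rewrite -(dif_id z0); exact: e.
Qed.

End Small.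

End SmallQuotients.

(** * Precovers by flat objects *)

Section Precover.
Variables (N : nat) (R : pzRingType).
Hypothesis N0 : (0 < N)%N.
Local Notation cx := (cx N R).

Lemma chom_inv (A B : cx) (f : chom A B) :
  (forall i x, f i x = 0 -> x = 0) -> (forall i y, exists x, f i x = y) ->
  exists2 g : chom B A, forall i y, f i (g i y) = y & forall i x, g i (f i x) = x.
Proof.
move=> finj fsurj; pose g i y := projT1 (cid (fsurj i y)).
have fg i y : f i (g i y) = y := projT2 (cid (fsurj i y)).
have injf i : injective (f i).
  by move=> x y xy; apply/eqP; rewrite -subr_eq0; apply/eqP/finj; rewrite linearB xy subrr.
have gL i : linear (g i) by move=> a x y; apply: injf; rewrite linearP !fg.
have gD i j y : mklin (gL j) (dif B i j y) = dif A i j (mklin (gL i) y).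
  by apply: injf; rewrite !mklinE fg cmapD fg.
exists (CHom gD) => [|i x]; first exact: fg.
by apply: injf; exact: fg.
Qed.

Section Zero.
Variable Y : cx.
Fact zsm0 i : (0 : Y i) = 0. Proof. by []. Qed.
Fact zsmD i (x y : Y i) : x = 0 -> y = 0 -> x + y = 0.
Proof. by move=> -> ->; rewrite addr0. Qed.
Fact zsmZ i a (x : Y i) : x = 0 -> a *: x = 0.
Proof. by move=> ->; rewrite scaler0. Qed.
Fact zscD i j (x : Y i) : x = 0 -> dif Y i j x = 0.
Proof. by move=> ->; rewrite linear0. Qed.
Definition zero_sc : subcx Y :=
  @SubCx N R Y (fun i => Submod (@zsm0 i) (@zsmD i) (@zsmZ i)) zscD.
Lemma zero_pure : pure zero_sc.
Proof.
move=> I J d e u z z0 _; exists (c0 _ _); split=> // n v.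
by rewrite [RHS]z0.
Qed.
End Zero.

Section Maximal.
Variables (X Y : cx) (f : chom Y X).

Definition pker_prop (K : subcx Y) := pure K /\ forall i x, K i x -> f i x = 0.
Definition pker := {K : subcx Y | pker_prop K}.
Definition pker_le (K L : pker) := `[< forall i x, sval K i x -> sval L i x >].

Fact pker0_prop : pure (zero_sc Y) /\ forall i x, zero_sc Y i x -> f i x = 0.
Proof. by split=> [|i x ->]; [exact: zero_pure | rewrite linear0]. Qed.
Definition pker0 : pker := exist pker_prop _ pker0_prop.

Section Union.
Variables (A : set pker) (K0 : pker) (AK0 : A K0) (Atot : total_on A pker_le).
Definition un_mem i (x : Y i) := exists2 K, A K & sval K i x.
Lemma un0 i : un_mem (0 : Y i). Proof. by exists K0 => //; exact: smem0. Qed.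
Lemma unD i (x y : Y i) : un_mem x -> un_mem y -> un_mem (x + y).
Proof.
move=> [K AK Kx] [L AL Ly]; have [/asboolP KL|/asboolP LK] := Atot AK AL.
  by exists L => //; apply: smemD => //; exact: KL.
by exists K => //; apply: smemD => //; exact: LK.
Qed.
Lemma unZ i a (x : Y i) : un_mem x -> un_mem (a *: x).
Proof. by move=> [K AK Kx]; exists K => //; exact: smemZ. Qed.
Lemma un_dif i j (x : Y i) : un_mem x -> un_mem (dif Y i j x).
Proof. by move=> [K AK Kx]; exists K => //; exact: scD. Qed.
Definition un_sc : subcx Y :=
  @SubCx N R Y (fun i => Submod (@un0 i) (@unD i) (@unZ i)) un_dif.

(** A finite system has finitely many constants, which all lie in one member of the chain, where it
    can be solved. *)
Lemma un_prop : pure un_sc /\ forall i x, un_sc i x -> f i x = 0.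
Proof.
split=> [|i x [K _ Kx]]; last by have [_] := svalP K; apply.
move=> I J d e u z zU wE.
have [K AK Kz] : exists2 K, A K & forall i, sval K _ (z (d i) (fgen N R d i)).
  have : forall s : seq I, exists2 K, A K &
      forall i, i \in s -> sval K _ (z (d i) (fgen N R d i)).
    elim=> [|i s [K AK Ks]]; first by exists K0.
    have [L AL Li] := zU _ (fgen N R d i).
    have [/asboolP KL|/asboolP LK] := Atot AK AL.
      by exists L => // j; rewrite in_cons => /orP[/eqP ->//|/Ks/KL].
    by exists K => // j; rewrite in_cons => /orP[/eqP ->|/Ks //]; exact: LK.
  by move=> /(_ (enum I))[K AK KE]; exists K => // i; apply: KE; rewrite mem_enum.
have [Kp _] := svalP K.
have [w [wK wu]] := Kp _ _ _ _ u z (ff_in N0 Kz) wE.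
by exists w; split=> // n v; exists K.
Qed.
End Union.

Lemma max_pker : exists K : pker, forall L : pker, pker_le K L -> pker_le L K.
Proof.
apply: (@ZL_preorder pker pker0 pker_le).
- by move=> K; apply/asboolP.
- by move=> K L M /asboolP KL /asboolP LM; apply/asboolP => i x /KL; exact: LM.
move=> A Atot; have [[K0 AK0]|A0] := pselect (exists K, A K); last first.
  by exists pker0 => K AK; case: A0; exists K.
exists (exist pker_prop _ (un_prop AK0 Atot)) => K AK; apply/asboolP => i x Kx /=.
by exists K.
Qed.

End Maximal.

Section Cover.
Variable X : cx.

(** The degree of the element named by a tree depends on Y, so each tree gets a generator in every
    degree. *)
Let gens : choiceType := {classic (int * small X)%type}.
Let free_small : cx := disk N (fun g : gens => (g : int * small X).1) (fun _ => R^o).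
(** Quotients of one fixed complex are given by predicates on it, so flat objects over X of this
    shape form a type over which [cds] can sum. *)
Let codes := {K : subcx free_small & {phi : chom (qcx K) X | flatobj (qcx K)}}.

Definition precover : cx := cds (fun a : {classic codes} => qcx (projT1 (a : codes))).
Definition precover_map : chom precover X :=
  cdmap (fun a : {classic codes} => sval (projT2 (a : codes))).

Lemma precover_flat : flatobj precover.
Proof. by apply: flatobj_cds => // a; exact: (svalP (projT2 (a : codes))). Qed.

(** Divide Y by a maximal pure subcomplex of the kernel of f. The quotient is still flat, maps to X,
    and by [small_surj] is isomorphic to a quotient of [free_small], that is to a summand of the
    precover. *)
Lemma precover_lift (Y : cx) (f : chom Y X) : flatobj Y ->
  exists g : chom Y precover, forall i y, precover_map i (g i y) = f i y.
Proof.
move=> Yf; have [K Kmax] := max_pker f.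
have [Kp Kf] := svalP K; pose Z := qcx (sval K); pose h := qclift Kf : chom Z X.
(* The preimage of C in Y is pure, lies in the kernel of f and contains K, so it equals K by
   maximality. *)
have nopure (C : subcx Z) : pure C -> (forall i x, C i x -> h i x = 0) ->
    forall i x, C i x -> x = 0.
  move=> Cp Ch i x Cx.
  have Lp : pure (preim_sc (qcpi (sval K)) C) /\
      forall i x, preim_sc (qcpi (sval K)) C i x -> f i x = 0.
    split=> [|j y Cy]; first exact: pure_preim.
    by rewrite -(qcliftE Kf); exact: Ch.
  pose L : pker f := exist (pker_prop f) _ Lp.
  have KL : pker_le K L.
    apply/asboolP => j t Kt; have e : qcpi (sval K) j t = 0 by apply/qcpi_eq0.
    by rewrite [smem _ _]/(C j (qcpi (sval K) j t)) e; exact: (smem0 (C j)).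
  have /asboolP LK := Kmax L KL.
  have [y yE] := qcpi_surj x; rewrite -yE; apply/qcpi_eq0; apply: LK.
  by rewrite [smem _ _]/(C i (qcpi (sval K) i y)) yE.
have [e eS] := small_surj N0 nopure.
pose q : chom free_small Z := dmap (fun g : gens =>
  scl (dif Z (dg (e (g : int * small X).2)) (g : int * small X).1 (vl (e (g : int * small X).2)))).
have qS i z : exists x, q i x = z.
  have [w wE] := eS (mkelt z).
  exists (dgen N (fun g : gens => (g : int * small X).1) (fun _ => R^o) (i, w) 1).
  rewrite /q (dmap_gen N0 (fun g : gens => _) (i := (i, w))).
  rewrite mklinE /scl_fun scale1r.
  rewrite -[LHS]/(dif Z (dg (e w)) i (vl (e w))) wE; exact: dif_id.
pose L := ker_sc q; have q0 i x : L i x -> q i x = 0 by [].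
pose qb := qclift q0.
have [|i z|s qbs sqb] := chom_inv (f := qb).
- move=> i x; have [{}x <-] := qcpi_surj x; rewrite qcliftE => qx.
  by apply/qcpi_eq0.
- by have [x xE] := qS i z; exists (qcpi L i x); rewrite qcliftE.
have Lf : flatobj (qcx L).
  by apply: (@flatobj_retract N R Z _ qb s sqb); exact: flatobj_pure_quot.
pose a : codes := existT (fun K => {phi : chom (qcx K) X | flatobj (qcx K)}) L
  (exist (fun _ => flatobj (qcx L)) (ccomp h qb) Lf).
exists (ccomp (cdin (fun a : {classic codes} => qcx (projT1 (a : codes))) a)
  (ccomp s (qcpi (sval K)))) => i y.
rewrite 2!ccompE /precover_map cdmap_in /= -[LHS]/(ccomp h qb i _) ccompE qbs.
exact: qcliftE.
Qed.

End Cover.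
End Precover.

(** * Maps from projective complexes to flat objects *)

Section CountableFree.
Variables (N : nat) (R : pzRingType).
Hypothesis N0 : (0 < N)%N.
Local Notation cx := (cx N R).

Lemma chom_factor (C D Z : cx) (v : chom C D) (t : chom Z D) :
  (forall i x, v i x = 0 -> x = 0) -> (forall i z, exists c, v i c = t i z) ->
  exists b : chom Z C, forall i z, v i (b i z) = t i z.
Proof.
move=> vinj ex; pose g i y := projT1 (cid (ex i y)).
have vg i y : v i (g i y) = t i y := projT2 (cid (ex i y)).
have injv i : injective (v i).
  by move=> x y xy; apply/eqP; rewrite -subr_eq0; apply/eqP/vinj; rewrite linearB xy subrr.
have gL i : linear (g i) by move=> a x y; apply: injv; rewrite linearP !vg linearP.
have gD i j y : mklin (gL j) (dif Z i j y) = dif C i j (mklin (gL i) y).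
  by apply: injv; rewrite !mklinE vg !cmapD vg.
by exists (CHom gD) => i z; exact: vg.
Qed.

Definition pker_fun (Q : cx) i : {linear prj_cover Q i -> prj_cover Q i} :=
  idfun \- (psec Q i \o csig Q i).
Fact pker_mem (Q : cx) i y : ker_sm (csig Q i) (pker_fun Q i y).
Proof.
have : csig Q i (y - psec Q i (csig Q i y)) = 0 by rewrite linearB csig_sec // subrr.
by [].
Qed.

(* scx (ker_sc (csig Q)) is the syzygy Omega Q = ker (prj_cover Q -> Q). *)
Definition pker_retr (Q : cx) : gmap (prj_cover Q) (scx (ker_sc (csig Q))) :=
  fun i => corestr (@pker_mem Q i).

Lemma pker_retrK (Q : cx) i z : pker_retr Q i (scincl (ker_sc (csig Q)) i z) = z.
Proof.
apply: sub_ext; rewrite -[LHS]/(sub_val z - psec Q i (csig Q i (sub_val z))).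
by rewrite [csig Q i _](sub_mem z) linear0 subr0.
Qed.

Lemma chom_descend (B C Z : cx) (p : chom B C) (q : gmap C B) (f : chom B Z) :
  (forall i x, p i (q i x) = x) -> (forall i x, p i x = 0 -> f i x = 0) ->
  exists g : chom C Z, forall i x, g i (p i x) = f i x.
Proof.
move=> pq f0; have fE i x : f i (q i (p i x)) = f i x.
  by apply/eqP; rewrite -subr_eq0 -linearB f0 // linearB pq subrr.
have gD i j x : (f j \o q j) (dif C i j x) = dif Z i j ((f i \o q i) x).
  have [y <-] : exists y, p i y = x by exists (q i x).
  rewrite -cmapD -[LHS]/(f j (q j (p j _))) fE cmapD.
  by rewrite -[in LHS](fE i y).
by exists (@CHom N R C Z (fun i => f i \o q i) gD) => i x; exact: fE.
Qed.

(** Being null-homotopic, b extends from the syzygy to the whole cover; after subtracting this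
    extension, th vanishes on the syzygy and descends to Q. *)
Lemma pker_descend (Q A B : cx) (v : chom A B) (th : chom (prj_cover Q) B)
    (b : chom (scx (ker_sc (csig Q))) A) :
  (forall i z, v i (b i z) = th i (scincl (ker_sc (csig Q)) i z)) -> nullh b ->
  exists (n : chom (prj_cover Q) A) (g : chom Q B),
    forall i y, g i (csig Q i y) = csub th (ccomp v n) i y.
Proof.
move=> bE /(nullh_ext (@pker_retrK Q))[n _ nE]; exists n.
apply: (chom_descend (fun i x => csig_sec x N0)) => i x x0.
pose z : scx (ker_sc (csig Q)) i := mksub (S := ker_sm (csig Q i)) x0.
by rewrite -[x]/(scincl (ker_sc (csig Q)) i z) csubE ccompE nE bE subrr.
Qed.

Lemma imv_sum (C : cx) (v : chom C C) i (I : Type) (s : seq I) (F : I -> C i) :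
  (forall k, exists c, F k = v i c) -> exists c, \sum_(k <- s) F k = v i c.
Proof.
move=> Fv; elim: s => [|k s [c cE]]; first by exists 0; rewrite big_nil linear0.
by have [d dE] := Fv k; exists (d + c); rewrite big_cons linearD dE cE.
Qed.

(* f lifts along g : C -> Y to al, a chain map modulo v(C): the obstruction to
   a strict lift is a map Omega Q -> C, which extends to prj_cover Q. *)
Lemma nullh_telescope (Q C Y : cx) (f : chom Q Y) (v : chom C C)
    (g : chom C Y) (al : gmap Q C) :
  nullh (idc C) -> (forall i x, v i x = 0 -> x = 0) ->
  (forall i x, g i (v i x) = 0) -> (forall i x, g i (al i x) = f i x) ->
  (forall i j x, exists c, al j (dif Q i j x) - dif C i j (al i x) = v j c) ->
  nullh f.
Proof.
move=> C0 vinj gv gal alD.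
pose th : chom (prj_cover Q) C := @dmap N R int (fun i => i) Q C al.
pose om := scincl (ker_sc (csig Q)).
(* The components z_k of a syzygy element satisfy sum d z_k = 0, so sum d(al z_k) equals minus the
   sum of the defects al(d z_k) - d(al z_k), all in the image of v. *)
have ex i z : exists c, v i c = ccomp th om i z.
  have z0 : csig Q i (om i z) = 0 by exact: sub_mem z.
  have [[s zs] _] := sub_mem (om i z).
  have us := undup_uniq s; have {}zs := cov_undup zs.
  have thE : th i (om i z) = \sum_(k <- undup s) dif C k i (al k (sub_val (om i z) k)).
    exact: (@dmapE N R int (fun i => i) Q C al i (om i z) _ us zs).
  have sgE : csig Q i (om i z) = \sum_(k <- undup s) dif Q k i (sub_val (om i z) k).
    exact: (@dmapE N R int (fun i => i) Q Q (fun i => idfun) i (om i z) _ us zs).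
  have [c cE] : exists c, \sum_(k <- undup s)
      (al i (dif Q k i (sub_val (om i z) k)) - dif C k i (al k (sub_val (om i z) k))) = v i c.
    by apply: imv_sum => k; exact: alD.
  exists (- c); rewrite linearN -cE sumrB -linear_sum -sgE z0 linear0 add0r opprK.
  by rewrite ccompE thE.
have [b bE] := chom_factor vinj ex.
have [n [ga gaE]] := pker_descend bE (contr_to b C0).
apply: (nullh_eq (f := ccomp g ga)); last by apply: nullh_compl; exact: contr_to.
move=> i x; rewrite ccompE -{1}(csig_sec x N0) gaE csubE ccompE linearB gv subr0.
by rewrite -gal /th /psec (dmap_gen N0 al).
Qed.

(** The elements are killed one after another, each in the finite free complex obtained for the
    previous ones. *)
Lemma flatobj_fam (Y : cx) : flatobj Y -> forall (I : finType) (deg : I -> int)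
    (g : chom (ff N R deg) Y) (T : finType) (x : T -> elt (ff N R deg)),
  (forall t, g _ (vl (x t)) = 0) ->
  exists (J : finType) (deg' : J -> int) (u : chom (ff N R deg) (ff N R deg'))
    (g' : chom (ff N R deg') Y), (forall i z, g i z = g' i (u i z)) /\
    forall t, u _ (vl (x t)) = 0.
Proof.
move=> Yf I deg g T x gx.
have : forall s : seq T, exists (J : finType) (deg' : J -> int)
    (u : chom (ff N R deg) (ff N R deg')) (g' : chom (ff N R deg') Y),
    (forall i z, g i z = g' i (u i z)) /\ forall t, t \in s -> u _ (vl (x t)) = 0.
  elim=> [|t s [J [e [u [g' [gE u0]]]]]]; first by exists I, deg, (idc _), g.
  have [|K [d [w [h [hE w0]]]]] := Yf _ _ g' _ (u _ (vl (x t))); first by rewrite -gE.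
  exists K, d, (ccomp w u), h; split=> [i z|y].
    by rewrite ccompE -hE gE.
  by rewrite in_cons ccompE => /orP[/eqP ->|/u0 ->]; rewrite ?linear0.
move=> /(_ (enum T))[J [e [u [g' [gE u0]]]]]; exists J, e, u, g'; split=> // t.
by apply: u0; rewrite mem_enum.
Qed.

Section Countable.
Variables (Y Q : cx) (f : chom Q Y) (J : int -> choiceType).
Variables (b : forall i, J i -> Q i) (nu : forall i, J i -> nat).
Hypothesis Yf : flatobj Y.
Hypothesis bspan : forall i (x : Q i), exists s : seq (R * J i),
  x = \sum_(p <- s) p.1 *: b p.2.
Hypothesis bext : forall i (V : lmodType R) (h : J i -> V),
  exists g : {linear Q i -> V}, forall j, g (b j) = h j.
Hypothesis nu_inj : forall i j i' j',
  @nu i j = @nu i' j' -> existT J i j = existT J i' j'.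

(** Forcing the empty expansion outside the window leaves only N target degrees, so [bdk] is a
    finite bound. *)
Lemma rho_ex i j m : exists s : seq (R * J m),
  dif Q i m (@b i j) = \sum_(p <- s) p.1 *: b p.2 /\
  (~~ ((i <= m) && (m < i + N%:Z)) -> s = [::]).
Proof.
have [ij|ij] := boolP ((i <= m) && (m < i + N%:Z)).
  by have [s sE] := bspan (dif Q i m (b j)); exists s.
by exists [::]; rewrite big_nil dif_out.
Qed.
Definition rho i (j : J i) m : seq (R * J m) := projT1 (cid (rho_ex j m)).
Lemma rhoE i (j : J i) m : dif Q i m (b j) = \sum_(p <- rho j m) p.1 *: b p.2.
Proof. by case: (projT2 (cid (rho_ex j m))). Qed.
Lemma rho_out i (j : J i) m : ~~ ((i <= m) && (m < i + N%:Z)) -> rho j m = [::].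
Proof. by case: (projT2 (cid (rho_ex j m))). Qed.

Definition tau (k : nat) : option {i & J i} :=
  if pselect (exists t : {i & J i}, nu (projT2 t) = k) is left e
  then Some (projT1 (cid e)) else None.
Lemma tauK i (j : J i) : tau (nu j) = Some (existT J i j).
Proof.
rewrite /tau; case: pselect => [e|[]]; last by exists (existT J i j).
by case: (cid e) => -[i' j'] /= /nu_inj ->.
Qed.

Lemma tau_inv k i (j : J i) : tau k = Some (existT J i j) -> nu j = k.
Proof.
rewrite /tau; case: pselect => // e; case: (cid e) => t tk te.
have tE : t = existT J i j := Some_inj te.
by rewrite -tk tE.
Qed.

Definition bdk (k : nat) : nat :=
  if tau k is Some (existT i j) then
    (\sum_(n < N) \sum_(p <- rho j (i + n%:Z)) (nu p.2).+1)%N else 0%N.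
(** Chosen to increase strictly and so that differentials of basis elements of index below [beta t]
    involve only indices below [beta t.+1]. *)
Fixpoint beta (t : nat) : nat :=
  if t is t'.+1 then ((beta t').+1 + \sum_(k < beta t') bdk k)%N else 0%N.

Lemma leq_bigsum (T : eqType) (s : seq T) (F : T -> nat) x :
  x \in s -> (F x <= \sum_(y <- s) F y)%N.
Proof.
elim: s => // y s IH; rewrite in_cons big_cons => /orP[/eqP ->|/IH].
  exact: leq_addr.
by move=> h; apply: leq_trans h (leq_addl _ _).
Qed.

Lemma beta_rho t i (j : J i) m p : (nu j < beta t)%N -> p \in rho j m ->
  (nu p.2 < beta t.+1)%N.
Proof.
move=> jt ps; have im : (i <= m) && (m < i + N%:Z).
  by apply/negPn/negP => /(rho_out j) e; rewrite e in ps.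
have [n mE] : exists n : nat, m = i + n%:Z by exists (absz (m - i)%R); lia.
subst m; have nN : (n < N)%N by lia.
rewrite /= addSn ltnS; apply: leq_trans (leq_addl _ _).
have h : (bdk (nu j) <= \sum_(k < beta t) bdk k)%N.
  by rewrite (bigD1 (Ordinal jt)) //= leq_addr.
apply: leq_trans h; rewrite /bdk tauK.
rewrite (bigD1 (Ordinal nN)) //=.
apply: (@leq_trans (\sum_(q <- rho j (i + n%:Z)) (nu q.2).+1)%N); last exact: leq_addr.
exact/ltnW/(@leq_bigsum (R * J (i + n%:Z))%type _ (fun q => (nu q.2).+1) p ps).
Qed.

Lemma beta_lt t : (beta t < beta t.+1)%N.
Proof. by rewrite /= addSn ltnS leq_addr. Qed.
Lemma beta_le s t : (s <= t)%N -> (beta s <= beta t)%N.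
Proof.
elim: t => [|t IH]; first by rewrite leqn0 => /eqP ->.
rewrite leq_eqVlt => /orP[/eqP -> //|/IH h].
exact: leq_trans h (ltnW (beta_lt t)).
Qed.
Lemma leq_beta t : (t <= beta t)%N.
Proof. by elim: t => // t IH; apply: leq_ltn_trans IH (beta_lt t). Qed.

(* A stage: a finite free complex over Y through which f factors on the
   basis elements of index < beta t.+1, compatibly with the differentials on
   those of index < beta t. *)
Record stage := Stage {
  stI : finType; stdeg : stI -> int; stg : chom (ff N R stdeg) Y;
  sta : forall i, J i -> ff N R stdeg i }.

Definition stage_ok t (s : stage) :=
  (forall i (j : J i), (nu j < beta t.+1)%N -> stg s i (sta s j) = f i (b j)) /\
  (forall i (j : J i), (nu j < beta t)%N -> forall m,
    dif _ i m (sta s j) = \sum_(p <- rho j m) p.1 *: sta s p.2).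

Definition stage_hom t (s s' : stage) (u : chom (ff N R (stdeg (s:=s))) (ff N R (stdeg (s:=s')))) :=
  (forall i z, stg s i z = stg s' i (u i z)) /\
  (forall i (j : J i), (nu j < beta t.+1)%N -> sta s' j = u i (sta s j)).

Definition tdg (k : nat) : int := if tau k is Some t then projT1 t else 0.
Definition tbas (k : nat) : Y (tdg k) :=
  match tau k as o return Y (if o is Some t then projT1 t else 0) with
  | Some t => f _ (b (projT2 t)) | None => 0 end.
Lemma tbasE i (j : J i) : dif Y (tdg (nu j)) i (tbas (nu j)) = f i (b j).
Proof. by rewrite /tbas /tdg tauK dif_id. Qed.

(** Add a free generator over the image of each basis element of index below [beta t.+1]. The
    relations expressing compatibility with differentials below [beta t] are finitely many and hold
    in Y, so flatness kills them in a further finite free complex. *)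
Lemma stage_step0 t (s : stage) :
  (forall i (j : J i), (nu j < beta t)%N -> stg s i (sta s j) = f i (b j)) ->
  exists s' (u : chom (ff N R (stdeg (s:=s))) (ff N R (stdeg (s:=s')))),
    stage_ok t s' /\ (forall i z, stg s i z = stg s' i (u i z)) /\
    (forall i (j : J i), (nu j < beta t)%N -> sta s' j = u i (sta s j)).
Proof.
case: s => I deg g a /= ga.
pose B := beta t.+1; pose dn (k : 'I_B) : int := tdg k.
pose g1 : chom (ff N R (djoin deg dn)) Y := fcase g (ffmap (fun k : 'I_B => tbas k)).
(* Old elements keep their images and new indices use the new generators. The differential from
   [dn k] to the equal degree i replaces a cast. *)
pose a1 i (j : J i) : ff N R (djoin deg dn) i :=
  if (nu j < beta t)%N then finl N R deg dn i (a i j) else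
  if insub (nu j) is Some k then dif _ (dn k) i (finr N R deg dn _ (fgen N R dn k)) else 0.
have g1a i (j : J i) : (nu j < B)%N -> g1 i (a1 i j) = f i (b j).
  move=> jB; rewrite /a1; case: ifP => [jt|_]; first by rewrite fcase_inl // ga.
  by rewrite insubT cmapD fcase_inr // ffmap_gen // [dn _]/= -(tbasE j).
pose x1 i (j : J i) n := dif _ i (i + n%:Z) (a1 i j) -
  \sum_(p <- rho j (i + n%:Z)) p.1 *: a1 _ p.2.
(* The finite list of defects to kill, one for each index below [beta t] and each of the N possible
   steps. *)
pose x (kn : 'I_(beta t) * 'I_N) : elt (ff N R (djoin deg dn)) :=
  if tau kn.1 is Some (existT i j) then mkelt (x1 i j kn.2) else mkelt (0 : ff N R (djoin deg dn) 0).
have [|I' [deg' [u [g' [gE u0]]]]] := flatobj_fam Yf (g := g1) (x := x).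
  move=> [k n]; have kt := ltn_ord k; rewrite /x -[(k, n).1]/k -[(k, n).2]/n.
  case tk : (tau k) => [[i j]|]; last by exact: (linear0 (g1 0)).
  rewrite -[dg _]/(i + n%:Z) -[vl _]/(x1 i j n).
  have jk : nu j = k := tau_inv tk.
  rewrite /x1 linearB cmapD g1a ?jk; last first.
    by apply: leq_trans kt _; exact: ltnW (beta_lt t).
  rewrite (linear_sum (g1 _)) -cmapD rhoE (linear_sum (f _)) -sumrB big_seq big1 // => p pr.
  rewrite (linearZZ (f _)) (linearZZ (g1 _)) g1a; first by rewrite subrr.
  by apply: (beta_rho _ pr); rewrite jk.
have ua i (j : J i) : (nu j < beta t)%N -> forall m,
    dif _ i m (u i (a1 i j)) = \sum_(p <- rho j m) p.1 *: u m (a1 m p.2).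
  move=> jt m; rewrite -cmapD; have [im|im] := boolP ((i <= m) && (m < i + N%:Z)); last first.
    by rewrite rho_out // big_nil dif_out // linear0.
  have [n mE] : exists n : nat, m = i + n%:Z by exists (absz (m - i)%R); lia.
  subst m; have nN : (n < N)%N by lia.
  apply/eqP; rewrite -subr_eq0; apply/eqP.
  under eq_bigr do rewrite -linearZZ.
  rewrite -(linear_sum (u _)) -linearB; have := u0 (Ordinal jt, Ordinal nN).
  by rewrite /x -[(_, _).1]/(Ordinal jt) -[(_, _).2]/(Ordinal nN) -[nat_of_ord _]/(nu j) tauK.
exists (Stage g' (fun i j => u i (a1 i j))), (ccomp u (finl N R deg dn)); split.
  split=> i j jt; last exact: ua.
  by rewrite -[LHS]/(g' i (u i (a1 i j))) -gE g1a.
split=> [i z|i j jt]; first by rewrite -[RHS]/(g' i (u i _)) -gE fcase_inl.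
by rewrite -[LHS]/(u i (a1 i j)) /a1 jt.
Qed.

Lemma stage_init : exists s, stage_ok 0 s.
Proof.
pose s0 := @Stage void (fun=> 0) (c0 _ _) (fun i (_ : J i) => 0).
by have [//|s [u [sok _]]] := @stage_step0 0 s0; exists s.
Qed.

Lemma stage_next t (s : {s | stage_ok t s}) : exists s' : {s | stage_ok t.+1 s},
  exists u, @stage_hom t (sval s) (sval s') u.
Proof.
case: s => s [s1 s2]; have [s' [u [s'ok su]]] := @stage_step0 t.+1 s s1.
by exists (exist _ s' s'ok), u.
Qed.

Fixpoint stages t : {s | stage_ok t s} :=
  if t is t'.+1 then projT1 (cid (stage_next (stages t')))
  else exist _ (projT1 (cid stage_init)) (projT2 (cid stage_init)).

Definition sI t := sval (stages t).
Definition sF t : cx := ff N R (stdeg (s:=sI t)).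
Lemma stages_hom t : exists u : chom (sF t) (sF t.+1), stage_hom t u.
Proof. exact: (projT2 (cid (stage_next (stages t)))). Qed.
Definition su t : chom (sF t) (sF t.+1) := projT1 (cid (stages_hom t)).
Lemma su_g t i z : stg (sI t) i z = stg (sI t.+1) i (su t i z).
Proof. by case: (projT2 (cid (stages_hom t))) => + _; apply. Qed.
Lemma su_a t i (j : J i) : (nu j < beta t.+1)%N ->
  sta (sI t.+1) j = su t i (sta (sI t) j).
Proof. by case: (projT2 (cid (stages_hom t))) => _; apply. Qed.

Definition tel : cx := cds sF.
Definition telU : chom tel tel := cdmap (fun t => ccomp (cdin sF t.+1) (su t)).
(** Identity minus shift: its cokernel is the colimit of the stages, which is not formed; [tel_eq]
    is equality modulo the image. *)
Definition telV : chom tel tel := csub (idc tel) telU.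
Definition telG : chom tel Y := cdmap (fun t => stg (sI t)).

Lemma telU0 n (x : tel n) : sub_val (telU n x) 0%N = 0.
Proof.
apply: (cds_hom_ext (f := ccomp (cdp sF 0%N) telU) (g := c0 _ _)) => t m z.
by rewrite ccompE /telU cdmap_in ccompE; exact: cdin_neq.
Qed.

Lemma telUS t n (x : tel n) : sub_val (telU n x) t.+1 = su t n (sub_val x t).
Proof.
apply: (cds_hom_ext (f := ccomp (cdp sF t.+1) telU) (g := ccomp (su t) (cdp sF t))) => s m z.
rewrite !ccompE /telU cdmap_in ccompE.
rewrite -[LHS]/(sub_val (cdin sF s.+1 m (su s m z)) t.+1).
rewrite -[cdp _ _ _ _]/(sub_val (cdin sF s m z) t).
have [e|st] := eqVneq s t; first by subst s; rewrite !cdin_eq.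
by rewrite !cdin_neq // linear0.
Qed.

(** A fixed point of the shift has zero component at 0, and each later component is the image of the
    preceding one. *)
Lemma telV_inj n (x : tel n) : telV n x = 0 -> x = 0.
Proof.
move=> /eqP; rewrite csubE subr_eq0 => /eqP xU; apply: cds_ext.
elim=> [|t IH]; first by rewrite -[x]/(idc tel n x) xU telU0.
by rewrite -[x in LHS]/(idc tel n x) xU telUS IH linear0.
Qed.

Lemma telGV n (x : tel n) : telG n (telV n x) = 0.
Proof.
apply: (cds_hom_ext (f := ccomp telG telV) (g := c0 _ _)) => t m z.
rewrite ccompE csubE linearB -[idc _ _ _]/(cdin sF t m z) /telU /telG.
by rewrite 2!cdmap_in ccompE cdmap_in -su_g subrr.
Qed.

Definition tel_eq n (x y : tel n) := exists c, x - y = telV n c.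
Lemma tel_eqD n a (x y x' y' : tel n) : tel_eq x y -> tel_eq x' y' ->
  tel_eq (a *: x + x') (a *: y + y').
Proof.
move=> [c cE] [d dE]; exists (a *: c + d).
by rewrite linearP -cE -dE opprD addrACA scalerBr.
Qed.
Lemma tel_eq_refl n (x : tel n) : tel_eq x x.
Proof. by exists 0; rewrite linear0 subrr. Qed.
Lemma tel_eq_trans n (y x z : tel n) : tel_eq x y -> tel_eq y z -> tel_eq x z.
Proof.
by move=> [c cE] [d dE]; exists (c + d); rewrite linearD -cE -dE addrA subrK.
Qed.
Lemma tel_eq_sym n (x y : tel n) : tel_eq x y -> tel_eq y x.
Proof. by move=> [c cE]; exists (- c); rewrite linearN -cE opprB. Qed.
Lemma tel_eq_dif n m (x y : tel n) : tel_eq x y ->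
  tel_eq (dif tel n m x) (dif tel n m y).
Proof. by move=> [c cE]; exists (dif tel n m c); rewrite cmapD -cE linearB. Qed.
Lemma tel_eq_sum n (T : eqType) (s : seq T) (r : T -> R) (F G : T -> tel n) :
  (forall t, t \in s -> tel_eq (F t) (G t)) ->
  tel_eq (\sum_(t <- s) r t *: F t) (\sum_(t <- s) r t *: G t).
Proof.
elim: s => [|t s IH] FG; first by rewrite !big_nil; exact: tel_eq_refl.
rewrite !big_cons; apply: tel_eqD; first by apply: FG; exact: mem_head.
by apply: IH => u us; apply: FG; rewrite in_cons us orbT.
Qed.

Lemma tel_a s t i (j : J i) : (nu j < beta s.+1)%N -> (s <= t)%N ->
  tel_eq (cdin sF s i (sta (sI s) j)) (cdin sF t i (sta (sI t) j)).
Proof.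
move=> js; elim: t => [|t IH]; first by rewrite leqn0 => /eqP ->; exact: tel_eq_refl.
rewrite leq_eqVlt => /orP[/eqP ->|st]; first exact: tel_eq_refl.
apply: tel_eq_trans (IH st) _; exists (cdin sF t i (sta (sI t) j)).
rewrite csubE /telU cdmap_in ccompE su_a //.
by apply: leq_trans js _; exact: beta_le.
Qed.

Lemma nu_beta i (j : J i) : (nu j < beta (nu j).+1)%N.
Proof. exact: leq_beta. Qed.

Lemma countable_null : nullh f.
Proof.
have ex i : exists g : {linear Q i -> tel i}, forall j : J i,
    g (b j) = cdin sF (nu j) i (sta (sI (nu j)) j) by exact: bext.
(* A basis element of index k goes to its approximation at stage k, early enough to be defined and
   lying over its image in Y. *)
pose al i := projT1 (cid (ex i)).
have alE i (j : J i) : al i (b j) = cdin sF (nu j) i (sta (sI (nu j)) j).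
  exact: (projT2 (cid (ex i))).
apply: (@nullh_telescope _ tel _ f telV telG al).
- by apply: cds_contr => t; exact: disk_contr.
- exact: telV_inj.
- exact: telGV.
- move=> i x; have [s ->] := bspan x; rewrite !linear_sum; apply: eq_bigr => p _.
  rewrite (linearZZ (al i)) (linearZZ (f i)) (linearZZ (telG i)) alE /telG cdmap_in.
  by have [/(_ i p.2 (nu_beta _)) -> _] := svalP (stages (nu p.2)).
move=> i m x; suff : tel_eq (al m (dif Q i m x)) (dif tel i m (al i x)) by [].
have [s ->] := bspan x; rewrite !linear_sum.
under eq_bigr do rewrite (linearZZ (dif Q i m)) (linearZZ (al m)).
under [X in tel_eq _ X]eq_bigr do rewrite (linearZZ (al i)) (linearZZ (dif tel i m)).
apply: tel_eq_sum => p _; rewrite alE; set j := p.2.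
(* Beyond stage T, j and all basis elements occurring in its differential are approximated; both
   sides are compared at stage [T.+1], where the stage respects the differential of j. *)
pose T := (nu j + \sum_(q <- rho j m) nu q.2)%N.
have jT : (nu j <= T)%N by exact: leq_addr.
apply: (@tel_eq_trans _ (dif tel i m (cdin sF T.+1 i (sta (sI T.+1) j)))); last first.
  apply: tel_eq_dif; apply: tel_eq_sym; apply: tel_a (nu_beta j) _.
  exact: leq_trans jT _.
rewrite -cmapD; have [_ ->] := svalP (stages T.+1); last first.
  by apply: leq_trans (nu_beta j) _; exact: beta_le.
rewrite rhoE !linear_sum.
under eq_bigr do rewrite (linearZZ (al m)) alE.
under [X in tel_eq _ X]eq_bigr do rewrite (linearZZ (cdin sF T.+1 m)).
apply: tel_eq_sum => q qr; apply: tel_a (nu_beta _) _.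
apply: leqW; apply: leq_trans (leq_addl _ _).
exact: (@leq_bigsum (R * J m)%type _ (fun q => nu q.2) q qr).
Qed.

End Countable.
End CountableFree.

(** * Free modules *)

Section FreeModule.
Variables (R : pzRingType) (J : choiceType).

Definition frsm : submod (dprod (fun _ : J => R^o)) :=
  @Submod _ _ (@fsupp R J (fun _ => R^o)) (@fsupp0 _ _ _) (@fsuppD _ _ _)
    (@fsuppZ _ _ _).
Definition frm : lmodType R := sub_of frsm.

Lemma frm_supp (x : frm) : fsupp (sub_val x).
Proof. exact: (sub_mem x). Qed.

Definition frb (j : J) : frm :=
  mksub (S := frsm) (@fsupp_single R J (fun _ => R^o) j (1 : R^o)).

Lemma frbE j k : sub_val (frb j) k = (j == k)%:R.
Proof.
rewrite -[LHS]/(dsingle (1 : R^o) k); have [<-|jk] := eqVneq j k.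
  by rewrite dsingle_eq.
by rewrite dsingle_neq.
Qed.

Lemma frm_ext (x y : frm) : (forall j, sub_val x j = sub_val y j) -> x = y.
Proof. by move=> xy; apply: sub_ext; exact: dpext. Qed.

Lemma frm_sum s (x : frm) : uniq s -> cov s (sub_val x) ->
  x = \sum_(j <- s) (sub_val x j : R) *: frb j.
Proof.
move=> us xs; apply: sub_ext; rewrite -[RHS]/(subv _ _) linear_sum.
rewrite {1}(dsum_single us xs); apply: eq_bigr => j _.
rewrite linearZZ; apply: dpext => k; rewrite dpEZ -[X in _ *: X]/(sub_val (frb j) k) frbE.
have [<-|jk] := eqVneq j k; last by rewrite dsingle_neq // scaler0.
by rewrite dsingle_eq [RHS]/GRing.scale /= mulr1.
Qed.

Section Flin.
Variables (V : lmodType R) (h : J -> V).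
Fact flin_linear : linear (fun x : frm => fsum (fun j => scl (h j)) (sub_val x)).
Proof. by move=> a x y; rewrite /= fsumP //; exact: frm_supp. Qed.
Definition flin : {linear frm -> V} := mklin flin_linear.
Lemma flinE s (x : frm) : uniq s -> cov s (sub_val x) ->
  flin x = \sum_(j <- s) (sub_val x j : R) *: h j.
Proof. by move=> us xs; rewrite /flin mklinE (fsumE _ us xs). Qed.
Lemma flin_b j : flin (frb j) = h j.
Proof. by rewrite /flin mklinE [LHS]fsum_single mklinE /scl_fun scale1r. Qed.
End Flin.

Lemma flin_eq (V : lmodType R) (h h' : J -> V) (B : J -> Prop) (x : frm) :
  (forall j, B j -> h j = h' j) -> (forall j, sub_val x j != 0 -> B j) ->
  flin h x = flin h' x.
Proof.
move=> hh xB; have [s xs] := frm_supp x.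
have us := undup_uniq s; have {}xs := cov_undup xs.
rewrite !(flinE _ us xs); apply: eq_bigr => j _.
by have [->|/xB/hh ->] := eqVneq (sub_val x j) 0; rewrite ?scale0r.
Qed.

Definition suppl (x : frm) : seq J :=
  [seq j <- projT1 (cid (frm_supp x)) | sub_val x j != 0].
Lemma mem_suppl (x : frm) j : (j \in suppl x) = (sub_val x j != 0).
Proof.
rewrite mem_filter andb_idr // => xj; apply/negPn/negP => jN.
by move: xj; rewrite (projT2 (cid (frm_supp x))) ?eqxx.
Qed.

End FreeModule.

(** * Degreewise free complexes: extending null-homotopies by Zorn's lemma *)

Section Based.
Variables (N : nat) (R : pzRingType).
Hypothesis N0 : (0 < N)%N.
Local Notation cx := (cx N R).
Variables (J : int -> choiceType).
Variables (dF : forall i j, {linear frm R (J i) -> frm R (J j)}).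
Hypotheses (dFc : forall (i j k : int) x, i <= j -> j <= k -> dF j k (dF i j x) = dF i k x)
  (dFo : forall (i j : int) x, ~~ ((i <= j) && (j < i + N%:Z)) -> dF i j x = 0)
  (dFi : forall i x, dF i i x = x).

Definition bcx : cx := Cx dFc dFo dFi.

Definition bset := forall i, J i -> Prop.
Definition bclosed (B : bset) := forall i (j : J i), B i j -> forall m k,
  sub_val (dF i m (frb R j)) k != 0 -> B m k.
Definition inb (B : bset) i (x : frm R (J i)) := forall j, sub_val x j != 0 -> B i j.

Section SubB.
Variables (B : bset).
Arguments B : clear implicits.
Hypothesis Bc : bclosed B.
Lemma inb0 i : inb B (0 : frm R (J i)). Proof. by move=> j; rewrite eqxx. Qed.
Lemma inbD i (x y : frm R (J i)) : inb B x -> inb B y -> inb B (x + y).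
Proof.
move=> xB yB j; rewrite sub_valD dpED; have [x0|/xB //] := eqVneq (sub_val x j) 0.
by rewrite x0 add0r => /yB.
Qed.
Lemma inbZ i a (x : frm R (J i)) : inb B x -> inb B (a *: x).
Proof.
move=> xB j; rewrite sub_valZ dpEZ; have [->|/xB //] := eqVneq (sub_val x j) 0.
by rewrite scaler0 eqxx.
Qed.
Lemma inb_sum i (T : eqType) (s : seq T) (F : T -> frm R (J i)) :
  (forall t, t \in s -> inb B (F t)) -> inb B (\sum_(t <- s) F t).
Proof.
by move=> FB; rewrite big_seq; apply: big_ind => //; [exact: inb0 | exact: inbD].
Qed.
Lemma inb_dif i m (x : bcx i) : inb B x -> inb B (dif bcx i m x).
Proof.
move=> xB; have [s xs] := frm_supp x.
rewrite {1}(frm_sum (undup_uniq s) (cov_undup xs)) linear_sum.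
apply: inb_sum => j _; rewrite linearZZ.
have [->|xj] := eqVneq (sub_val x j) 0; first by rewrite scale0r; exact: inb0.
by apply: inbZ => k; apply: Bc; exact: xB.
Qed.
Definition bsub : subcx bcx :=
  @SubCx N R bcx (fun i => Submod (@inb0 i) (@inbD i) (@inbZ i)) inb_dif.
End SubB.

Definition brestr (B : bset) i (x : frm R (J i)) : frm R (J i) :=
  mksub (S := frsm R (J i)) (fsupp_restr (fun j => `[< B i j >]) (frm_supp x)).
Lemma brestrE B i (x : frm R (J i)) j :
  sub_val (brestr B x) j = if `[< B i j >] then sub_val x j else 0.
Proof. by []. Qed.
Lemma brestr_linear B i : linear (@brestr B i).
Proof. by move=> a x y; apply: sub_ext; exact: restr_linear. Qed.
Lemma brestr_inb B i (x : frm R (J i)) : inb B (brestr B x).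
Proof. by move=> j; rewrite brestrE; case: asboolP => //; rewrite eqxx. Qed.
Lemma brestr_id B i (x : frm R (J i)) : inb B x -> brestr B x = x.
Proof.
move=> xB; apply: frm_ext => j; rewrite brestrE; case: asboolP => // jB.
by apply/esym/eqP/negPn/negP => /xB.
Qed.

Variables (Y : cx) (Yf : flatobj Y) (f : chom bcx Y).

Definition bhom := forall i, J i -> Y (i - N%:Z + 1).
Definition bh (s : bhom) : hmap bcx Y := fun i => flin (s i).

Section Step.
Variables (B C : bset).
Arguments B : clear implicits.
Arguments C : clear implicits.
Hypotheses (Bc : bclosed B) (Cc : bclosed C).
Hypothesis BC : forall i j, B i j -> C i j.
Variable nu : forall i, J i -> nat.
Hypothesis nu_inj : forall i j i' j', C i j -> ~ B i j -> C i' j' -> ~ B i' j' ->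
  @nu i j = @nu i' j' -> existT J i j = existT J i' j'.
Variables (s : bhom).
Arguments s : clear implicits.
Hypothesis sB : forall i x, inb B x -> f i x = tr (bh s) x.

Let FB := scx (bsub Bc).
Let FC := scx (bsub Cc).
Fact binc_in i (x : FB i) : bsub Cc i (scincl (bsub Bc) i x).
Proof. by move=> j xj; apply: BC; exact: (sub_mem x). Qed.
Definition binc : chom FB FC := sccor binc_in.
Fact bret_linear i : linear (fun x : FC i =>
  mksub (S := bsub Bc i) (@brestr_inb B i (sub_val x)) : FB i).
Proof. by move=> a x y; apply: sub_ext; exact: brestr_linear. Qed.
Definition bret : gmap FC FB := fun i => mklin (@bret_linear i).
Fact bretK i x : bret i (binc i x) = x.
Proof. by apply: sub_ext; apply: brestr_id; exact: (sub_mem x). Qed.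

Let Q := cok bretK.
Let f1 : chom FC Y := ccomp (csub f (trc (bh s))) (scincl (bsub Cc)).
Fact f1_B i x : f1 i (binc i x) = 0.
Proof.
rewrite /f1 ccompE csubE trcE sccorE sB ?subrr //; exact: (sub_mem x).
Qed.
Let fQ : chom Q Y := coklift bretK f1_B.

Let JQ i : choiceType := {j : J i | `[< C i j /\ ~ B i j >]}.
Fact frb_in (D : bset) i (j : J i) : D i j -> inb D (frb R j).
Proof.
by move=> Dj k; rewrite frbE; have [<- //|jk] := eqVneq j k; rewrite eqxx.
Qed.
Let bC i (j : J i) (Cj : C i j) : FC i := mksub (S := bsub Cc i) (frb_in Cj).
Fact JQC i (j : JQ i) : C i (val j). Proof. by have /asboolP[] := valP j. Qed.
Fact JQB i (j : JQ i) : ~ B i (val j). Proof. by have /asboolP[] := valP j. Qed.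
Let bQ i (j : JQ i) : Q i := cokc bretK i (bC (JQC j)).

Fact cokc_B i (j : J i) (Cj : C i j) : B i j -> cokc bretK i (bC Cj) = 0.
Proof.
move=> Bj; have -> : bC Cj = binc i (mksub (S := bsub Bc i) (frb_in Bj)).
  by apply: sub_ext.
exact: cokc_m.
Qed.

Let bF i (j : J i) : FC i := if pselect (C i j) is left Cj then bC Cj else 0.

Lemma bF_sum i (y : FC i) : exists u : seq (J i),
  [/\ uniq u, cov u (sub_val (sub_val y)), forall j, j \in u -> C i j &
    y = \sum_(j <- u) (sub_val (sub_val y) j : R) *: bF j].
Proof.
pose z := sub_val y : frm R (J i); have zC : inb C z := sub_mem y.
have us : uniq (undup (suppl z)) := undup_uniq _.
have zs : cov (undup (suppl z)) (sub_val z).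
  by move=> j; rewrite mem_undup mem_suppl negbK => /eqP.
exists (undup (suppl z)); split=> // [j|]; first by rewrite mem_undup mem_suppl => /zC.
apply: sub_ext; rewrite -[LHS]/z -[RHS]/(subv _ _) linear_sum {1}(frm_sum us zs).
rewrite big_seq [RHS]big_seq; apply: eq_bigr => j.
rewrite mem_undup mem_suppl => /zC Cj.
by rewrite linearZZ /bF; case: pselect.
Qed.

Fact bQ_span i (x : Q i) : exists u : seq (R * JQ i), x = \sum_(p <- u) p.1 *: bQ p.2.
Proof.
pose y := cokj bret i x : FC i; have [u [us yu uC yE]] := bF_sum y.
pose z := sub_val y : frm R (J i).
exists (pmap (fun j => omap (fun k => (sub_val z j : R, k)) (insub j)) u).
rewrite -(cokc_j bretK x) -/y yE linear_sum big_pmap.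
apply: eq_bigr => j _; rewrite linearZZ /bF.
case: insubP => [k kP kE|/asboolPn nCB]; rewrite [RHS]/=.
  rewrite -kE /bQ; case: pselect => [Ck|[]]; last exact: JQC.
  by have -> : bC Ck = bC (JQC k) by exact: sub_ext.
case: pselect => Cj; last by rewrite linear0 scaler0.
rewrite cokc_B ?scaler0 //; apply: contrapT => nB; exact: nCB.
Qed.

Fact bQ_ext i (V : lmodType R) (h : JQ i -> V) :
  exists g : {linear Q i -> V}, forall j, g (bQ j) = h j.
Proof.
pose h' (j : J i) : V := if insub j is Some k then h k else 0.
have gL : linear (fun x : Q i => flin h' (scincl (bsub Cc) i (cokj bret i x))).
  by move=> a x y; rewrite !linearP.
exists (mklin gL) => j; rewrite mklinE.
have -> : cokj bret i (bQ j) = bC (JQC j).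
  rewrite /bQ -[LHS]/(cokj bret i (cokpi bretK i _)) cokjE.
  have -> : bret i (bC (JQC j)) = 0.
    apply: sub_ext; apply: frm_ext => k.
    rewrite -[LHS]/(sub_val (brestr B (frb R (val j))) k) brestrE frbE.
    case: asboolP => // Bk; have [e|//] := eqVneq (val j) k.
    by case: (JQB (j := j)); rewrite e.
  by rewrite linear0 subr0.
by rewrite -[scincl _ _ _]/(frb R (val j)) flin_b /h' valK.
Qed.

(** The map f - Tr(s) vanishes on the span of B, so it factors through span C / span B, which is
    degreewise free on C minus B. That set is countable, so the induced map is null, and its
    homotopy is added to s. *)
Lemma bstep : exists s' : bhom, (forall i j, B i j -> s' i j = s i j) /\
  forall i x, inb C x -> f i x = tr (bh s') x.
Proof.
have nuQ i (j : JQ i) i' (j' : JQ i') :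
    nu (val j) = nu (val j') -> existT JQ i j = existT JQ i' j'.
  move=> /(nu_inj (JQC j) (@JQB _ j) (JQC j') (@JQB _ j')) e.
  have ii : i = i' by exact: (congr1 (@projT1 _ _) e).
  subst i'; congr existT; apply: val_inj.
  by have := congr1 (tagged_as (Tagged J (val j))) e; rewrite !tagged_asE.
have [s2 s2E] : nullh fQ := countable_null N0 fQ Yf bQ_span bQ_ext nuQ.
exists (fun i j => s i j + s2 i (cokc bretK i (bF j))); split=> [i j Bj|i x xC].
  rewrite /bF; case: pselect => [Cj|]; last by rewrite !linear0 addr0.
  by rewrite cokc_B // linear0 addr0.
pose y : FC i := mksub (S := bsub Cc i) xC.
have fE : f i x = tr (bh s) x + fQ i (cokc bretK i y).
  by rewrite /fQ cokliftE /f1 ccompE csubE trcE addrC subrK.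
pose s' : bhom := fun i j => s i j + s2 i (cokc bretK i (bF j)).
have E k : tr_term (bh s') x k = tr_term (bh s) x k + tr_term s2 (cokc bretK i y) k.
  rewrite /tr_term -linearD; congr (dif _ _ _ _).
  rewrite -cmapD; set z := dif FC i k y.
  have -> : dif bcx i k x = sub_val z by [].
  have [u [us zu _ zE]] := bF_sum z.
  have -> : s2 k (cokc bretK k z) =
      \sum_(j <- u) (sub_val (sub_val z) j : R) *: s2 k (cokc bretK k (bF j)).
    by rewrite {1}zE !linear_sum; apply: eq_bigr => j _; rewrite !linearZZ.
  rewrite /bh !(flinE _ us zu) -big_split.
  by apply: eq_bigr => j _; rewrite scalerDr.
by rewrite fE s2E trcE -big_split; apply: eq_bigr => n _; rewrite E.
Qed.

End Step.
Section Closure.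
Variable t0 : {i & J i}.
Definition bnext (t : {i & J i}) (m : int) (p : nat) : {i & J i} :=
  nth t [seq existT (fun i => J i : Type) m k | k <- suppl (dF (projT1 t) m (frb R (projT2 t)))] p.
Fixpoint bdec (c : seq (int * nat)) : {i & J i} :=
  if c is (m, p) :: c' then bnext (bdec c') m p else t0.
(** The closure of one basis element. Supports of differentials are finite, so each member is
    reached by a finite sequence of pairs (degree, position), which makes the closure countable. *)
Definition bcl : bset := fun i j => exists c, bdec c = existT _ i j.
Lemma bcl_closed : bclosed bcl.
Proof.
move=> i j [c cE] m k jk; exists ((m, index k (suppl (dF i m (frb R j)))) :: c).
have ks : k \in suppl (dF i m (frb R j)) by rewrite mem_suppl.
by rewrite /= cE /bnext /= (nth_map k) ?index_mem // nth_index.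
Qed.
Definition bcode i (j : J i) : nat :=
  if pselect (bcl j) is left e then pickle (projT1 (cid e)) else 0%N.
Lemma bcode_inj i (j : J i) i' (j' : J i') : bcl j -> bcl j' ->
  bcode j = bcode j' -> existT (fun i => J i : Type) i j = existT _ i' j'.
Proof.
rewrite /bcode; case: pselect => // e _; case: pselect => // e' _.
case: (cid e) => c cE; case: (cid e') => c' cE' /(pcan_inj pickleK) /= cc.
by rewrite -cE -cE' cc.
Qed.
End Closure.

(** Partial null-homotopies, defined on closed sets of basis elements. Values off the set are
    arbitrary, so extension is only a preorder. *)
Definition zok (p : bset * bhom) :=
  bclosed p.1 /\ forall i x, inb p.1 x -> f i x = tr (bh p.2) x.
Definition zt := {p : bset * bhom | zok p}.
Definition zB (p : zt) : bset := (sval p).1.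
Definition zs (p : zt) : bhom := (sval p).2.
Arguments zB : clear implicits.
Arguments zs : clear implicits.
Definition zle (p q : zt) := `[< (forall i j, zB p i j -> zB q i j) /\
  (forall i j, zB p i j -> zs q i j = zs p i j) >].

Fact z0_ok : zok (fun _ _ => False, fun _ _ => 0).
Proof.
split=> // i x xB; have -> : x = 0.
  by apply: frm_ext => j; apply/eqP/negPn/negP => /xB.
by rewrite linear0 -[RHS]trcE linear0.
Qed.

Section ZUnion.
Variables (A : set zt) (p0 : zt) (Ap0 : A p0) (Atot : total_on A zle).
Definition zuB : bset := fun i j => exists2 p, A p & zB p i j.
Definition zus : bhom := fun i j =>
  if pselect (exists p, A p /\ zB p i j) is left e then zs (projT1 (cid e)) i j else 0.

Arguments zus : clear implicits.
Lemma zusE p i j : A p -> zB p i j -> zus i j = zs p i j.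
Proof.
move=> Ap pj; rewrite /zus; case: pselect => [e|[]]; last by exists p.
case: (cid e) => q [Aq qj] /=.
have [/asboolP[_ h]|/asboolP[_ h]] := Atot Ap Aq; first exact: h.
exact/esym/h.
Qed.

Lemma zu_in i (x : frm R (J i)) : inb zuB x -> exists2 p, A p & inb (zB p) x.
Proof.
move=> xB; have : forall s : seq (J i), (forall j, j \in s -> zuB j) ->
    exists2 p, A p & forall j, j \in s -> zB p i j.
  elim=> [|j s IH] sB; first by exists p0.
  have [|p Ap ps] := IH; first by move=> k ks; apply: sB; rewrite in_cons ks orbT.
  have [q Aq qj] := sB j (mem_head _ _).
  have [/asboolP[h _]|/asboolP[h _]] := Atot Ap Aq.
    by exists q => // k; rewrite in_cons => /orP[/eqP -> //|/ps/h].
  by exists p => // k; rewrite in_cons => /orP[/eqP ->|/ps //]; exact: h.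
move=> /(_ (suppl x))[j|p Ap ps]; first by rewrite mem_suppl => /xB.
by exists p => // j xj; apply: ps; rewrite mem_suppl.
Qed.

Lemma zu_ok : zok (zuB, zus).
Proof.
split=> [i j [p Ap pj] m k jk|i x /zu_in[p Ap px]].
  by exists p => //; have [pc _] := svalP p; exact: (pc _ _ pj _ _ jk).
have [pc pE] := svalP p; rewrite (pE _ _ px); apply: eq_bigr => n _.
rewrite /tr_term; congr (dif _ _ _ _); apply/esym/(flin_eq (B := zB p _)).
  by move=> j pj; apply: zusE.
exact: (@inb_dif (zB p) pc i _ x px).
Qed.
End ZUnion.

(** A maximal partial null-homotopy is total: a missing basis element could be adjoined together
    with its closure, which adds only countably many elements. *)
Lemma based_null : nullh f.
Proof.
have [|||p pmax] := @ZL_preorder zt (exist _ _ z0_ok) zle.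
- by move=> p; apply/asboolP.
- move=> p q r /asboolP[pq pqs] /asboolP[qr qrs]; apply/asboolP; split=> i j pj.
    exact/qr/pq.
  by rewrite qrs ?pqs //; exact: pq.
- move=> A Atot; have [[p0 Ap0]|A0] := pselect (exists p, A p); last first.
    by exists (exist _ _ z0_ok) => p Ap; case: A0; exists p.
  exists (exist _ _ (zu_ok Ap0 Atot)) => p Ap; apply/asboolP; split=> i j pj.
    by exists p.
  exact: (zusE Atot Ap pj).
have [pc pE] := svalP p.
exists (bh (zs p)) => i x; apply: (pE i x) => j _; apply: contrapT => pj.
pose t0 : {i & J i} := existT _ i j.
pose C : bset := fun k l => zB p k l \/ bcl t0 l.
have Cc : bclosed C.
  move=> k l [kl|kl] m n ln; [left|right]; first exact: (pc _ _ kl _ _ ln).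
  exact: (bcl_closed kl ln).
have BC k l : zB p k l -> C k l by left.
have nuI k (l : J k) k' (l' : J k') : C k l -> ~ zB p k l -> C k' l' -> ~ zB p k' l' ->
    bcode t0 l = bcode t0 l' -> existT (fun i => J i : Type) k l = existT _ k' l'.
  by move=> [//|ll] _ [//|ll'] _; exact: bcode_inj.
have [s' [s'B s'E]] := bstep pc Cc BC nuI pE.
have s'ok : zok (C, s') by [].
have /asboolP[h _] : zle (exist _ _ s'ok) p.
  by apply: pmax; apply/asboolP; split.
by apply: pj; apply: h; right; exists [::].
Qed.

End Based.

(** * Null-homotopy of maps from complexes of projectives to flat objects *)

Section FlatPerp.
Variables (N : nat) (R : pzRingType).
Hypothesis N0 : (0 < N)%N.
Local Notation cx := (cx N R).

Definition perp (Y : cx) := forall P : cx, (forall i, projective (P i)) ->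
  forall f : chom P Y, nullh f.

(* P is a retract of the degreewise free complex P + P', where the complement
   P' has zero differentials. *)
Section FreeHull.
Variables (P : cx) (Pp : forall i, projective (P i)).
Let J i : choiceType := P i.
Let ev i : {linear frm R (J i) -> P i} := flin (fun x : J i => x : P i).

Fact ev_section i : exists k : {linear P i -> frm R (J i)}, forall x, ev i (k x) = x.
Proof.
have [|k kE] := @Pp i _ _ (ev i) idfun; last by exists k.
by move=> y; exists (frb R (y : J i)); rewrite /ev flin_b.
Qed.
Let ks i := projT1 (cid (ev_section i)).
Let evk i x : ev i (ks i x) = x. Proof. exact: (projT2 (cid (ev_section i)) x). Qed.

(** In the encoding by all composites, a zero differential is still the identity from a degree to
    itself. *)
Definition cst (i j : int) : {linear frm R (J i) -> frm R (J j)} :=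
  if i =P j is ReflectT e then ecast l {linear frm R (J i) -> frm R (J l)} e idfun
  else \0.
Lemma cst_id i x : cst i i x = x.
Proof. by rewrite /cst; case: eqP => // e; rewrite (eq_axiomK e). Qed.
Lemma cst_neq (i j : int) x : i != j -> cst i j x = 0.
Proof. by rewrite /cst; case: eqP. Qed.

Definition hD (i j : int) : {linear frm R (J i) -> frm R (J j)} :=
  (ks j \o (dif P i j \o ev i)) \+ (cst i j \o (idfun \- (ks i \o ev i))).
Lemma hDE (i j : int) x : hD i j x = ks j (dif P i j (ev i x)) + cst i j (x - ks i (ev i x)).
Proof. by []. Qed.
Lemma ev_hD (i j : int) x : ev j (hD i j x) = dif P i j (ev i x).
Proof.
rewrite hDE (linearD (ev j)) evk; have [<-|ij] := eqVneq i j.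
  by rewrite cst_id linearB evk subrr addr0.
by rewrite cst_neq // linear0 addr0.
Qed.
Fact hD_comp (i j k : int) x : i <= j -> j <= k -> hD j k (hD i j x) = hD i k x.
Proof.
move=> ij jk; rewrite [LHS]hDE ev_hD dif_comp // [RHS]hDE; congr (_ + _).
rewrite [hD i j x]hDE addrC addKr.
have [e|nij] := eqVneq i j; first by subst j; rewrite cst_id.
rewrite (cst_neq _ nij) linear0 cst_neq //.
by apply: contraNneq nij => ik; rewrite eq_le ij ik jk.
Qed.
Fact hD_out (i j : int) x : ~~ ((i <= j) && (j < i + N%:Z)) -> hD i j x = 0.
Proof.
move=> ij; rewrite hDE dif_out // linear0 add0r cst_neq //.
by apply: contraNneq ij => <-; rewrite lexx; lia.
Qed.
Fact hD_id i x : hD i i x = x.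
Proof. by rewrite hDE dif_id cst_id addrC subrK. Qed.

Lemma projective_null (Y : cx) (f : chom P Y) : flatobj Y -> nullh f.
Proof.
move=> Yf; pose F := bcx hD_comp hD_out hD_id.
have evD i j x : ev j (dif F i j x) = dif P i j (ev i x) by exact: ev_hD.
have ksD i j x : ks j (dif P i j x) = dif F i j (ks i x).
  by rewrite -[RHS]/(hD i j (ks i x)) hDE !evk subrr linear0 addr0.
pose p : chom F P := @CHom N R F P ev evD; pose s : chom P F := @CHom N R P F ks ksD.
have := based_null N0 Yf (ccomp f p).
move/(nullh_compr s); apply: nullh_eq => i x.
by rewrite 2!ccompE; congr (f i _); exact: evk.
Qed.
End FreeHull.

Lemma flatobj_perp (Y : cx) : flatobj Y -> perp Y.
Proof. by move=> Yf P Pp f; exact: projective_null. Qed.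

End FlatPerp.

(** * Recovering all composites from one-step differentials *)

Section FromNComplex.
Variables (N : nat) (R : pzRingType).
Local Notation C := (lmod_cat R).
Local Notation cx := (cx N R).

Lemma chom_steps (A B : cx) (f : gmap A B) :
  (forall i x, f (i + 1) (dif A i (i + 1) x) = dif B i (i + 1) (f i x)) ->
  forall i j x, f j (dif A i j x) = dif B i j (f i x).
Proof.
move=> fD i j x; have [ij|ij] := boolP (i <= j); last first.
  by rewrite !(@dif_out _ _ _ i j) ?(negPf ij) // linear0.
have [r rE] : exists r : nat, j = i + r%:Z by exists (absz (j - i)%R); lia.
subst j; elim: r {ij} => [|r IH]; first by rewrite addr0 !dif_id.
have e : i + r.+1%:Z = i + r%:Z + 1 by lia.
rewrite e -(@dif_comp _ _ A i (i + r%:Z)); [|lia|lia].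
by rewrite fD IH dif_comp; [|lia|lia].
Qed.

Lemma dpow_cast (X : int -> C) d r (i i' j : int) (p : i = i')
    (e : i' + r%:Z = j) (e' : i + r%:Z = j) :
  Defs.pcomp (dpow (X := X) d e) (deg_cast X p) = dpow d e'.
Proof.
case: _ / p e => e; rewrite /deg_cast /= (eq_irrelevance e e').
exact: (pcompm1 (p := C)).
Qed.

Lemma dpow_comp (X : int -> C) d r1 r2 (i j k : int) (e1 : i + r1%:Z = j)
    (e2 : j + r2%:Z = k) (e : i + (r1 + r2)%N%:Z = k) :
  Defs.pcomp (dpow (X := X) d e2) (dpow d e1) = dpow d e.
Proof.
elim: r1 i e1 e => [|r IH] i e1 e; first exact: dpow_cast.
have h := IH (i + 1) (shift_step e1) (shift_step e).
rewrite -[dpow d e1]/(Defs.pcomp (dpow d (shift_step e1)) (d i)).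
by rewrite (pcompA (p := C)) h.
Qed.

Variable X : ncomplex N C.

Lemma dpowN r (i j : int) (e : i + r%:Z = j) : (N <= r)%N -> dpow (ndiff X) e = 0.
Proof.
move=> Nr; have e' : i + (N + (r - N))%N%:Z = j by rewrite subnKC.
have -> : dpow (ndiff X) e = dpow (ndiff X) e'.
  by move: e'; rewrite subnKC // => e'; rewrite (eq_irrelevance e e').
have e2 : i + N%:Z + (r - N)%N%:Z = j by lia.
by rewrite -(dpow_comp _ (erefl (i + N%:Z)) e2) ndiffN (pcomp0r (C := C)).
Qed.

Definition nc_car (i : int) : lmodType R := X i.
(** The equation tested fails exactly for [j < i]; from [i + N] on, the composite is 0 by
    [dpowN]. *)
Definition nc_dif (i j : int) : {linear nc_car i -> nc_car j} :=
  if pselect (i + (absz (j - i)%R)%:Z = j) is left e then dpow (ndiff X) e else \0.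

Lemma nc_difE r (i j : int) (e : i + r%:Z = j) : nc_dif i j = dpow (ndiff X) e.
Proof.
have rE : absz (j - i)%R = r by lia.
rewrite /nc_dif; case: pselect => [e'|[]]; last by rewrite rE.
by move: e'; rewrite rE => e'; rewrite (eq_irrelevance e' e).
Qed.

Fact nc_comp (i j k : int) x : i <= j -> j <= k ->
  nc_dif j k (nc_dif i j x) = nc_dif i k x.
Proof.
move=> ij jk; have e1 : i + (absz (j - i)%R)%:Z = j by lia.
have e2 : j + (absz (k - j)%R)%:Z = k by lia.
have e : i + (absz (j - i)%R + absz (k - j)%R)%N%:Z = k by lia.
by rewrite (nc_difE e1) (nc_difE e2) (nc_difE e) -(dpow_comp _ e1 e2).
Qed.

Fact nc_out (i j : int) x : ~~ ((i <= j) && (j < i + N%:Z)) -> nc_dif i j x = 0.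
Proof.
move=> ij; rewrite /nc_dif; case: pselect => // e; rewrite dpowN //; lia.
Qed.

Fact nc_id i x : nc_dif i i x = x.
Proof.
rewrite (nc_difE (r := 0) (addr0 i)) /= /deg_cast.
by rewrite (eq_irrelevance (etrans _ _) erefl).
Qed.

Definition of_nc : cx := Cx nc_comp nc_out nc_id.

Lemma of_nc_diff i x : dif of_nc i (i + 1) x = ndiff X i x.
Proof.
rewrite -[LHS]/(nc_dif i (i + 1) x) (nc_difE (r := 1) (erefl (i + 1))) /= /deg_cast.
by rewrite (eq_irrelevance (etrans _ _) erefl).
Qed.

End FromNComplex.

Lemma frm_hom_ext (R : pzRingType) (J : choiceType) (V : lmodType R)
    (f g : {linear frm R J -> V}) :
  (forall j, f (frb R j) = g (frb R j)) -> forall x, f x = g x.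
Proof.
move=> fg x; have [s xs] := frm_supp x.
rewrite (frm_sum (undup_uniq s) (cov_undup xs)) !linear_sum.
by apply: eq_bigr => j _; rewrite !linearZZ fg.
Qed.

Lemma flatobj_ff (N : nat) (R : pzRingType) (I : finType) (deg : I -> int) :
  flatobj (ff N R deg).
Proof. by move=> J d g n x gx; exists I, deg, g, (idc _). Qed.

(** A disk on a free module is the sum of disks on R over a basis; only the retraction from that sum
    of finite free complexes is needed. *)
Lemma disk_flatobj (N : nat) (R : pzRingType) (T : choiceType) (deg : T -> int)
    (K : T -> choiceType) : (0 < N)%N -> flatobj (disk N deg (fun t => frm R (K t))).
Proof.
move=> N0; pose D := disk N deg (fun t => frm R (K t)).
pose d (p : {t : T & K t}) (_ : unit) := deg (tag p).
pose tk t (k : K t) : {t : T & K t} := existT _ t k.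
pose e t : {linear frm R (K t) -> cds (fun p => ff N R (d p)) (deg t)} :=
  flin (fun k => cdin (fun p => ff N R (d p)) (tk t k) (deg t) (fgen N R (d (tk t k)) tt)).
pose p : chom (cds (fun p => ff N R (d p))) D := cdmap (fun q =>
  ffmap (deg := d q) (fun _ : unit => dgen N deg _ (tag q) (frb R (tagged q)))).
apply: (@flatobj_retract N R _ D (dmap e) p); last first.
  by apply: flatobj_cds => // q; exact: flatobj_ff.
apply: (disk_hom_ext N0 (f := ccomp p (dmap e)) (g := idc D)) => t v.
rewrite ccompE dmap_gen //.
apply: (frm_hom_ext (f := p (deg t) \o e t) (g := dgen N deg _ t)) => k.
rewrite -[LHS]/(p (deg t) (e t (frb R k))) /e flin_b /p cdmap_in.
exact: (ffmap_gen N0 (fun _ : unit => dgen N deg _ t (frb R k))).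
Qed.

(** * A criterion for flat objects *)

Lemma frm_projective (R : pzRingType) (J : choiceType) : projective (frm R J).
Proof.
move=> M M' g h gs; pose y j := projT1 (cid (gs (h (frb R j)))).
exists (flin y); apply: (frm_hom_ext (f := g \o flin y)) => j.
by rewrite -[LHS]/(g (flin y (frb R j))) flin_b; exact: (projT2 (cid (gs _))).
Qed.

Lemma In_mapE (T : eqType) T' (h : T -> T') z (l : seq T) :
  List.In z (map h l) <-> exists2 t, t \in l & z = h t.
Proof.
split.
  elim: l => [//|u l IH] /= uz; case: uz => [<-|zl]; first by exists u; rewrite ?mem_head.
  by have [t tl ->] := IH zl; exists t => //; rewrite in_cons tl orbT.
move=> [t tl ->]; elim: l tl => [//|u l IH]; rewrite in_cons => /orP[/eqP ->|tl].
  by left.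
by right; exact: IH.
Qed.

Section PerpFlat.
Variables (N : nat) (R : pzRingType).
Hypothesis N0 : (0 < N)%N.
Local Notation cx := (cx N R).
Variables (Y : cx) (Yf : forall i, eqflat (Y i)).
Variables (I : finType) (deg : I -> int) (g : chom (ff N R deg) Y).
Variables (n0 : int) (x : ff N R deg n0).
Hypothesis gx : g n0 x = 0.
Local Notation F := (ff N R deg).

Definition fcoord_fun i (v : F i) : frm R I :=
  mksub (S := frsm R I) (proj1 (sub_mem v)).
Fact fcoord_linear i : linear (@fcoord_fun i).
Proof. by move=> a v w; apply: sub_ext. Qed.
Definition fcoord i : {linear F i -> frm R I} := mklin (@fcoord_linear i).
(* A finite free approximation of Y in one degree: g factors through it via
   stc, and a pending pair (v, t) is an element to be killed t steps later. *)
Record state := State {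
  lev : int; stK : finType; gam : {linear frm R stK -> Y lev};
  stc : {linear F lev -> frm R stK}; pend : seq (frm R stK * nat) }.

Definition state_ok (s : state) := [/\ forall z, gam s (stc s z) = g _ z,
  forall p, p \in pend s -> dif Y (lev s) (lev s + p.2%:Z) (gam s p.1) = 0,
  stc s (dif F n0 (lev s) x) = 0 &
  forall k, (frb R k, N) \in pend s].

Definition state_rel (s s' : state) := lev s' = lev s + 1 /\
  exists de : {linear frm R (stK s) -> frm R (stK s')},
  [/\ forall v, gam s' (de v) = dif Y (lev s) (lev s') (gam s v),
    forall z, stc s' (dif F (lev s) (lev s') z) = de (stc s z),
    forall v, (v, 1%N) \in pend s -> de v = 0 &
    forall v t, (v, t.+2) \in pend s -> (de v, t.+1) \in pend s'].

Let egen (p : I) (i : int) : F i := dif F (deg p) i (fgen N R deg p).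

Lemma F_sum i (z : F i) : z = \sum_p (sub_val z p : R) *: egen p i.
Proof. exact: ff_sum. Qed.

Lemma frm_fsum (K : finType) (v : frm R K) : v = \sum_k (sub_val v k : R) *: frb R k.
Proof.
have vs : cov (enum K) (sub_val v) by move=> k; rewrite mem_enum.
by rewrite {1}(frm_sum (enum_uniq K) vs) big_enum.
Qed.

Lemma flin_fsum (K : finType) (V : lmodType R) (h : K -> V) (v : frm R K) :
  flin h v = \sum_k (sub_val v k : R) *: h k.
Proof.
have vs : cov (enum K) (sub_val v) by move=> k; rewrite mem_enum.
by rewrite (flinE _ (enum_uniq K) vs) big_enum.
Qed.

(** In degree i + 1 consider the images of the old basis and of the generators of F. Finitely many
    relations among them are required and all hold in Y, so flatness of that degree realises them in
    a finite free module. *)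
Lemma state_step (s : state) : state_ok s -> exists2 s', state_ok s' & state_rel s s'.
Proof.
case: s => i K ga c pe [gaE' peE' cx0' _]; pose i' : int := i + 1.
have gaE z : ga (c z) = g i z := gaE' z.
have peE (p : frm R K * nat) : p \in pe -> dif Y i (i + p.2%:Z) (ga p.1) = 0 := peE' p.
have cx0 : c (dif F n0 i x) = 0 := cx0'.
move=> {gaE' peE' cx0'}.
pose m (e : K + I) : Y i' :=
  match e with inl k => dif Y i i' (ga (frb R k)) | inr p => g i' (egen p i') end.
(* [r1] kills the pending elements that are due, [r2] makes the maps from F commute with the
   differentials, and [r3] sends x to 0. *)
pose r1 (v : frm R K) (e : K + I) : R := if e is inl k then sub_val v k else 0.
pose r2 (p : I) (e : K + I) : R := match e with
  | inl k => sub_val (c (egen p i)) k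
  | inr q => - (sub_val (dif F i i' (egen p i)) q : R) end.
pose r3 (e : K + I) : R := if e is inr p then sub_val (dif F n0 i' x) p else 0.
pose rs := r3 :: [seq r1 p.1 | p <- pe & p.2 == 1%N] ++ [seq r2 p | p <- enum I].
have sum1 (v : frm R K) : \sum_k (sub_val v k : R) *: m (inl k) = dif Y i i' (ga v).
  rewrite {2}(frm_fsum v) !linear_sum; apply: eq_bigr => k _.
  by rewrite !linearZZ.
have sum2 (z : F i') : \sum_p (sub_val z p : R) *: m (inr p) = g i' z.
  by rewrite {2}(F_sum z) linear_sum; apply: eq_bigr => p _; rewrite linearZZ.
have rs0 r : List.In r rs -> \sum_e r e *: m e = 0.
  move=> rr; have [rE|rr1] : r3 = r \/ List.In r ([seq r1 p.1 | p <- pe & p.2 == 1%N] ++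
      [seq r2 p | p <- enum I]) by exact: rr.
    rewrite -rE sum_sumType.
    rewrite [X in X + _]big1 ?add0r => [|k _]; last by rewrite scale0r.
    by apply: etrans (sum2 (dif F n0 i' x)) _; rewrite cmapD gx linear0.
  case: (List.in_app_or _ _ _ rr1) => /In_mapE; last first.
    move=> [p _ ->]; rewrite sum_sumType (sum1 (c (egen p i))) gaE.
    under [X in _ + X]eq_bigr do rewrite scaleNr.
    by rewrite sumrN (sum2 (dif F i i' (egen p i))) cmapD subrr.
  move=> [[v t]]; rewrite mem_filter => /andP[/= /eqP -> vp] ->; rewrite sum_sumType.
  rewrite [X in _ + X]big1 ?addr0 => [|k _]; last by rewrite scale0r.
  by apply: etrans (sum1 v) _; exact: (peE _ vp).
have [K' [m' [a [mE aE]]]] := eqflat_seq (@Yf i') rs0.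
pose A (e : K + I) : frm R K' := \sum_j a e j *: frb R j.
have gA e : flin m' (A e) = m e.
  by rewrite mE linear_sum; apply: eq_bigr => j _; rewrite linearZZ flin_b.
have sumA r : List.In r rs -> \sum_e r e *: A e = 0.
  move=> rr; under eq_bigr do rewrite scaler_sumr.
  rewrite exchange_big big1 // => j _.
  by under eq_bigr do rewrite scalerA; rewrite -scaler_suml aE // scale0r.
pose de : {linear frm R K -> frm R K'} := flin (fun k => A (inl k)).
pose c' : {linear F i' -> frm R K'} := flin (fun p => A (inr p)) \o fcoord i'.
have c'E z : c' z = \sum_p (sub_val z p : R) *: A (inr p).
  by rewrite -[LHS]/(flin (fun p => A (inr p)) (fcoord i' z)) flin_fsum.
(* Older dates come one step nearer, and fresh basis elements fall due after N steps; this yields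
   d^N = 0. *)
pose pe' := [seq (de p.1, p.2.-1) | p <- pe & (1 < p.2)%N] ++ [seq (frb R k, N) | k <- enum K'].
have gde v : flin m' (de v) = dif Y i i' (ga v).
  rewrite -sum1 [de v]flin_fsum linear_sum; apply: eq_bigr => k _.
  by rewrite linearZZ gA.
exists (@State i' K' (flin m') c' pe').
  split.
  - move=> z; rewrite -[LHS]/(flin m' (c' z)) c'E linear_sum -[RHS]sum2.
    by apply: eq_bigr => p _; rewrite linearZZ gA.
  - move=> p; rewrite -[pend _]/pe' mem_cat => /orP[/mapP[[v t]]|/mapP[k _ ->]]; last first.
      by rewrite -[(_, N).2]/N dif_out //; rewrite -[lev _]/i'; lia.
    rewrite mem_filter => /andP[]; rewrite -[(v, t).2]/t => t1 vt pE.
    rewrite -[lev _]/i' -[gam _]/(flin m').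
    have [-> ->] : p.1 = de v /\ p.2 = t.-1 by rewrite pE.
    rewrite gde dif_comp; [|lia|lia].
    have -> : i' + t.-1%:Z = i + t%:Z by rewrite /i'; lia.
    exact: (peE _ vt).
  - have := sumA r3 (or_introl erefl).
    rewrite sum_sumType [X in X + _]big1 ?add0r => [|k _]; last by rewrite scale0r.
    by move=> <-; exact: c'E.
  - by move=> k; rewrite -[pend _]/pe' mem_cat; apply/orP; right; apply: map_f; rewrite mem_enum.
split=> //; exists de; split; first exact: gde.
- move=> z; rewrite -[lev _]/i' -[lev _]/i -[stc _]/c' -[stc _]/c.
  rewrite (F_sum z) !linear_sum; apply: eq_bigr => p _; rewrite !linearZZ.
  congr (_ *: _); apply/eqP; rewrite eq_sym -subr_eq0; apply/eqP.
  have := sumA (r2 p) (or_intror (List.in_or_app _ _ _ (or_intror (proj2 (In_mapE _ _ _) (ex_intro2 _ _ p (mem_enum I p) erefl))))).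
  rewrite sum_sumType; under [X in _ + X]eq_bigr do rewrite scaleNr.
  by rewrite sumrN /de flin_fsum c'E.
- move=> v; rewrite -[pend _]/pe => v1.
  have vin : (v, 1%N) \in [seq p <- pe | p.2 == 1%N] by rewrite mem_filter v1.
  have := sumA (r1 v) (or_intror (List.in_or_app _ _ _ (or_introl (proj2 (In_mapE (fun p => r1 p.1) _ _) (ex_intro2 _ _ (v, 1%N) vin erefl))))).
  rewrite sum_sumType [X in _ + X]big1 ?addr0 => [|k _]; last by rewrite scale0r.
  by rewrite /de flin_fsum.
- move=> v t vt; rewrite -[pend _]/pe' mem_cat; apply/orP; left.
  by apply/mapP; exists (v, t.+2) => //; rewrite mem_filter.
Qed.


Definition triv (i : int) : state := @State i void (\0) (\0) [::].

(** F has finitely many generators, so it vanishes in low degrees and the recursion can start from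
    zero states. *)
Fact lower_bound : exists a : int, forall p, a < deg p.
Proof.
have : forall s : seq I, exists a : int, forall p, p \in s -> a < deg p.
  elim=> [|p s [a aP]]; first by exists 0.
  exists (Order.min a (deg p - 1)) => q; rewrite in_cons => /orP[/eqP ->|/aP]; lia.
by move/(_ (enum I)) => [a aP]; exists a => p; apply: aP; rewrite mem_enum.
Qed.
Let a := projT1 (cid lower_bound).
Fact ff_low i (z : F i) : i <= a -> z = 0.
Proof.
move=> ia; rewrite (F_sum z) big1 // => p _; rewrite /egen dif_out ?scaler0 //.
by have := projT2 (cid lower_bound) p; rewrite -/a; lia.
Qed.

Fact triv_ok i : i <= a -> state_ok (triv i).
Proof. by move=> ia; split=> // z; rewrite (ff_low z ia) !linear0. Qed.
Fact triv_rel i : i < a -> state_rel (triv i) (triv (i + 1)).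
Proof.
move=> ia; split=> //; exists (\0).
by split=> // v; rewrite [RHS]linear0.
Qed.

Fixpoint stseq (k : nat) : {s | state_ok s} :=
  if k is k'.+1 then let h := cid2 (state_step (svalP (stseq k'))) in
    exist _ (s2val h) (s2valP h)
  else exist _ (triv a) (triv_ok (lexx a)).
Lemma stseq_rel k : state_rel (sval (stseq k)) (sval (stseq k.+1)).
Proof. exact: (s2valP' (cid2 (state_step (svalP (stseq k))))). Qed.

Definition st (i : int) : state := if i < a then triv i else sval (stseq (absz (i - a)%R)).
Lemma st_ok i : state_ok (st i).
Proof.
by rewrite /st; case: ifP => [ia|_]; [apply: triv_ok; exact: ltW | exact: (svalP (stseq _))].
Qed.
Lemma st_rel i : state_rel (st i) (st (i + 1)).
Proof.
rewrite /st; case: (ltP i a) => ia; last first.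
  have -> : (i + 1 < a) = false by lia.
  have -> : absz (i + 1 - a)%R = (absz (i - a)%R).+1 by lia.
  exact: stseq_rel.
case: ltP => ia1; first exact: triv_rel.
have e : i + 1 = a by lia.
by rewrite e subrr -[sval _]/(triv a) -e; exact: triv_rel.
Qed.
Lemma st_lev i : lev (st i) = i.
Proof.
rewrite /st; case: (ltP i a) => // ia.
have {2}-> : i = a + (absz (i - a)%R)%:Z by lia.
elim: (absz _) => [|k IH]; first by rewrite addr0.
by apply: etrans (proj1 (stseq_rel k)) _; rewrite IH; lia.
Qed.

Let de i := projT1 (cid (proj2 (st_rel i))).
Let deP i := projT2 (cid (proj2 (st_rel i))).

Lemma pend_kill t i j (e : i + t.+1%:Z = j) v : (v, t.+1) \in pend (st i) ->
  dpow (C := lmod_cat R) (X := fun i => frm R (stK (st i))) de e v = 0.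
Proof.
elim: t i e v => [|t IH] i e v vp; last first.
  by have [_ _ _ /(_ _ _ vp)] := deP i; exact: IH.
have [_ _ /(_ _ vp) v0 _] := deP i.
rewrite -[LHS]/(dpow (C := lmod_cat R) (X := fun i => frm R (stK (st i))) de (shift_step e) (de i v)).
by rewrite [de i v]v0 linear0.
Qed.

Fact appr_N i : dpow (C := lmod_cat R) (X := fun i => frm R (stK (st i))) de
  (erefl (i + N%:Z)) = 0.
Proof.
apply: linear_eqP; apply: (frm_hom_ext (g := \0)) => k.
have [_ _ _ /(_ k)] := st_ok i.
by move: (erefl _); rewrite -(prednK N0) => e; exact: pend_kill.
Qed.

Definition appr : ncomplex N (lmod_cat R) :=
  @NComplex N (lmod_cat R) (fun i => frm R (stK (st i))) de appr_N.
Let Q := of_nc appr.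

(** The level of [st i] equals i only propositionally; differentials between equal degrees serve as
    casts. *)
Definition appr_h_fun i : {linear Q i -> Y i} := dif Y (lev (st i)) i \o gam (st i).
Fact appr_h_D i v :
  appr_h_fun (i + 1) (dif Q i (i + 1) v) = dif Y i (i + 1) (appr_h_fun i v).
Proof.
rewrite of_nc_diff -[LHS]/(dif Y _ _ (gam _ (de i v))).
have [-> _ _ _] := deP i.
by rewrite -[in RHS]/(dif Y _ _ (gam _ v)) !dif_comp ?st_lev //; lia.
Qed.
Definition appr_h : chom Q Y := CHom (chom_steps appr_h_D).

Definition appr_c_fun i : {linear F i -> Q i} := stc (st i) \o dif F i (lev (st i)).
Fact appr_c_D i z :
  appr_c_fun (i + 1) (dif F i (i + 1) z) = dif Q i (i + 1) (appr_c_fun i z).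
Proof.
rewrite of_nc_diff -[RHS]/(de i (stc _ (dif F _ _ z))).
have [_ <- _ _] := deP i.
by rewrite -[LHS]/(stc _ (dif F (i + 1) _ (dif F _ _ _))) !dif_comp ?st_lev //; lia.
Qed.
Definition appr_c : chom F Q := CHom (chom_steps appr_c_D).

Lemma appr_hc i z : appr_h i (appr_c i z) = g i z.
Proof.
rewrite -[LHS]/(dif Y _ _ (gam _ (stc _ (dif F _ _ z)))).
by have [-> _ _ _] := st_ok i; rewrite cmapD dif_comp ?st_lev // dif_id.
Qed.

(** The approximation is a complex of projectives, so its map to Y is null and extends over its
    hull. The hull is a sum of disks on free modules, hence a flat object, and x is already 0
    there. *)
Lemma perp_factors : perp Y -> factors g x.
Proof.
move=> Yp; have [|e eE] := nullh_iota (Yp Q _ appr_h).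
  by move=> i; exact: frm_projective.
have cx0 : ccomp (ciota Q) appr_c n0 x = 0.
  rewrite ccompE -[appr_c n0 x]/(stc _ (dif F _ _ x)).
  by have [_ _ -> _] := st_ok n0; rewrite linear0.
have If : flatobj (inj_hull Q).
  exact: (@disk_flatobj N R int _ (fun i => stK (st i)) N0).
apply: factors_eq (factors_comp e (If _ _ _ _ _ cx0)) => i z.
by rewrite 2!ccompE eE appr_hc.
Qed.

End PerpFlat.

Lemma perp_flatobj (N : nat) (R : pzRingType) (Y : cx N R) : (0 < N)%N ->
  (forall i, flat (Y i)) -> perp Y -> flatobj Y.
Proof.
by move=> N0 Yf Yp I deg g n x gx; apply: perp_factors => // i; exact: flat_eqflat.
Qed.

(** * Closure properties *)

Lemma projective_retract (R : pzRingType) (M P : lmodType R) (i : {linear M -> P})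
    (p : {linear P -> M}) : (forall x, p (i x) = x) -> projective P -> projective M.
Proof.
move=> pi Pp U V g h gs; have [k kE] := Pp _ _ g (h \o p) gs.
by exists (k \o i) => x; rewrite -[LHS]/(g (k (i x))) kE -[LHS]/(h (p (i x))) pi.
Qed.

Section FlatClosure.
Variables (N : nat) (R : pzRingType).
Hypothesis N0 : (0 < N)%N.
Local Notation cx := (cx N R).

Lemma disk_projective (I : choiceType) (deg : I -> int) (M : I -> lmodType R) n :
  (forall i, projective (M i)) -> projective (disk N deg M n).
Proof.
move=> Mp U V g h gs; pose D := disk N deg M.
pose j i : {linear M i -> D n} := dif D (deg i) n \o dgen N deg M i.
pose k i := projT1 (cid (@Mp i _ _ g (h \o j i) gs)).
have kE i x : g (k i x) = h (j i x) := projT2 (cid (@Mp i _ _ g (h \o j i) gs)) x.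
have kL : linear (fun v : D n => fsum k (sub_val v)).
  by move=> a v w; rewrite /= fsumP //; [case: (sub_mem v) | case: (sub_mem w)].
exists (mklin kL) => v; have [[s vs] _] := sub_mem v.
rewrite mklinE (fsumE _ (undup_uniq s) (cov_undup vs)).
rewrite [in RHS](disk_sum N0 (undup_uniq s) (cov_undup vs)) !linear_sum.
by apply: eq_bigr => i _; rewrite kE.
Qed.

(** In degree n the hull is the finite sum of X n, ..., X (n + N - 1). *)
Lemma inj_hull_flat (X : cx) n : (forall i, flat (X i)) -> flat (inj_hull X n).
Proof.
move=> Xf; pose deg (i : int) := i - N%:Z + 1; pose D := inj_hull X.
apply: (@flat_sum R (D n) 'I_N (fun k => X (n + k%:Z)) (fun k => dcomp N deg X n _)
  (fun k => dif D (deg (n + k%:Z)) n \o dgen N deg X _)) => // v.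
rewrite {1}(@disk_sum N R int deg X N0 n v [seq n + (k : 'I_N)%:Z | k <- enum 'I_N]).
- by rewrite big_map big_enum.
- by rewrite map_inj_uniq ?enum_uniq // => i k ik; apply: ord_inj; lia.
move=> i iN; apply: disk_out; apply: contra iN; rewrite /deg => win.
have iN : (absz (i - n)%R < N)%N by lia.
apply/mapP; exists (Ordinal iN); first by rewrite mem_enum.
by rewrite -[nat_of_ord _]/(absz (i - n)%R); lia.
Qed.

Lemma inj_hull_flatobj (X : cx) : (forall i, flat (X i)) -> flatobj (inj_hull X).
Proof.
move=> Xf; apply: perp_flatobj => // [i|P _ f]; first exact: inj_hull_flat.
exact: contr_to (inj_hull_contr X).
Qed.

Lemma flatobj_cprod (A B : cx) : flatobj A -> flatobj B -> flatobj (cprod A B).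
Proof.
move=> Af Bf I deg g n x gx.
have gA : ccomp (cfst A B) g n x = 0 by rewrite ccompE gx linear0.
have gB : ccomp (csnd A B) g n x = 0 by rewrite ccompE gx linear0.
apply: factors_eq (factorsD N0
  (factors_comp (cpair (idc A) (c0 A B)) (Af _ _ _ _ _ gA))
  (factors_comp (cpair (c0 B A) (idc B)) (Bf _ _ _ _ _ gB))) => i z.
rewrite caddE !ccompE; case: (g i z) => a b.
by rewrite -[LHS]/(a + 0, 0 + b) addr0 add0r.
Qed.

(** Composed with the contractible cover of Q, f lifts to w with values in B. On the syzygy w takes
    values in A, and this map to A becomes null in B; the hypothesis makes it null in A, so w can be
    corrected to descend to Q. *)
Lemma cok_lift (A B Q : cx) (m : chom A B) (r : gmap B A)
    (rm : forall i x, r i (m i x) = x) (f : chom Q (cok rm)) :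
  (forall i, projective (Q i)) ->
  (forall (O : cx) (a : chom O A), (forall i, projective (O i)) ->
    nullh (ccomp m a) -> nullh a) ->
  exists g : chom Q B, forall i x, cokc rm i (g i x) = f i x.
Proof.
move=> Qp Ap; pose O := scx (ker_sc (csig Q)).
pose om : chom O (prj_cover Q) := scincl (ker_sc (csig Q)).
have Op i : projective (O i).
  apply: (projective_retract (@pker_retrK N R N0 Q i)).
  exact: disk_projective.
have [w _ wE] := nullh_lift (p := cokc rm) (q := cokj r) (cokc_j rm)
  (contr_from (ccomp f (csig Q)) (prj_cover_contr Q)).
have om0 i z : csig Q i (om i z) = 0 by exact: (sub_mem z).
have minj i x : m i x = 0 -> x = 0 by move=> mx; rewrite -(rm i x) mx linear0.
have [|a aE] := chom_factor (t := ccomp w om) minj.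
  move=> i z; exists (r i (w i (om i z))); rewrite ccompE -(cokc_eq0 (rm := rm)) //.
  by rewrite wE ccompE om0 linear0.
have a0 : nullh a.
  apply: Ap => //; apply: (nullh_eq (f := ccomp w om)) => [i x|].
    exact: esym (aE i x).
  by apply: nullh_compr; exact: contr_from (prj_cover_contr Q).
have [n [g gE]] := pker_descend N0 aE a0.
exists g => i x; rewrite -{1}(csig_sec x N0) gE csubE ccompE linearB cokc_m subr0 wE.
by rewrite ccompE csig_sec.
Qed.

Lemma perp_cok (A B : cx) (m : chom A B) (r : gmap B A)
    (rm : forall i x, r i (m i x) = x) : perp A -> perp B -> perp (cok rm).
Proof.
move=> Ap Bp Q Qp f.
have [|g gE] := cok_lift f Qp; first by move=> O a Op _; exact: Ap.
exact: (nullh_eq (f := ccomp (cokc rm) g)) gE (nullh_compl _ (Bp Q Qp g)).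
Qed.

Lemma cok_flat (A B : cx) (m : chom A B) (r : gmap B A)
    (rm : forall i x, r i (m i x) = x) i : flat (B i) -> flat (cok rm i).
Proof.
exact: (@flat_retract _ _ _ (@cokj _ _ _ _ r i) (@cokpi _ _ _ _ m r rm i) (@cokpi_j _ _ _ _ m r rm i)).
Qed.

Lemma flatobj_cok (A B : cx) (m : chom A B) (r : gmap B A)
    (rm : forall i x, r i (m i x) = x) : flatobj A -> flatobj B -> flatobj (cok rm).
Proof.
move=> Af Bf; apply: perp_flatobj => // [i|].
  by apply: cok_flat; exact: flatobj_flat.
by apply: perp_cok; exact: flatobj_perp.
Qed.

Definition susp (X : cx) := cok (@iretrK N R X).
Definition spi (X : cx) : chom (inj_hull X) (susp X) := cokc (@iretrK N R X).

Lemma flatobj_susp (X : cx) : flatobj X -> flatobj (susp X).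
Proof.
move=> Xf; apply: flatobj_cok => //; apply: inj_hull_flatobj => i.
exact: flatobj_flat.
Qed.

(* E is a direct summand of B + inj_hull A, into which f becomes a degreewise
   split mono with a strict retraction. *)
Lemma htpy_complement (A B : cx) (f : chom A B) (r : chom B A) :
  flatobj A -> flatobj B -> hteq (ccomp r f) (idc A) ->
  exists (E : cx) (k : chom E B) (p : chom B E), [/\ flatobj E,
    hteq (ccomp p k) (idc E) & hteq (ccomp k p) (csub (idc B) (ccomp f r))].
Proof.
move=> Af Bf rf; pose J := inj_hull A; pose D := cprod B J.
pose m : chom A D := cpair f (ciota A).
pose mr : gmap D A := fun i => @iretr N R A i \o csnd B J i.
have mrK i x : mr i (m i x) = x by exact: (@iretrK N R A i x).
have [|r' r'r r'm] := strict_retr (r := ccomp r (cfst B J)) mrK.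
  by apply: nullh_eq rf.
pose E := scx (ker_sc r').
pose t : chom D D := csub (idc D) (ccomp m r').
have tE i x : ker_sc r' i (t i x).
  have : r' i (t i x) = 0 by rewrite csubE ccompE linearB r'm subrr.
  by [].
pose q : chom D E := sccor tE; pose jE : chom E D := scincl (ker_sc r').
have qj i x : q i (jE i x) = x.
  apply: sub_ext; rewrite -[LHS]/(t i (jE i x)) csubE ccompE.
  by have -> : r' i (jE i x) = 0 by [exact: (sub_mem x)]; rewrite linear0 subr0.
pose k := ccomp (cfst B J) jE; pose p := ccomp q (cpair (idc B) (c0 B J)).
exists E, k, p; split.
- apply: (@flatobj_retract N R D E jE q qj); apply: flatobj_cprod => //.
  by apply: inj_hull_flatobj => i; exact: flatobj_flat.
(* The identity of E minus [p k] is the part of E that passes through the contractible summand J. *)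
- pose c := ccomp (csnd B J) jE; pose z := ccomp q (cpair (c0 J B) (idc J)).
  have c0 : nullh (ccomp z c) by apply: nullh_compr; exact: contr_from (inj_hull_contr A).
  apply: nullh_eq (nullhB (nullh0 E E) c0) => i x.
  rewrite !csubE sub0r -[idc E i x]/x -[X in _ - X](qj i x) /p /k /z /c !ccompE.
  rewrite -[LHS](linearN (q i)) -[RHS](linearB (q i)).
  by case: (jE i x) => b j; congr (q i _); congr pair; rewrite /= ?subrr ?oppr0 ?sub0r.
(* Here [k p] is strictly 1 - f r' on B, and r' is homotopic to r after projection to B. *)
- have := nullh_compl f (nullh_compr (cpair (idc B) (c0 B J)) r'r).
  move/(nullhB (nullh0 B B)); apply: nullh_eq => i x.
  rewrite !csubE sub0r !ccompE csubE !ccompE linearB.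
  pose u := f i (r' i (x, 0)); pose w := f i (r i x).
  rewrite -[LHS]/(- (u - w)) -[RHS]/((x - u) - (x - w)) opprB.
  by rewrite [in RHS](opprB x w) [RHS]addrC addrA subrK.
Qed.

End FlatClosure.

(** * Splitting homotopy idempotents *)

Section Idempotents.
Variables (N : nat) (R : pzRingType).
Hypothesis N0 : (0 < N)%N.
Local Notation cx := (cx N R).

Lemma c0E (X Y : cx) i x : c0 X Y i x = 0. Proof. by []. Qed.
Lemma idcE (X : cx) i x : idc X i x = x. Proof. by []. Qed.

Lemma hteqD (X Y : cx) (f f' g g' : chom X Y) :
  hteq f f' -> hteq g g' -> hteq (cadd f g) (cadd f' g').
Proof.
move=> ff' gg'; apply: nullh_eq (nullhD ff' gg') => i x.
by rewrite !caddE !csubE !caddE opprD addrACA.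
Qed.

Lemma hteqB (X Y : cx) (f f' g g' : chom X Y) :
  hteq f f' -> hteq g g' -> hteq (csub f g) (csub f' g').
Proof.
move=> ff' gg'; apply: nullh_eq (nullhB ff' gg') => i x.
by rewrite !csubE !opprD addrACA.
Qed.

(** The extensions over the hulls of the summands assemble to an extension over the sum of hulls,
    which is contractible. *)
Lemma nullh_cds (I : choiceType) (X : I -> cx) (Y : cx) (f : chom (cds X) Y) :
  (forall i, nullh (ccomp f (cdin X i))) -> nullh f.
Proof.
move=> f0; pose h i := projT1 (cid (nullh_iota (f0 i))).
have hE i n x : h i n (ciota (X i) n x) = f n (cdin X i n x) :=
  projT2 (cid (nullh_iota (f0 i))) n x.
pose J i := inj_hull (X i).
pose j : chom (cds X) (cds J) := cdmap (fun i => ccomp (cdin J i) (ciota (X i))).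
apply: (nullh_eq (f := ccomp (cdmap h) j)).
  apply: (cds_hom_ext (f := ccomp (cdmap h) j)) => i n x.
  by rewrite ccompE /j cdmap_in ccompE cdmap_in hE.
apply: nullh_compr; apply: contr_from; apply: cds_contr => i.
exact: inj_hull_contr.
Qed.

Lemma hteq_cds (I : choiceType) (X : I -> cx) (Y : cx) (f g : chom (cds X) Y) :
  (forall i, hteq (ccomp f (cdin X i)) (ccomp g (cdin X i))) -> hteq f g.
Proof. by move=> fg; apply: nullh_cds => i; exact: nullh_eq (fg i). Qed.

(* With A = W^(nat) and in_n : W -> A, the map m = 1 - e + e (shift) has the
   homotopy retraction r = 1 - e + e (unshift), with complement e W in degree 0. *)
Section Split.
Variables (W : cx) (e : chom W W).
Hypotheses (Wf : flatobj W) (ee : hteq (ccomp e e) e).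
Let A : cx := cds (fun _ : nat => W).
Let ins n : chom W A := cdin (fun _ : nat => W) n.
Let prev n : chom W A := if n is n'.+1 then ins n' else c0 W A.
Let e' := csub (idc W) e.
Let m : chom A A := cdmap (fun n => cadd (ccomp (ins n) e') (ccomp (ins n.+1) e)).
Let r : chom A A := cdmap (fun n => cadd (ccomp (ins n) e') (ccomp (prev n) e)).

Fact idem_e'e : hteq (ccomp e' e) (c0 W W).
Proof.
apply: nullh_eq (nullhB (nullh0 W W) ee) => i x.
by rewrite !csubE !ccompE csubE !c0E idcE sub0r subr0 opprB.
Qed.
Fact idem_ee' : hteq (ccomp e e') (c0 W W).
Proof.
apply: nullh_eq idem_e'e => i x.
by rewrite !csubE !ccompE !csubE linearB.
Qed.
Fact idem_e'e' : hteq (ccomp e' e') e'.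
Proof.
apply: nullh_eq (nullhB (nullh0 W W) idem_e'e) => i x.
by rewrite !csubE !ccompE !csubE !c0E !idcE subr0 sub0r [RHS]addrC addKr (linearB (e i)).
Qed.

Fact split_pr0 i x : cdp (fun _ : nat => W) 0%N i (ins 0%N i x) = x.
Proof. exact: cdin_eq. Qed.
Fact split_prS n i x : cdp (fun _ : nat => W) 0%N i (ins n.+1 i x) = 0.
Proof. exact: cdin_neq. Qed.
Fact split_m n i x : m i (ins n i x) = ins n i (e' i x) + ins n.+1 i (e i x).
Proof. by rewrite /m cdmap_in. Qed.
Fact split_r n i x : r i (ins n i x) = ins n i (e' i x) + prev n i (e i x).
Proof. by rewrite /r cdmap_in. Qed.

(** The mixed terms e (1 - e) are null, and (1 - e)^2 + e^2 is homotopic to 1. *)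
Fact split_rm : hteq (ccomp r m) (idc A).
Proof.
apply: hteq_cds => n.
pose a := cadd (ccomp (ins n) e') (ccomp (prev n) (c0 W W)).
pose b := cadd (ccomp (ins n.+1) (c0 W W)) (ccomp (ins n) e).
apply: (hteq_trans (g := cadd a b)); last first.
  apply: hteq_eq => i x; rewrite !caddE !ccompE csubE linear0 [ins _ _ (c0 W W _ _)]linear0.
  by rewrite addr0 add0r linearB subrK.
apply: (hteq_trans (g := cadd (cadd (ccomp (ins n) (ccomp e' e')) (ccomp (prev n) (ccomp e e')))
    (cadd (ccomp (ins n.+1) (ccomp e' e)) (ccomp (ins n) (ccomp e e))))).
  apply: hteq_eq => i x; rewrite 2!ccompE split_m linearD !split_r.
  by rewrite !caddE !ccompE.
by apply: hteqD; apply: hteqD; apply: hteq_compl;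
  [exact: idem_e'e'|exact: idem_ee'|exact: idem_e'e|].
Qed.

Let th : chom A A := ccomp (ins 0%N) (ccomp e (cdp (fun _ : nat => W) 0%N)).

Fact split_mr : hteq (csub (idc A) (ccomp m r)) th.
Proof.
apply: hteq_cds => n.
apply: (hteq_trans (g := csub (ins n) (cadd (ccomp (ins n) e') (if n is _.+1 then ccomp (ins n) e else c0 W A)))); last first.
  apply: hteq_eq => i x; rewrite csubE caddE /th !ccompE csubE linearB.
  case: n => [|n]; last by rewrite split_prS !linear0 ccompE idcE subrK subrr.
  by rewrite split_pr0 c0E idcE addr0 opprB addrC subrK.
apply: (hteq_trans (g := csub (ins n) (ccomp (ccomp m r) (ins n)))); first exact: hteq_eq.
apply: hteqB; first exact: hteq_eq.
pose b := cadd (ccomp (prev n) (ccomp e' e)) (if n is _.+1 then ccomp (ins n) (ccomp e e) else c0 W A).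
apply: (hteq_trans (g := cadd (cadd (ccomp (ins n) (ccomp e' e')) (ccomp (ins n.+1) (ccomp e e'))) b)).
  apply: hteq_eq => i x; rewrite 2!ccompE split_r linearD split_m !caddE !ccompE.
  congr (_ + _); case: n @b => [|n] b; first by rewrite linear0 addr0.
  by rewrite [prev _]/(ins n) split_m !ccompE.
apply: (hteq_trans (g := cadd (cadd (ccomp (ins n) e') (ccomp (ins n.+1) (c0 W W)))
    (cadd (ccomp (prev n) (c0 W W)) (if n is _.+1 then ccomp (ins n) e else c0 W A)))).
  apply: hteqD; apply: hteqD; try (apply: hteq_compl).
  - exact: idem_e'e'.
  - exact: idem_ee'.
  - exact: idem_e'e.
  - by case: n @b => [|n] _; [exact: hteq_eq | exact: hteq_compl].
apply: hteq_eq => i x; rewrite !caddE !ccompE !c0E.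
by rewrite [ins _ _ 0]linear0 [prev n i _]linear0 add0r addr0.
Qed.

(** The complement E of m satisfies k p ~ 1 - m r ~ [th], which is e placed at index 0; restricting
    to that index splits e. *)
Lemma idem_split : exists (E : cx) (i : chom E W) (p : chom W E),
  [/\ flatobj E, hteq (ccomp i p) e & hteq (ccomp p i) (idc E)].
Proof.
have Af : flatobj A by exact: flatobj_cds.
have [E [k [p [Ef pk kp]]]] := htpy_complement N0 Af Af split_rm.
have {}kp := hteq_trans kp split_mr.
pose pr : chom A W := cdp (fun _ : nat => W) 0%N.
exists E, (ccomp e (ccomp pr k)), (ccomp p (ins 0%N)); split => //.
  apply: hteq_trans ee.
  have h := hteq_compr (ins 0%N) (hteq_compl (ccomp e pr) kp).
  apply: (hteq_trans (g := ccomp (ccomp (ccomp e pr) th) (ins 0%N))).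
    exact: nullh_eq h.
  by apply: hteq_eq => i x; rewrite !ccompE !split_pr0.
apply: (hteq_trans (g := ccomp (ccomp p th) k)).
  exact: hteq_eq.
apply: (hteq_trans (g := ccomp (ccomp p (ccomp k p)) k)).
  by apply: hteq_compr; apply: hteq_compl; exact: hteq_sym.
apply: (hteq_trans _ pk).
apply: (hteq_trans (g := ccomp (ccomp p k) (ccomp p k))); first exact: hteq_eq.
by apply: (hteq_trans (g := ccomp (ccomp p k) (idc E)));
  [exact: hteq_compl | exact: hteq_eq].
Qed.

End Split.
End Idempotents.

(** * Coreflection into flat objects *)

Section Pullback.
Variables (N : nat) (R : pzRingType) (A B C : cx N R) (f : chom A C) (g : chom B C).
Let df := csub (ccomp f (cfst A B)) (ccomp g (csnd A B)).
Definition pb : cx N R := scx (ker_sc df).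
Definition pb1 : chom pb A := ccomp (cfst A B) (scincl (ker_sc df)).
Definition pb2 : chom pb B := ccomp (csnd A B) (scincl (ker_sc df)).

Lemma pb_comm i x : f i (pb1 i x) = g i (pb2 i x).
Proof.
have : df i (scincl (ker_sc df) i x) = 0 by exact: (sub_mem x).
by move/eqP; rewrite /df csubE subr_eq0 => /eqP.
Qed.

Lemma pb_ext i (x y : pb i) : pb1 i x = pb1 i y -> pb2 i x = pb2 i y -> x = y.
Proof.
move=> xy1 xy2; apply: sub_ext; move: xy1 xy2.
rewrite -[pb1 i x]/((sub_val x).1) -[pb1 i y]/((sub_val y).1).
rewrite -[pb2 i x]/((sub_val x).2) -[pb2 i y]/((sub_val y).2).
by case: (sub_val x) (sub_val y) => [a b] [a' b'] /= -> ->.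
Qed.

Lemma pb_mem i a b : f i a = g i b -> exists x : pb i, pb1 i x = a /\ pb2 i x = b.
Proof.
move=> ab; have mem : ker_sc df i (a, b).
  by have : df i (a, b) = 0 by rewrite csubE !ccompE -[cfst _ _ _ _]/a -[csnd _ _ _ _]/b ab subrr.
by exists (mksub (S := ker_sm (df i)) mem).
Qed.

Section Lift.
Variables (Z : cx N R) (a : chom Z A) (b : chom Z B).
Hypothesis ab : forall i z, f i (a i z) = g i (b i z).
Fact pb_lift_mem i z : ker_sc df i (cpair a b i z).
Proof.
have : df i (cpair a b i z) = 0.
  by rewrite csubE !ccompE -[cfst _ _ _ _]/(a i z) -[csnd _ _ _ _]/(b i z) ab subrr.
by [].
Qed.
Definition pb_lift : chom Z pb := sccor pb_lift_mem.
Lemma pb1_lift i z : pb1 i (pb_lift i z) = a i z. Proof. by []. Qed.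
Lemma pb2_lift i z : pb2 i (pb_lift i z) = b i z. Proof. by []. Qed.
End Lift.
End Pullback.

Section Coreflection.
Variables (N : nat) (R : pzRingType).
Hypothesis N0 : (0 < N)%N.
Local Notation cx := (cx N R).

(* Neeman's argument: W -> X is a precover, W1 -> W a precover of its homotopy
   kernel, and C the cone of W1 -> W.  As C is flat, W -> X extends to C and
   then lifts to a : C -> W; the composite W -> C -> W is a homotopy idempotent,
   and its splitting E makes the lifts to X unique up to homotopy. *)
Lemma flat_coreflection (X : cx) : exists (E : cx) (p : chom E X), [/\ flatobj E,
  forall (Y : cx) (f : chom Y X), flatobj Y -> exists g, hteq (ccomp p g) f &
  forall (Y : cx) (g : chom Y E), flatobj Y -> nullh (ccomp p g) -> nullh g].
Proof.
pose W := precover X; pose p0 : chom W X := precover_map X.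
have Wf : flatobj W := @precover_flat N R N0 X.
(* A map to T is a map to W together with a lift of its composite with p0 to the contractible cover
   of X. By [nullh_lift] such lifts exist exactly for null composites, so T stands for the homotopy
   kernel. *)
pose T := pb (csig X) p0; pose W1 := precover T.
have W1f : flatobj W1 := @precover_flat N R N0 T.
pose u : chom W1 T := precover_map T; pose v := ccomp (pb2 (csig X) p0) u.
have vlift (Y : cx) (y : chom Y W) : flatobj Y -> nullh (ccomp p0 y) ->
    exists z : chom Y W1, forall i x, v i (z i x) = y i x.
  move=> Yf /(nullh_lift (fun i x => csig_sec x N0))[t _ tE].
  have [z zE] := precover_lift N0 (pb_lift (f := csig X) (g := p0) tE) Yf.
  by exists z => i x; rewrite /v ccompE zE pb2_lift.
have p0v : nullh (ccomp p0 v).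
  apply: (nullh_eq (f := ccomp (csig X) (ccomp (pb1 (csig X) p0) u))) => [i x|].
    by rewrite !ccompE pb_comm.
  by apply: nullh_compl; apply: contr_to (prj_cover_contr X).
have [ext extE] := nullh_iota p0v.
pose J := inj_hull W1; pose m : chom W1 (cprod W J) := cpair v (ciota W1).
pose r : gmap (cprod W J) W1 := fun i => @iretr N R W1 i \o csnd W J i.
have rm i x : r i (m i x) = x by exact: (@iretrK N R W1 i x).
pose C := cok rm.
have Cf : flatobj C.
  apply: flatobj_cok => //; apply: flatobj_cprod => //.
  by apply: inj_hull_flatobj => // i; exact: flatobj_flat.
pose b : chom W C := ccomp (cokc rm) (cpair (idc W) (c0 W J)).
pose q0 := csub (ccomp p0 (cfst W J)) (ccomp ext (csnd W J)).
have q0m i x : q0 i (m i x) = 0.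
  rewrite /q0 csubE !ccompE -[cfst _ _ _ _]/(v i x) -[csnd _ _ _ _]/(ciota W1 i x).
  by rewrite extE ccompE subrr.
pose q : chom C X := coklift rm q0m.
have qb i x : q i (b i x) = p0 i x.
  by rewrite /q /b ccompE cokliftE /q0 csubE !ccompE [X in _ - X]linear0 subr0.
have [a aE] := precover_lift N0 q Cf.
have {aE}p0a i x : p0 i (a i x) = q i x by exact: aE.
have bv : nullh (ccomp b v).
  pose j : chom J C := ccomp (cokc rm) (cpair (c0 J W) (idc J)).
  have j0 : nullh (ccomp j (ciota W1)) by apply: nullh_compr; exact: contr_from (inj_hull_contr W1).
  apply: nullh_eq (nullhB (nullh0 _ _) j0) => i x.
  apply/eqP; rewrite csubE c0E sub0r eq_sym -subr_eq0 opprK /b /j !ccompE -linearD.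
  rewrite -[X in cokc rm i X]/((v i x + 0, 0 + ciota W1 i x)) addr0 add0r.
  by rewrite -[X in cokc rm i X]/(m i x) cokc_m.
pose e := ccomp a b.
(* Strictly p0 e = p0, so e - 1 is killed by p0 and factors through v; since b v is null, b e is
   homotopic to b. *)
have [z zE] : exists z : chom W W1, forall i x, v i (z i x) = csub e (idc W) i x.
  apply: vlift => //; apply: nullh_eq (nullh0 _ _) => i x.
  by rewrite ccompE csubE linearB ccompE p0a qb subrr.
have be : hteq (ccomp b e) b.
  have bz i x : b i (v i (z i x)) = b i (e i x) - b i x.
    by rewrite zE csubE (linearB (b i)).
  by apply: nullh_eq (nullh_compr z bv) => i x; exact: bz.
have ee : hteq (ccomp e e) e.
  by apply: nullh_eq (nullh_compl a be) => i x; exact: (linearB (a i)).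
have [E [k [p [Ef kp pk]]]] := idem_split N0 Wf ee.
exists E, (ccomp p0 k); split=> // Y f Yf.
  have [y yE] := precover_lift N0 f Yf.
  exists (ccomp p y); apply: (hteq_trans (g := ccomp (ccomp p0 e) y)).
    by apply: nullh_eq (hteq_compr y (hteq_compl p0 kp)).
  by apply: hteq_eq => i x; rewrite !ccompE p0a qb yE.
(* Since p0 k f is null, k f factors through v, hence e k f = a b v y is null. With e ~ k p and p k
   ~ 1 this gives back f. *)
move=> fn; have [y yE] := vlift _ (ccomp k f) Yf (nullh_eq (fun _ _ => erefl) fn).
have eknull : nullh (ccomp e (ccomp k f)).
  apply: (nullh_eq (f := ccomp a (ccomp (ccomp b v) y))) => [i x|].
    by rewrite 3!ccompE yE.
  by apply: nullh_compl; exact: nullh_compr.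
have knull : nullh (ccomp p (ccomp (ccomp k p) (ccomp k f))).
  by apply: nullh_compl; apply: hteq_nullh eknull; exact: hteq_compr.
apply: hteq_nullh knull; apply: hteq_sym.
apply: (hteq_trans (g := ccomp (idc E) f)); last exact: hteq_eq.
apply: (hteq_trans (g := ccomp (ccomp p k) f)); last exact: hteq_compr.
apply: (hteq_trans (g := ccomp (ccomp p k) (ccomp (ccomp p k) f))); first exact: hteq_eq.
apply: (hteq_trans (g := ccomp (idc E) (ccomp (ccomp p k) f))); first exact: hteq_compr.
exact: hteq_eq.
Qed.

End Coreflection.

(** * The homotopy fibre of the coreflection *)

Section Target.
Variables (N : nat) (R : pzRingType).
Hypothesis N0 : (0 < N)%N.
Local Notation cx := (cx N R).
Variables (X E : cx) (p : chom E (susp X)).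
Hypotheses (Ef : flatobj E)
  (p_surj : forall (Y : cx) (f : chom Y (susp X)), flatobj Y ->
     exists g, hteq (ccomp p g) f)
  (p_inj : forall (Y : cx) (g : chom Y E), flatobj Y -> nullh (ccomp p g) -> nullh g).

(* The homotopy fibre of p: 0 -> X -> target -> E -> 0 is degreewise split. *)
Definition target : cx := pb (spi X) p.
Let T := target.
Let t1 : chom T (inj_hull X) := pb1 (spi X) p.
Let t2 : chom T E := pb2 (spi X) p.

Fact tin_comm i x : spi X i (ciota X i x) = p i (c0 X E i x).
Proof. by rewrite c0E linear0; exact: cokc_m. Qed.
Definition tin : chom X T := pb_lift tin_comm.

Lemma tin_t2 i z : t2 i z = 0 -> exists x, tin i x = z.
Proof.
move=> z0; have : spi X i (t1 i z) = 0 by rewrite /t1 pb_comm -/t2 z0 linear0.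
move/cokc_eq0 => z1; exists (iretr X i (t1 i z)).
by apply: (@pb_ext N R _ _ _ (spi X) p); rewrite ?pb1_lift ?pb2_lift -?z1 //; exact: esym z0.
Qed.

Lemma tin_inj i x : tin i x = 0 -> x = 0.
Proof.
move=> x0; have : t1 i (tin i x) = 0 by rewrite x0 linear0.
by move=> /(congr1 (@iretr N R X i)); rewrite iretrK linear0.
Qed.

Fact tsec_ex i (b : E i) : exists z : T i, t1 i z = cokj (@iretr N R X) i (p i b) /\ t2 i z = b.
Proof. by apply: pb_mem; exact: cokc_j. Qed.
Let ts i b := projT1 (cid (@tsec_ex i b)).
Fact tsec1 i b : t1 i (ts b) = cokj (@iretr N R X) i (p i b).
Proof. by case: (projT2 (cid (@tsec_ex i b))). Qed.
Fact tsec2 i (b : E i) : t2 i (ts b) = b.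
Proof. by case: (projT2 (cid (@tsec_ex i b))). Qed.
Fact tsec_linear i : linear (fun b : E i => ts b : T i).
Proof.
move=> a x y; apply: (@pb_ext N R _ _ _ (spi X) p).
  by rewrite -/t1 linearP !tsec1 !linearP.
by rewrite -/t2 linearP !tsec2.
Qed.
Definition tsec : gmap E T := fun i => mklin (@tsec_linear i).
Lemma tsecK i b : t2 i (tsec i b) = b. Proof. exact: tsec2. Qed.

Lemma target_flat i : (forall i, flat (X i)) -> flat (T i).
Proof.
move=> Xf; pose al (b : bool) : {linear T i -> if b then X i else E i} :=
  if b return {linear T i -> if b then X i else E i} then iretr X i \o t1 i else t2 i.
pose be (b : bool) : {linear (if b then X i else E i) -> T i} :=
  if b return {linear (if b then X i else E i) -> T i} then tin i else tsec i.
apply: (@flat_sum R (T i) bool _ al be) => [z|[|]]; last 2 first.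
- exact: Xf.
- exact: flatobj_flat.
rewrite big_bool -[RHS]/(tin i (iretr X i (t1 i z)) + tsec i (t2 i z)).
apply: (@pb_ext N R _ _ _ (spi X) p); rewrite -/t1 -/t2 linearD; last first.
  by rewrite tsecK [X in X + _]pb2_lift add0r.
rewrite [t1 i (tsec _ _)]tsec1 [X in X + _]pb1_lift /t2 -pb_comm -/t1.
have -> : cokj (@iretr N R X) i (spi X i (t1 i z)) = t1 i z - ciota X i (iretr X i (t1 i z)) by [].
by rewrite addrC subrK.
Qed.

(** Extend k into the hull of X over B. The induced map from the flat cokernel to the suspension
    lifts to E up to homotopy, and correcting the extension by that homotopy gives a strict map to
    the pullback. *)
Lemma target_ext (A B : cx) (m : chom A B) (r : gmap B A)
    (rm : forall i x, r i (m i x) = x) (k : chom A X) : flatobj (cok rm) ->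
  exists g : chom B T, forall i x, g i (m i x) = tin i (k i x).
Proof.
move=> Cf.
have [b _ bE] := nullh_ext rm (contr_to (ccomp (ciota X) k) (inj_hull_contr X)).
have bm i x : ccomp (spi X) b i (m i x) = 0.
  by rewrite ccompE bE; exact: cokc_m.
have [l lE] := p_surj (coklift rm bm) Cf.
have [n _ nE] := nullh_lift (p := spi X) (q := cokj (@iretr N R X))
  (cokc_j (@iretrK N R X)) (hteq_sym lE).
pose b' := csub b (ccomp n (cokc rm)).
have b'E i y : spi X i (b' i y) = p i (ccomp l (cokc rm) i y).
  rewrite /b' csubE linearB ccompE nE csubE cokliftE !ccompE.
  by rewrite opprB addrC subrK.
exists (pb_lift b'E) => i x; apply: (@pb_ext N R _ _ _ (spi X) p).
  by rewrite !pb1_lift /b' csubE ccompE cokc_m linear0 subr0 bE.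
by rewrite !pb2_lift ccompE cokc_m linear0.
Qed.

Lemma target_ker (A : cx) (f : chom A T) : (forall i x, t2 i (f i x) = 0) ->
  exists k : chom A X, forall i x, tin i (k i x) = f i x.
Proof.
move=> f0; apply: chom_factor => [i x|i x]; first exact: tin_inj.
exact: tin_t2.
Qed.

Lemma target_htpy_ker (A : cx) (f : chom A T) : nullh (ccomp t2 f) ->
  exists k : chom A X, hteq f (ccomp tin k).
Proof.
move=> /(nullh_lift tsecK)[n n0 nE].
have [|k kE] := @target_ker A (csub f n).
  by move=> i x; rewrite csubE linearB nE ccompE subrr.
exists k; apply: nullh_eq n0 => i x.
by rewrite csubE ccompE kE csubE opprB addrC subrK.
Qed.

(** The component in E is null because p makes it pass through a contractible hull. So h comes from
    some k : C -> X up to homotopy, and [tin k] extends over the hull of C since the suspension of C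
    is flat. *)
Lemma nullh_flat_target (C : cx) (h : chom C T) : flatobj C -> nullh h.
Proof.
move=> Cf; have [|k kE] := @target_htpy_ker C h.
  apply: p_inj => //; apply: (nullh_eq (f := ccomp (spi X) (ccomp t1 h))) => [i x|].
    by rewrite 2!ccompE pb_comm.
  by apply: nullh_compl; exact: contr_to (inj_hull_contr X).
apply: hteq_nullh kE _.
have [g gE] := target_ext k (flatobj_susp N0 Cf).
apply: (nullh_eq (f := ccomp g (ciota C))) => [i x|]; first by rewrite ccompE gE.
by apply: nullh_compl; exact: contr_to (inj_hull_contr C).
Qed.

(** Extend [tin k] to g on the hull of P. The E-component of g factors through the suspension of P,
    is null there because E is a flat object, and can be removed from g; then k itself extends over
    the hull. *)
Lemma nullh_tin (P : cx) (k : chom P X) : (forall i, projective (P i)) ->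
  nullh (ccomp tin k) -> nullh k.
Proof.
move=> Pp /nullh_iota[g gE].
have gm i x : ccomp t2 g i (ciota P i x) = 0.
  by rewrite ccompE gE ccompE; exact: pb2_lift.
pose w := coklift (@iretrK N R P) gm.
have w0 : nullh w.
  apply: (flatobj_perp N0 Ef) => i.
  apply: (projective_retract (@cokpi_j _ _ _ _ _ _ (@iretrK N R P) i)).
  exact: disk_projective.
have [n _ nE] := nullh_lift tsecK w0.
have [|k' k'E] := @target_ker _ (csub g (ccomp n (spi P))).
  by move=> i x; rewrite csubE linearB ccompE nE /w cokliftE ccompE subrr.
apply: (nullh_eq (f := ccomp k' (ciota P))) => [i x|]; last first.
  by apply: nullh_compl; exact: contr_to (inj_hull_contr P).
apply/eqP; rewrite -subr_eq0; apply/eqP/tin_inj.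
by rewrite linearB ccompE k'E csubE gE !ccompE cokc_m linear0 subr0 subrr.
Qed.

Lemma tin_htpy_surj (P : cx) (f : chom P T) : (forall i, projective (P i)) ->
  exists k : chom P X, hteq f (ccomp tin k).
Proof.
by move=> Pp; apply: target_htpy_ker; exact: (flatobj_perp N0 Ef).
Qed.

(* The hypotheses make P a coreflection of Y into the complexes of projectives,
   so the cone of c receives only null maps from them: it is a flat object. *)
Section Counit.
Variables (P Y : cx) (c : chom P Y).
Hypotheses (Pp : forall i, projective (P i)) (Yf : forall i, flat (Y i)).
Hypotheses (c_surj : forall (Q : cx) (f : chom Q Y), (forall i, projective (Q i)) ->
    exists g : chom Q P, hteq (ccomp c g) f)
  (c_inj : forall (Q : cx) (g : chom Q P), (forall i, projective (Q i)) ->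
    nullh (ccomp c g) -> nullh g).
Let J := inj_hull P.
Let B := cprod Y J.
Let m : chom P B := cpair c (ciota P).
Let r : gmap B P := fun i => @iretr N R P i \o csnd Y J i.
Fact cone_rm i x : r i (m i x) = x. Proof. exact: (@iretrK N R P i x). Qed.
Let b1 : chom Y B := cpair (idc Y) (c0 Y J).
Let b2 : chom J B := cpair (c0 J Y) (idc J).
Fact cone_dec i (z : B i) : b1 i (cfst Y J i z) + b2 i (csnd Y J i z) = z.
Proof. by case: z => a b; rewrite -[LHS]/(a + 0, 0 + b) addr0 add0r. Qed.

(** A map from Q to the cone lifts to B by [c_inj]. By [c_surj] its Y-component comes from P up to
    homotopy; subtracting m times that map leaves both components null. *)
Fact cone_perp : perp (cok cone_rm).
Proof.
move=> Q Qp f; have [|g gE] := cok_lift N0 f Qp.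
  by move=> O a Op /(nullh_compl (cfst Y J)) m0; apply: c_inj.
have [h hE] := c_surj (ccomp (cfst Y J) g) Qp.
apply: (nullh_eq (f := ccomp (cokc cone_rm) (csub g (ccomp m h)))) => [i x|].
  by rewrite ccompE csubE linearB gE ccompE cokc_m subr0.
apply: nullh_compl.
apply: (nullh_eq (f := cadd (ccomp b1 (ccomp (cfst Y J) (csub g (ccomp m h))))
    (ccomp b2 (ccomp (csnd Y J) (csub g (ccomp m h)))))) => [i x|].
  by rewrite caddE; exact: cone_dec.
apply: nullhD; apply: nullh_compl; last exact: contr_to (inj_hull_contr P).
exact: nullh_eq (hteq_sym hE).
Qed.

Fact cone_flat : flatobj (cok cone_rm).
Proof.
apply: perp_flatobj => // [i|]; last exact: cone_perp.
apply: cok_flat; apply: (@flat_sum R (B i) bool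
  (fun b => if b then Y i else J i)
  (fun b => if b return {linear B i -> if b then Y i else J i} then cfst Y J i else csnd Y J i)
  (fun b => if b return {linear (if b then Y i else J i) -> B i} then b1 i else b2 i)) => [z|[|]].
- by rewrite big_bool; exact: esym (cone_dec z).
- exact: Yf.
- by apply: inj_hull_flat => // k; exact: projective_flat.
Qed.

(** Up to homotopy f is [tin k]. It extends over the cylinder object B because the cone of c is
    flat, and the restriction of the extension to Y is the map sought. *)
Lemma target_counit_surj (f : chom P T) : exists g : chom Y T, hteq (ccomp g c) f.
Proof.
have [k kE] := tin_htpy_surj f Pp.
have [g gE] := target_ext k cone_flat.
exists (ccomp g b1); apply: hteq_trans (hteq_sym kE).
have n0 : nullh (ccomp (ccomp g b2) (ciota P)).
  by apply: nullh_compl; exact: contr_to (inj_hull_contr P).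
apply: nullh_eq (nullhB (nullh0 P T) n0) => i x.
rewrite !csubE c0E sub0r !ccompE -gE -(cone_dec (m i x)) (linearD (g i)).
by rewrite opprD addrA subrr add0r.
Qed.

(** Correct g on B by a null map so that it vanishes on P; it then descends to the cone, a flat
    object, whose maps to T are null. *)
Lemma target_counit_inj (g : chom Y T) : nullh (ccomp g c) -> nullh g.
Proof.
move=> gc0; have gm : nullh (ccomp (ccomp g (cfst Y J)) m) by exact: nullh_eq gc0.
have [n n0 nE] := nullh_ext cone_rm gm.
have d0 i x : csub (ccomp g (cfst Y J)) n i (m i x) = 0 by rewrite csubE nE subrr.
have := nullh_compr (cokc cone_rm) (nullh_flat_target (coklift cone_rm d0) cone_flat).
move/(nullhD n0)/(nullh_compr b1); apply: nullh_eq => i x.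
by rewrite ccompE caddE ccompE cokliftE csubE addrC subrK.
Qed.

End Counit.
End Target.

(** * Universal arrows *)

Local Open Scope quotient_scope.
Local Notation hom := Defs.hom.
Local Notation comp := Defs.comp.

Section Universal.
Variables (C D : category) (F : functor C D).
Hypothesis univ : forall d : D, exists (c : C) (e : hom (F c) d),
  forall (x : C) (f : hom (F x) d), exists! g : hom x c, comp e (fmap F g) = f.

Let G d := projT1 (cid (univ d)).
Let univ' d : exists e : hom (F (G d)) d, forall (x : C) (f : hom (F x) d),
  exists! g : hom x (G d), comp e (fmap F g) = f := projT2 (cid (univ d)).
Let e d := projT1 (cid (univ' d)).
Fact eP d x (f : hom (F x) d) : exists! g : hom x (G d), comp (e d) (fmap F g) = f.
Proof. exact: (projT2 (cid (univ' d))). Qed.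
Let tr x d (f : hom (F x) d) := projT1 (cid (eP f)).
Fact trE x d (f : hom (F x) d) : comp (e d) (fmap F (tr f)) = f.
Proof. by case: (projT2 (cid (eP f))). Qed.
Fact tr_uniq x d (g : hom x (G d)) : tr (comp (e d) (fmap F g)) = g.
Proof. by case: (projT2 (cid (eP (comp (e d) (fmap F g))))) => _; apply. Qed.
Fact tr_inj x d (g h : hom x (G d)) :
  comp (e d) (fmap F g) = comp (e d) (fmap F h) -> g = h.
Proof. by move=> gh; rewrite -(tr_uniq g) gh tr_uniq. Qed.

Definition univ_functor : functor D C.
Proof.
refine (@Functor D C G (fun d d' v => tr (comp v (e d))) _ _).
- by move=> d; apply: tr_inj; rewrite trE fmap1 comp1m compm1.
- move=> d d' d'' g f; apply: tr_inj.
  by rewrite trE fmapM Defs.compA trE -[RHS]Defs.compA trE Defs.compA.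
Defined.

Lemma univ_right_adjoint : has_right_adjoint F.
Proof.
exists univ_functor; constructor.
refine (@Adjunction C D F univ_functor (fun x d f => tr f) _ _).
- move=> x d; exists (fun g => comp (e d) (fmap F g)) => [f|g]; first exact: trE.
  exact: tr_uniq.
- move=> x x' y y' u v f; apply: tr_inj.
  by rewrite trE !fmapM !Defs.compA trE -!Defs.compA [comp (e y) _]Defs.compA trE.
Qed.
End Universal.

(** * A criterion for a right adjoint to have a right adjoint *)

Section Coadjoint.
Variables (C D : category) (j : functor D C) (js : functor C D) (A : adjunction j js).

Lemma adj_inj x y (f g : hom (j x) y) : adj A f = adj A g -> f = g.
Proof. exact: (bij_inj (adj_bij A x y)). Qed.
Fact counit_ex (Y : C) : exists f : hom (j (js Y)) Y, adj A f = idm (js Y).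
Proof. by have [g _ gK] := adj_bij A (js Y) Y; exists (g (idm (js Y))). Qed.
Definition counit (Y : C) := projT1 (cid (counit_ex Y)).
Lemma adj_counit Y : adj A (counit Y) = idm (js Y).
Proof. exact: (projT2 (cid (counit_ex Y))). Qed.
Lemma adj_counit_comp Y P (u : hom P (js Y)) : adj A (comp (counit Y) (fmap j u)) = u.
Proof.
have := adj_nat A u (idm Y) (counit Y).
by rewrite !comp1m adj_counit fmap1 !comp1m.
Qed.
Lemma counit_nat Y Y' (v : hom Y Y') :
  comp v (counit Y) = comp (counit Y') (fmap j (fmap js v)).
Proof.
apply: adj_inj; rewrite adj_counit_comp.
have := adj_nat A (idm (js Y)) v (counit Y).
by rewrite fmap1 compm1 adj_counit !compm1.
Qed.
Lemma counit_lift Y P (f : hom (j P) Y) : comp (counit Y) (fmap j (adj A f)) = f.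
Proof. by apply: adj_inj; rewrite adj_counit_comp. Qed.

(** Maps js Y -> X correspond to maps j (js Y) -> T by the first bijection and to maps Y -> T by the
    second. The universal arrow js T -> X corresponds to the counit at T. *)
Lemma coadjoint :
  (forall X : D, exists (T : C) (t : hom (j X) T),
    (forall P (f : hom (j P) T), exists! u : hom P X, comp t (fmap j u) = f) /\
    (forall Y (f : hom (j (js Y)) T), exists! g : hom Y T, comp g (counit Y) = f)) ->
  has_right_adjoint js.
Proof.
move=> h; apply: univ_right_adjoint => X; have [T [t [h1 h2]]] := h X.
have [e [eE _]] := h1 _ (counit T); exists T, e => Y f.
have eq (g : hom Y T) : comp e (fmap js g) = f <-> comp g (counit Y) = comp t (fmap j f).
  have -> : comp g (counit Y) = comp t (fmap j (comp e (fmap js g))).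
    by rewrite counit_nat fmapM Defs.compA eE.
  split=> [->//|tf]; have [u [_ uu]] := h1 _ (comp t (fmap j f)).
  by rewrite -(uu f) // (uu _ tf).
have [g [gE gu]] := h2 _ (comp t (fmap j f)).
by exists g; split=> [|g']; [apply/eq | move/eq/gu].
Qed.
End Coadjoint.

(** * The homotopy category in terms of [cx] *)

Section Translation.
Variables (N : nat) (R : pzRingType) (Pr : lmodType R -> Prop).
Hypothesis N0 : (0 < N)%N.
Local Notation M := (lmod_cat R).
Local Notation C := (full_sub (C := M) Pr).
Implicit Types X Y Z : ncomplex N C.

Definition fgt : additive_functor C M :=
  @AdditiveFunctor C M (fun x => sval x) (fun x y f => f)
    (fun x => erefl) (fun x y z g f => erefl) (fun x y f g => erefl).
Definition ucx X : cx N R := of_nc (ncomplex_map fgt X).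

Lemma ucx_dif X r (i j : int) (e : i + r%:Z = j) (x : ucx X i) :
  dif (ucx X) i j x = (dpow (ndiff X) e : {linear _ -> _}) x.
Proof.
rewrite -[LHS]/(nc_dif (ncomplex_map fgt X) i j x) (nc_difE _ e).
by rewrite -(amap_dpow fgt).
Qed.

Lemma ucx_diff X i (x : ucx X i) :
  dif (ucx X) i (i + 1) x = (ndiff X i : {linear _ -> _}) x.
Proof. exact: of_nc_diff. Qed.

Fact uch_D X Y (f : nhom X Y) i (x : ucx X i) :
  (f (i + 1) : {linear ucx X (i + 1) -> ucx Y (i + 1)}) (dif (ucx X) i (i + 1) x) =
  dif (ucx Y) i (i + 1) ((f i : {linear ucx X i -> ucx Y i}) x).
Proof.
rewrite !ucx_diff; symmetry.
exact: (congr1 (fun g : {linear _ -> _} => g x) (nmapC f i)).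
Qed.
Definition uch X Y (f : nhom X Y) : chom (ucx X) (ucx Y) :=
  CHom (chom_steps (f := fun i => (f i : {linear ucx X i -> ucx Y i})) (uch_D f)).

Fact vch_C X Y (g : chom (ucx X) (ucx Y)) i :
  Defs.pcomp (ndiff Y i) (g i : phom (X i) (Y i)) =
  Defs.pcomp (g (i + 1) : phom (X (i + 1)) (Y (i + 1))) (ndiff X i).
Proof.
apply: linear_eqP => x; have := @cmapD _ _ _ _ g i (i + 1) x.
by rewrite !ucx_diff.
Qed.
Definition vch X Y (g : chom (ucx X) (ucx Y)) : nhom X Y := NHom (vch_C g).

Lemma lin_sumE (U V : lmodType R) n (f : 'I_n -> {linear U -> V}) x :
  (\sum_(i < n) f i) x = \sum_(i < n) f i x.
Proof. exact: (big_morph (fun g : {linear U -> V} => g x)). Qed.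

Lemma lin_subE (U V : lmodType R) (f g : {linear U -> V}) x : (f - g) x = f x - g x.
Proof. by []. Qed.

Lemma null_homotopicE X Y (f : nhom X Y) : null_homotopic f <-> nullh (uch f).
Proof.
have trE (s : hmap (ucx X) (ucx Y)) i (x : ucx X i) : tr s x =
    (\sum_(j < N) Defs.pcomp (dpow (ndiff Y) (htpy_index i j))
      (Defs.pcomp (s (i + j%:Z) : phom (X _) (Y _)) (dpow (ndiff X) (erefl (i + j%:Z)))) : {linear ucx X i -> ucx Y i}) x.
  rewrite /tr /wsum [RHS]lin_sumE; apply: eq_bigr => k _.
  by rewrite /tr_term (ucx_dif (htpy_index i k)) (ucx_dif (erefl (i + k%:Z))).
split=> -[s sE]; exists s => i.
  by move=> x; rewrite trcE trE -sE.
by apply: linear_eqP => x; have := sE i x; rewrite trcE trE.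
Qed.

Definition kcl X Y (g : chom (ucx X) (ucx Y)) : khom X Y := \pi_(khom X Y) (vch g).

Lemma kcl_surj X Y (f : khom X Y) : exists g, f = kcl g.
Proof.
have [{}f ->] := khomP f; exists (uch f); congr (\pi_ _ _).
by apply: nhomP.
Qed.

Lemma kcl_eq X Y (g h : chom (ucx X) (ucx Y)) : kcl g = kcl h <-> hteq g h.
Proof.
have E i x : uch (nsub (vch g) (vch h)) i x = csub g h i x.
  rewrite csubE; exact: lin_subE.
split=> [/eqmodP/asboolP/null_homotopicE n|n].
  exact: nullh_eq E n.
apply/eqmodP/asboolP/null_homotopicE.
exact: nullh_eq (fun i x => esym (E i x)) n.
Qed.

Lemma kcl_comp X Y Z (g : chom (ucx Y) (ucx Z)) (f : chom (ucx X) (ucx Y)) :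
  kcomp (kcl g) (kcl f) = kcl (ccomp g f).
Proof.
rewrite /kcl kcompE; apply: (congr1 (fun h => \pi_(khom X Z) h)).
apply: nhomP => i; transitivity (Defs.pcomp (vch g i) (vch f i)); first by [].
rewrite -[RHS]/(ccomp g f i); apply: linear_eqP => x.
by rewrite ccompE -[LHS]/(vch g i (vch f i x)).
Qed.

Section OfCx.
Variables (Z : cx N R) (ZP : forall i, Pr (Z i)).
Let zobj i : C := exist Pr (Z i) (ZP i).
Let zd i : phom (zobj i) (zobj (i + 1)) := dif Z i (i + 1).
Fact zdpow r (i j : int) (e : i + r%:Z = j) (x : Z i) :
  (dpow zd e : {linear Z i -> Z j}) x = dif Z i j x.
Proof.
elim: r i e x => [|r IH] i e x.
  rewrite /= /deg_cast; move: (etrans _ _) => {e} e'; case: _ / e'.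
  by rewrite dif_id.
rewrite -[LHS]/((dpow zd (shift_step e) : {linear _ -> _}) (dif Z i (i + 1) x)).
by rewrite IH dif_comp //; lia.
Qed.
Fact zdN i : dpow zd (erefl (i + N%:Z)) = 0.
Proof. by apply: linear_eqP => x; rewrite zdpow dif_out //; lia. Qed.
Definition ncx : ncomplex N C := NComplex zdN.
End OfCx.
End Translation.

Section NcxIso.
Variables (N : nat) (R : pzRingType).
Hypothesis N0 : (0 < N)%N.

Lemma ucx_iso (Pr : lmodType R -> Prop) (X : ncomplex N (full_sub (C := lmod_cat R) Pr))
    (Z : cx N R) (a : forall i, {linear Z i -> ucx X i}) (b : forall i, {linear ucx X i -> Z i}) :
  (forall i x, b i (a i x) = x) -> (forall i x, a i (b i x) = x) ->
  (forall i x, a (i + 1) (dif Z i (i + 1) x) = (ndiff X i : {linear _ -> _}) (a i x)) ->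
  exists (f : chom Z (ucx X)) (g : chom (ucx X) Z),
    (forall i x, g i (f i x) = x) /\ (forall i x, f i (g i x) = x).
Proof.
move=> ba ab aD.
have fD i x : a (i + 1) (dif Z i (i + 1) x) = dif (ucx X) i (i + 1) (a i x).
  by rewrite aD ucx_diff.
have gD i x : b (i + 1) (dif (ucx X) i (i + 1) x) = dif Z i (i + 1) (b i x).
  by rewrite -{1}(ab i x) -fD ba.
by exists (CHom (chom_steps fD)), (CHom (chom_steps gD)).
Qed.

(** Going back and forth recomputes all composites from the one-step differentials, so Z is
    recovered only up to isomorphism. *)
Lemma ncx_iso (Pr : lmodType R -> Prop) (Z : cx N R) (ZP : forall i, Pr (Z i)) :
  exists (f : chom Z (ucx (ncx N0 ZP))) (g : chom (ucx (ncx N0 ZP)) Z),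
    (forall i x, g i (f i x) = x) /\ (forall i x, f i (g i x) = x).
Proof. exact: (@ucx_iso Pr (ncx N0 ZP) Z (fun i => idfun) (fun i => idfun)). Qed.

Local Notation incl := (full_incl (C := lmod_cat R) (@projective_flat R)).

Lemma ncx_incl_iso (Z : cx N R) (ZP : forall i, projective (Z i)) :
  let X := ncomplex_map incl (ncx N0 ZP) in
  exists (f : chom Z (ucx X)) (g : chom (ucx X) Z),
    (forall i x, g i (f i x) = x) /\ (forall i x, f i (g i x) = x).
Proof.
exact: (@ucx_iso (@flat R) (ncomplex_map incl (ncx N0 ZP)) Z (fun i => idfun) (fun i => idfun)).
Qed.

Lemma incl_full (P X : ncomplex N (Prj R)) (f : khom (ncomplex_map incl P) (ncomplex_map incl X)) :
  exists u : khom P X, kmap incl u = f.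
Proof.
have [{}f ->] := khomP f.
pose u : nhom P X := @NHom N (Prj R) P X (fun i => f i) (nmapC f).
exists (\pi_(khom P X) u); rewrite kmapE.
by apply: (congr1 (fun h => \pi_(khom (ncomplex_map incl P) (ncomplex_map incl X)) h)); apply: nhomP.
Qed.

Lemma dpow_incl (X : ncomplex N (Prj R)) r (i k : int) (e : i + r%:Z = k) :
  dpow (ndiff (ncomplex_map incl X)) e = dpow (ndiff X) e.
Proof. exact: esym (amap_dpow incl (ndiff X) e). Qed.

Lemma incl_faithful (P X : ncomplex N (Prj R)) (u v : khom P X) :
  kmap incl u = kmap incl v -> u = v.
Proof.
have [{}u ->] := khomP u; have [{}v ->] := khomP v; rewrite !kmapE.
move=> /eqmodP/asboolP[s sE]; apply/eqmodP/asboolP; exists s => i.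
have E : nsub (nhom_map incl u) (nhom_map incl v) i = u i - v i by [].
have E' : nsub u v i = u i - v i by reflexivity.
refine (eq_trans E' (eq_trans (etrans (esym E) (sE i)) _)).
apply: eq_bigr => k _.
exact: (congr2 (fun a b => Defs.pcomp a (Defs.pcomp (s (i + k%:Z)) b))
  (dpow_incl X (htpy_index i k)) (dpow_incl P (erefl (i + k%:Z)))).
Qed.
End NcxIso.

(** * The right adjoint of the given functor *)

Section Adjoint.
Variables (N : nat) (R : pzRingType).
Hypothesis N0 : (0 < N)%N.
Local Notation incl := (full_incl (C := lmod_cat R) (@projective_flat R)).
Local Notation j := (j_shriek N R).
Variables (js : functor (K N (Flat R)) (K N (Prj R))) (A : adjunction j js).
Local Notation uF := (@ucx N R (@flat R)).

Fact uF_projective (P : ncomplex N (Prj R)) i : projective (uF (j P) i).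
Proof. exact: (svalP (P i)). Qed.

Section Counit.
Variables (Y : ncomplex N (Flat R)) (c : chom (uF (j (js Y))) (uF Y)).
Hypothesis cE : counit A Y = kcl c.

Lemma counit_surj (Q : cx N R) (f : chom Q (uF Y)) : (forall i, projective (Q i)) ->
  exists g : chom Q (uF (j (js Y))), hteq (ccomp c g) f.
Proof.
move=> Qp; have [a [b [ba ab]]] := ncx_incl_iso N0 Qp.
pose Q' : K N (Prj R) := ncx N0 Qp.
pose h : hom (j Q') Y := kcl (ccomp f b).
have [g gE] := kcl_surj (fmap j (adj A h)).
have := counit_lift A h; rewrite gE cE => /(etrans (esym (kcl_comp c g)))/kcl_eq cg.
exists (ccomp g a); apply: nullh_eq (nullh_compr a cg) => i x.
by rewrite ccompE !csubE !ccompE ba.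
Qed.

Lemma counit_inj (Q : cx N R) (g : chom Q (uF (j (js Y)))) :
  (forall i, projective (Q i)) -> nullh (ccomp c g) -> nullh g.
Proof.
move=> Qp cg; have [a [b [ba ab]]] := ncx_incl_iso N0 Qp.
pose Q' : K N (Prj R) := ncx N0 Qp.
have [u uE] := incl_full (P := Q') (X := js Y) (kcl (ccomp g b)).
have [v vE] := incl_full (P := Q') (X := js Y) (kcl (c0 _ _)).
have uv : u = v.
  have step (w : hom Q' (js Y)) h : fmap j w = kcl h ->
      comp (counit A Y) (fmap j w) = kcl (ccomp c h).
    by move=> wE; rewrite wE cE; exact: kcl_comp.
  have E : comp (counit A Y) (fmap j (u : hom Q' (js Y))) = comp (counit A Y) (fmap j v).
    apply: (etrans (step u _ uE)); apply: (etrans _ (esym (step v _ vE))).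
    apply/kcl_eq; apply: nullh_eq (nullh_compr b cg) => i x.
    by rewrite csubE !ccompE [X in _ - X]linear0 subr0.
  exact: etrans (esym (adj_counit_comp A u)) (etrans (congr1 _ E) (adj_counit_comp A v)).
have /kcl_eq gb : kcl (ccomp g b) = kcl (c0 _ _) by rewrite -uE -vE uv.
apply: nullh_eq (nullh_compr a gb) => i x.
by rewrite ccompE csubE ccompE ba [X in _ - X]c0E subr0.
Qed.

End Counit.

(** T is the homotopy fibre of the flat coreflection of the suspension of X. The adjunction enters
    only through its counits, which satisfy the two lifting properties of [counit_surj] and
    [counit_inj]; a and b transport maps between [target p] and the N-complex built from it. *)
Lemma jstar_coadjoint (X : K N (Prj R)) : exists (T : K N (Flat R)) (t : hom (j X) T),
  (forall P (f : hom (j P) T), exists! u : hom P X, comp t (fmap j u) = f) /\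
  (forall Y (f : hom (j (js Y)) T), exists! g : hom Y T, comp g (counit A Y) = f).
Proof.
pose Xc := uF (j X).
have [E [p [Ef ps pi]]] := flat_coreflection N0 (susp Xc).
have Tf i : flat (target p i).
  by apply: target_flat => // k; apply: projective_flat; exact: uF_projective.
have [a [b [ba ab]]] := ncx_iso N0 Tf.
pose T' : K N (Flat R) := ncx N0 Tf.
pose t : hom (j X) T' := kcl (ccomp a (tin p)).
exists T', t; split=> [P f|Y f].
- have [f0 fE] := kcl_surj f.
  have Pp : forall i, projective (uF (j P) i) := @uF_projective P.
  have [k kE] := tin_htpy_surj N0 Ef (ccomp b f0) Pp.
  have [u uE] := incl_full (P := P) (X := X) (kcl k).
  have tk : comp t (kcl k : hom (j P) (j X)) = f.
    rewrite fE /t [LHS](kcl_comp (ccomp a (tin p)) k); apply/kcl_eq.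
    apply: nullh_eq (nullh_compl a (hteq_sym kE)) => i x.
    by rewrite ccompE !csubE !ccompE linearB ab.
  exists u; split=> [|u' u'E]; first by rewrite [fmap j u]uE.
  apply: incl_faithful; rewrite uE.
  have [k' k'E] := kcl_surj (kmap incl u'); rewrite k'E; apply/kcl_eq.
  apply: (nullh_tin N0 Ef (p := p)) => //.
  have /kcl_eq/(nullh_compl b) : kcl (ccomp (ccomp a (tin p)) k) = kcl (ccomp (ccomp a (tin p)) k').
    by rewrite -!kcl_comp -k'E; apply: etrans tk _; exact: esym u'E.
  apply: nullh_eq => i x.
  by rewrite !ccompE !csubE !ccompE -linearB ba -linearB.
- have [f0 fE] := kcl_surj f; have [c cE] := kcl_surj (counit A Y).
  have Pp : forall i, projective (uF (j (js Y)) i) := @uF_projective (js Y).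
  have Yf i : flat (uF Y i) by exact: (svalP (Y i)).
  have cs := counit_surj cE; have ci := counit_inj cE.
  have [g gE] := target_counit_surj N0 Ef ps Pp Yf cs ci (ccomp b f0).
  have gc : comp (kcl (ccomp a g) : hom Y T') (counit A Y) = f.
    rewrite fE cE [LHS](kcl_comp (ccomp a g) c); apply/kcl_eq.
    apply: nullh_eq (nullh_compl a gE) => i x.
    by rewrite ccompE !csubE !ccompE linearB ab.
  exists (kcl (ccomp a g)); split=> // h hE.
  have [h0 hE0] := kcl_surj h; rewrite hE0; apply/kcl_eq.
  have /kcl_eq gh : kcl (ccomp (ccomp a g) c) = kcl (ccomp h0 c).
    rewrite -!kcl_comp -cE -hE0; exact: etrans gc (esym hE).
  have : nullh (ccomp (csub g (ccomp b h0)) c).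
    apply: nullh_eq (nullh_compl b gh) => i x.
    by rewrite !ccompE !csubE !ccompE linearB ba.
  move/(target_counit_inj N0 ps pi Pp Yf cs ci)/(nullh_compl a).
  apply: nullh_eq => i x; by rewrite ccompE !csubE !ccompE linearB ab.
Qed.

End Adjoint.

Local Close Scope ring_scope.

Theorem lemma4p5 (N : nat) (hN : 2 <= N) (R : pzRingType)
  (jstar : functor (K N (Flat R)) (K N (Prj R)))
  (jadj : adjunction (j_shriek N R) jstar) :
  has_right_adjoint jstar.
Proof.
exact: coadjoint (jstar_coadjoint (ltnW hN) jadj).
Qed.
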